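(* For every function $f\in H^{1}(\mathbb{R})$ and every $b\in\mathbb{R}$, $$\frac{1}{\pi}\int_{-\infty}^{\infty} f(x)\,\ln\frac{1}{|x-b|}\,dx=-\int_{-\infty}^{b}\tilde f(x)\,dx,$$ where $\tilde f$ is the Hilbert transform of $f$ and the integral on the left-hand side is understood via the $H^{1}$–$BMO(\mathbb{R})$ duality.
   Context: The Hilbert transform of $f\in L^{p}(\mathbb{R})$, $1\le p<\infty$, is $Hf(x)=\tilde f(x)=\frac{1}{\pi}\,\mathrm{p.v.}\int_{-\infty}^{\infty}\frac{f(t)}{x-t}\,dt$ (defined for a.e. $x$). The real Hardy space $H^{1}(\mathbb{R})$ consists of all $f\in L^{1}(\mathbb{R})$ such that $\tilde f\in L^{1}(\mathbb{R})$, with norm $\|f\|_{L^1}+\|\tilde f\|_{L^1}$. Its dual is $BMO(\mathbb{R})$, the space of functions of bounded mean oscillation; for each $b$ the function $x\mapsto \ln\frac{1}{|x-b|}$ is in $BMO(\mathbb{R})$. For $\psi\in BMO(\mathbb{R})$ and $f\in H^{1}(\mathbb{R})$, the expression $\int f\psi\,dx$ ''via duality'' means the value at $f$ of the unique continuous linear functional on $H^{1}(\mathbb{R})$ which is given by the ordinary Lebesgue integral $\int f\psi\,dx$ on the dense subspace of bounded, compactly supported $f$ with $\int f=0$. *)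

(* Defs.v *)
From mathcomp Require Import all_boot all_order all_algebra.
From mathcomp Require Import all_classical all_reals all_analysis.
Set Implicit Arguments.
Unset Strict Implicit.
Unset Printing Implicit Defensive.
Import Order.TTheory GRing.Theory Num.Theory.
Import numFieldNormedType.Exports.
Local Open Scope classical_set_scope.
Local Open Scope ring_scope.

(* Functions R -> R stand for their classes modulo a.e. equality; Lfun
   only holds Borel functions, and every class in L^1 contains one. *)
Section HardySpace.
Context {R : realType}.
Local Notation mu := (@lebesgue_measure R).
Implicit Types (f g psi : R -> R) (Lambda : (R -> R) -> R).

(* For integrable f the truncated integrals converge absolutely, so the
   principal value only concerns the singularity t = x. Where the limit does
   not exist, which for integrable f is a null set of x, lim returns a default
   value. *)
Definition hilbert f (x : R) : R :=
  pi^-1 * lim ((\int[mu]_(t in [set t | (e < `|x - t|)%R]) (f t / (x - t)))%R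
               @[e --> 0^'+]).

Definition H1 : set (R -> R) :=
  [set f | f \in Lfun mu 1 /\ hilbert f \in Lfun mu 1].

Definition H1norm f : \bar R :=
  ('N[mu]_1[EFin \o f] + 'N[mu]_1[EFin \o hilbert f])%E.

Definition BMO : set (R -> R) :=
  [set psi | locally_integrable setT psi /\
    exists M : R, forall a b : R, a < b ->
      let avg := (b - a)^-1 * \int[mu]_(x in `[a, b]) psi x in
      (b - a)^-1 * \int[mu]_(x in `[a, b]) `|psi x - avg| <= M].

(* Only the values of Lambda on H1 matter. Continuity for the H1 norm makes
   these values depend only on the a.e. class of the argument. *)
Definition H1_linear Lambda : Prop :=
  forall (a : R) f g, H1 f -> H1 g ->
    Lambda (fun x => a * f x + g x) = a * Lambda f + Lambda g.

Definition H1_continuous Lambda : Prop :=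
  forall f, H1 f -> forall e : R, 0 < e -> exists2 d : R, 0 < d &
    forall g, H1 g -> (H1norm (fun x => (g x - f x)%R) < d%:E)%E ->
      `|Lambda g - Lambda f| < e.

Definition H1_test : set (R -> R) :=
  [set g : R -> R | [/\ measurable_fun setT g,
               [bounded g x | x in setT],
               compact (closure [set x | g x != 0]) &
               \int[mu]_x g x = 0]].

Definition represents psi Lambda : Prop :=
  [/\ H1_linear Lambda, H1_continuous Lambda &
      forall g, H1_test g -> Lambda g = \int[mu]_x (g x * psi x)].

(* A definite description: by density of H1_test in H1, the set below has
   exactly one element when f is in H1 and psi in BMO. Outside of that domain
   the value carries no meaning. *)
Definition H1_BMO_pairing f psi : R :=
  get [set v | BMO psi /\
               exists2 Lambda, represents psi Lambda & v = Lambda f].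

End HardySpace.

(* Main.v *)
(** Write [F = P f + i Q f] for the Cauchy integral of [f], where [P] and [Q]
    are convolution with [pk y u = y / (u^2 + y^2)] and
    [qk y u = u / (u^2 + y^2)] (the factor [1 / pi] is left out). [F] is
    holomorphic on the upper half plane; as [y] tends to [0], [P f] tends to
    [pi f] and [Q f] tends to [pi (hilbert f)] almost everywhere, the latter by
    a weak type estimate, itself obtained from the Poisson representation of
    [F / (lam + F)] for [f >= 0].

    If [f] and [hilbert f] are integrable, then [Q f = P (hilbert f)]: both
    sides are limits of Poisson integrals of bounded holomorphic damped
    versions of [F]. Hence the integral of [f] vanishes, and box averages
    commute with [hilbert]; together with a tent cutoff, whose commutator with
    [hilbert] is a small [L^1] function, they show that [H1_test] is dense
    in [H1], so that the pairing is determined by its values on [H1_test].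

    For a test function [h] the identity comes from integrating
    [Q h = P (hilbert h)] over [(-oo, b]]: the left-hand side is
    [\int h(t) ln sqrt ((b - t)^2 + y^2) dt], the boundary term at [-oo] being
    killed by [\int h = 0]. Finally [f |-> - pi \int_(-oo, b] hilbert f] is
    continuous on [H1]. *)
From HB Require Import structures.
Require Import Defs.
From mathcomp Require Import all_boot all_order all_algebra.
From mathcomp Require Import all_classical all_reals all_analysis.
From mathcomp Require Import measurable_realfun ring lra complex.
Import Order.TTheory GRing.Theory Num.Theory.
Import numFieldNormedType.Exports.
Import ComplexField.Normc.
Local Open Scope classical_set_scope.
Local Open Scope ring_scope.
Set Implicit Arguments.
Unset Strict Implicit.
Unset Printing Implicit Defensive.

(** * Integration on the line *)

Section Invariance.
Context {R : realType}.
Local Notation mu := (@lebesgue_measure R).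
Local Notation intg f := (mu.-integrable setT (EFin \o f)).
Implicit Types (f g h k : R -> R).

(** The obstacle is the lack of control of [F] near the real line: for integrable [f] its imaginary
    part is only of weak type there, so dominated convergence does not apply to [F] itself. For
    [f >= 0] the real part of [F] is nonnegative; then [lam + F] never vanishes and its inverse is
    bounded by [1 / lam], which makes the Cayley transform and the damped functions bounded. This is
    why [f] is split into [fpos f] and [fneg f]. The price is that the Hilbert transforms of the two
    parts need not be integrable even when that of [f] is. The damped function therefore carries the
    factor [a - b], whose boundary values are [pi f + i pi (hilbert f)], and an integrable bound
    survives the limit in [lam].

    The pairing is a [get]: some functional must be shown to represent the logarithm, and all of
    them to agree on [H1]. Density is needed in the norm of [H1], so a cutoff must be close to [f]
    together with its Hilbert transform. Cutting off destroys the zero mean, without which the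
    Hilbert transform decays only like [1 / x]. *)

Lemma ae_imp (P Q : R -> Prop) : {ae mu, forall x, P x} ->
  (forall x, P x -> Q x) -> {ae mu, forall x, Q x}.
Proof. by move=> aeP PQ; apply: (@filterS _ _ (ae_filter_ringOfSetsType mu) _ _ PQ aeP). Qed.

Lemma ae_imp2 (P1 P2 Q : R -> Prop) : {ae mu, forall x, P1 x} ->
  {ae mu, forall x, P2 x} ->
  (forall x, P1 x -> P2 x -> Q x) -> {ae mu, forall x, Q x}.
Proof. by move=> aeP1 aeP2 PQ; apply: (@filterS2 _ _ (ae_filter_ringOfSetsType mu) _ _ _ PQ aeP1 aeP2). Qed.

Definition shift_fun (a : R) : measurableTypeR R -> measurableTypeR R :=
  fun x => (x : R) + a.
Definition refl_fun (a : R) : measurableTypeR R -> measurableTypeR R :=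
  fun x => a - (x : R).

Lemma measurable_shift_fun (a : R) : measurable_fun setT (shift_fun a).
Proof. exact: (@measurable_funD _ _ R setT id (cst a)). Qed.

Lemma measurable_refl_fun (a : R) : measurable_fun setT (refl_fun a).
Proof. exact: (@measurable_funB _ _ R setT (cst a) id). Qed.

HB.instance Definition _ (a : R) :=
  isMeasurableFun.Build _ _ _ _ (shift_fun a) (measurable_shift_fun a).
HB.instance Definition _ (a : R) :=
  isMeasurableFun.Build _ _ _ _ (refl_fun a) (measurable_refl_fun a).

Lemma measure_preserving_shift (a : R) (A : set R) : measurable A ->
  pushforward mu (shift_fun a) A = mu A.
Proof.
move=> mA; apply/esym/lebesgue_measure_unique => //= _ [[u v]] _ <-.
rewrite /pushforward /=.
have -> : shift_fun a @^-1` `]u, v] = `]u - a, v - a]%classic.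
  by apply/seteqP; split => x /=; rewrite /shift_fun !in_itv/=; lra.
rewrite !lebesgue_measure_itv/= !lte_fin ltrD2r -!EFinD.
by case: ifP => // _; congr EFin; ring.
Qed.

Lemma measure_preserving_refl (a : R) (A : set R) : measurable A ->
  pushforward mu (refl_fun a) A = mu A.
Proof.
move=> mA; apply/esym/lebesgue_measure_unique => //= _ [[u v]] _ <-.
rewrite /pushforward /=.
have -> : refl_fun a @^-1` `]u, v] = `[a - v, a - u[%classic.
  by apply/seteqP; split => x /=; rewrite /refl_fun !in_itv/=; lra.
rewrite !lebesgue_measure_itv/= !lte_fin ltrD2l ltrN2 -!EFinD.
by case: ifP => // _; congr EFin; ring.
Qed.

Section preserving.
Variable phi : {mfun measurableTypeR R >-> measurableTypeR R}.
Hypothesis pphi : forall A : set R, measurable A -> pushforward mu phi A = mu A.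

Lemma ge0_integral_preserving (f : R -> \bar R) : measurable_fun setT f ->
  (forall x, 0 <= f x)%E -> (\int[mu]_x f (phi x) = \int[mu]_x f x)%E.
Proof.
move=> mf f0.
have := @ge0_integral_pushforward _ _ _ _ R phi (measurable_funP phi) mu setT f measurableT mf (fun x _ => f0 x).
rewrite preimage_setT => <-.
by apply: eq_measure_integral => A mA _; exact: pphi.
Qed.

Lemma intg_preserving f : intg f -> intg (f \o phi).
Proof.
move=> /integrableP[/measurable_EFinP mf fi]; apply/integrableP; split.
  apply/measurable_EFinP; exact: (measurableT_comp mf (measurable_funP phi)).
rewrite (ge0_integral_preserving (f := fun x => `|(f x)%:E|%E)) //.
by apply: measurableT_comp => //; apply/measurable_EFinP.
Qed.

Lemma Rintegral_preserving f : intg f ->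
  \int[mu]_x f (phi x) = \int[mu]_x f x.
Proof.
move=> fi; rewrite /Rintegral; congr fine.
have mf := measurable_int _ fi.
have := @integral_pushforward _ _ _ _ R phi (measurable_funP phi) mu setT (EFin \o f) mf (intg_preserving fi) measurableT.
rewrite preimage_setT /comp => <-.
by apply: eq_measure_integral => A mA _; exact: pphi.
Qed.

End preserving.

Lemma ge0_integral_shift (a : R) (f : R -> \bar R) : measurable_fun setT f ->
  (forall x, 0 <= f x)%E -> (\int[mu]_x f (x + a)%R = \int[mu]_x f x)%E.
Proof. exact: (ge0_integral_preserving (measure_preserving_shift a)). Qed.

Lemma intg_shift (a : R) f : intg f -> intg (fun x => f (x + a)).
Proof. exact: (intg_preserving (measure_preserving_shift a)). Qed.

Lemma intg_refl (a : R) f : intg f -> intg (fun x => f (a - x)).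
Proof. exact: (intg_preserving (measure_preserving_refl a)). Qed.

Lemma Rintegral_shift (a : R) f : intg f -> \int[mu]_x f (x + a) = \int[mu]_x f x.
Proof. exact: (Rintegral_preserving (measure_preserving_shift a)). Qed.

Lemma Rintegral_refl (a : R) f : intg f -> \int[mu]_x f (a - x) = \int[mu]_x f x.
Proof. exact: (Rintegral_preserving (measure_preserving_refl a)). Qed.

Lemma intg_measurable f : intg f -> measurable_fun setT f.
Proof. by move=> fi; have /measurable_EFinP := measurable_int _ fi. Qed.

Lemma le_intg f g : measurable_fun setT f -> (forall x, `|f x| <= g x) -> intg g -> intg f.
Proof.
move=> mf fg gi; apply: (le_integrable _ _ _ gi) => //; first exact/measurable_EFinP.
by move=> x _; rewrite /= lee_fin (le_trans (fg x))// ler_norm.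
Qed.

Lemma intgD f g : intg f -> intg g -> intg (fun x => f x + g x).
Proof. by move=> fi gi; exact: (integrableD measurableT fi gi). Qed.

Lemma intgB f g : intg f -> intg g -> intg (fun x => f x - g x).
Proof. by move=> fi gi; exact: (integrableB measurableT fi gi). Qed.

Lemma intgZ (c : R) f : intg f -> intg (fun x => c * f x).
Proof. by move=> fi; exact: (integrableZl measurableT c fi). Qed.

Lemma intg_norm f : intg f -> intg (fun x => `|f x|).
Proof. by move=> fi; exact: (integrable_norm fi). Qed.

Lemma Rintegral_intgD f g : intg f -> intg g ->
  \int[mu]_x (f x + g x) = \int[mu]_x f x + \int[mu]_x g x.
Proof. by move=> fi gi; rewrite RintegralD. Qed.

Lemma Rintegral_intgB f g : intg f -> intg g ->
  \int[mu]_x (f x - g x) = \int[mu]_x f x - \int[mu]_x g x.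
Proof. by move=> fi gi; rewrite RintegralB. Qed.

Lemma Rintegral_intgZ (c : R) f : intg f ->
  \int[mu]_x (c * f x) = c * \int[mu]_x f x.
Proof. by move=> fi; rewrite RintegralZl. Qed.

Lemma le_Rint f g : intg f -> intg g -> (forall x, f x <= g x) ->
  \int[mu]_x f x <= \int[mu]_x g x.
Proof. by move=> fi gi fg; apply: le_Rintegral. Qed.

Lemma le_norm_Rint f g : intg f -> intg g -> (forall x, `|f x| <= g x) ->
  `|\int[mu]_x f x| <= \int[mu]_x g x.
Proof.
move=> fi gi fg; apply: (le_trans (le_normr_Rintegral _ fi)) => //.
by apply: le_Rint => //; exact: intg_norm.
Qed.

Lemma intg_bounded k f (M : R) : measurable_fun setT k -> (forall x, `|k x| <= M) ->
  intg f -> intg (fun x => k x * f x).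
Proof.
move=> mk kM fi; apply: (@le_intg _ (fun x => M * `|f x|)).
- by apply: measurable_funM => //; exact: intg_measurable.
- by move=> x; rewrite normrM ler_wpM2r.
- by apply: intgZ; exact: intg_norm.
Qed.

Lemma dominated_cvgR (D : set R) (f_ : nat -> R -> R) f g : measurable D ->
  (forall n, measurable_fun D (f_ n)) -> measurable_fun D f ->
  {ae mu, forall x, D x -> f_ n x @[n --> \oo] --> f x} ->
  mu.-integrable D (EFin \o g) ->
  {ae mu, forall x, forall n, D x -> `|f_ n x| <= g x} ->
  mu.-integrable D (EFin \o f) /\
  \int[mu]_(x in D) f_ n x @[n --> \oo] --> \int[mu]_(x in D) f x.
Proof.
move=> mD mf_ mf cf gi fg.
have [] := @dominated_convergence _ _ R mu D mD (fun n => EFin \o f_ n) (EFin \o f) (EFin \o g).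
- by move=> n; apply/measurable_EFinP; exact: mf_.
- by apply/measurable_EFinP.
- apply: ae_imp cf _ => x cf Dx.
  by apply: (cvg_comp _ _ (cf Dx)).
- by [].
- by apply: ae_imp fg _ => x fg n Dx; rewrite /= lee_fin fg.
move=> fi _ cI; split => //.
have fin : (\int[mu]_(x in D) (EFin \o f) x)%E \is a fin_num by apply: integrable_fin_num.
by move: cI; rewrite -(fineK fin) => /fine_cvg.
Qed.

Lemma dominated_cvgT (f_ : nat -> R -> R) f g :
  (forall n, measurable_fun setT (f_ n)) -> measurable_fun setT f ->
  (forall x, f_ n x @[n --> \oo] --> f x) ->
  intg g -> (forall n x, `|f_ n x| <= g x) ->
  \int[mu]_x f_ n x @[n --> \oo] --> \int[mu]_x f x.
Proof.
move=> mf_ mf cf gi fg.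
have [] // := @dominated_cvgR setT f_ f g measurableT mf_ mf _ gi _.
- by apply: aeW => x _; exact: cf.
- by apply: aeW => x n _; exact: fg.
Qed.

End Invariance.

(** * Fubini's theorem and convolutions *)

Section Convolution.
Context {R : realType}.
Local Notation mu := (@lebesgue_measure R).
Local Notation intg f := (mu.-integrable setT (EFin \o f)).
Implicit Types (f g h k : R -> R).

(** Measurability of [g] does not follow from the almost everywhere equality: measurable sets are
    the Borel sets, which are not complete for [mu]. *)
Lemma Rintegral_ae f g : intg f -> measurable_fun setT g ->
  {ae mu, forall x, f x = g x} -> intg g /\ \int[mu]_x f x = \int[mu]_x g x.
Proof.
move=> fi mg fg.
have mf := intg_measurable fi.
have mEf : measurable_fun setT (EFin \o f) by exact/measurable_EFinP.
have mEg : measurable_fun setT (EFin \o g) by exact/measurable_EFinP.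
split.
  apply/integrableP; split; first exact/measurable_EFinP.
  move/integrableP: fi => [_]; apply: le_lt_trans.
  rewrite le_eqVlt; apply/orP; left; apply/eqP/ae_eq_integral => //.
  - by apply: measurableT_comp.
  - by apply: measurableT_comp.
  - by apply: ae_imp fg _ => x e _ /=; rewrite e.
rewrite /Rintegral; congr fine; apply: ae_eq_integral => //.
by apply: ae_imp fg _ => x e _ /=; rewrite e.
Qed.

(** Sections may fail to be integrable, so the positive and negative parts are integrated
    separately; their difference is measurable as an extended real function, and [fine] sends
    infinite values to a default. *)
Lemma measurable_Rint_param (F : R -> R -> R) :
  measurable_fun setT (fun z : R * R => F z.1 z.2) ->
  measurable_fun setT (fun x => \int[mu]_y F x y).
Proof.
move=> mF.
pose G (z : measurableTypeR R * measurableTypeR R) : \bar R := (F z.1 z.2)%:E.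
have mG : measurable_fun setT G by exact/measurable_EFinP.
have m1 : measurable_fun setT (fun x => (\int[mu]_y (G^\+ (x, y)))%E).
  apply: (measurable_fun_fubini_tonelli_F (m2 := mu) (G^\+)%E) => //.
  exact: measurable_funepos.
have m2 : measurable_fun setT (fun x => (\int[mu]_y (G^\- (x, y)))%E).
  apply: (measurable_fun_fubini_tonelli_F (m2 := mu) (G^\-)%E) => //.
  exact: measurable_funeneg.
apply: (measurableT_comp (fine_measurable measurableT)).
rewrite (_ : (fun x => _) = (fun x => (\int[mu]_y (G^\+ (x, y)) - \int[mu]_y (G^\- (x, y)))%E)).
  exact: emeasurable_funB.
apply/funext => x; rewrite integralE.
by congr (_ - _)%E; apply: eq_integral => y _; rewrite ?funeposE ?funenegE.
Qed.

Section fubini.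
Variable F : R -> R -> R.
Hypothesis mF : measurable_fun setT (fun z : R * R => F z.1 z.2).
Hypothesis Ffin : (\int[mu]_x \int[mu]_y `|(F x y)%:E| < +oo)%E.

Let G (z : measurableTypeR R * measurableTypeR R) : \bar R := (F z.1 z.2)%:E.
Let mG : measurable_fun setT G. Proof. exact/measurable_EFinP. Qed.
Let iG : (mu \x mu)%E.-integrable setT G.
Proof. by apply/(@integrable12ltyP _ _ _ _ _ mu mu G mG). Qed.

Lemma fubini_ae1 : {ae mu, forall x, intg (F x)}.
Proof. exact: ae_integrable1 iG. Qed.

Lemma fubini_ae2 : {ae mu, forall y, intg (F ^~ y)}.
Proof. exact: ae_integrable2 iG. Qed.

Let e1 : {ae mu, forall x, setT x -> (EFin \o (fun x => \int[mu]_y F x y)) x = fubini_F mu G x}.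
Proof.
by apply: ae_imp fubini_ae1 _ => x ix _; rewrite /= /Rintegral fineK//; exact: integrable_fin_num.
Qed.

Let mE1 : measurable_fun setT (EFin \o (fun x => \int[mu]_y F x y)).
Proof. by apply/measurable_EFinP; exact: measurable_Rint_param. Qed.

Lemma fubini_intg1 : intg (fun x => \int[mu]_y F x y).
Proof.
have i1 := integrable_fubini_F iG.
apply/integrableP; split => //.
move/integrableP: (i1) => [_]; apply: le_lt_trans.
rewrite le_eqVlt; apply/orP; left; apply/eqP/ae_eq_integral => //.
+ by apply: measurableT_comp.
+ by apply: measurableT_comp => //; exact: measurable_int i1.
+ by apply: ae_imp e1 _ => x e _; rewrite e.
Qed.

Lemma fubini_fine1 : \int[mu]_x \int[mu]_y F x y = fine (\int[mu]_x \int[mu]_y (F x y)%:E)%E.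
Proof.
rewrite {1}/Rintegral; congr fine; apply: ae_eq_integral => //.
exact: measurable_int (integrable_fubini_F iG).
Qed.

End fubini.

Lemma fubini_intg (F : R -> R -> R) :
  measurable_fun setT (fun z : R * R => F z.1 z.2) ->
  (\int[mu]_x \int[mu]_y `|(F x y)%:E| < +oo)%E ->
  [/\ {ae mu, forall x, intg (F x)} /\ {ae mu, forall y, intg (F ^~ y)},
      intg (fun x => \int[mu]_y F x y), intg (fun y => \int[mu]_x F x y) &
      \int[mu]_x \int[mu]_y F x y = \int[mu]_y \int[mu]_x F x y].
Proof.
move=> mF Ffin.
have mF' : measurable_fun setT (fun z : R * R => F z.2 z.1).
  exact: (measurableT_comp mF (@measurable_swap _ _ _ _)).
pose G (z : measurableTypeR R * measurableTypeR R) : \bar R := (F z.1 z.2)%:E.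
have mG : measurable_fun setT G by exact/measurable_EFinP.
have iG : (mu \x mu)%E.-integrable setT G.
  by apply/(@integrable12ltyP _ _ _ _ _ mu mu G mG).
have Ffin' : (\int[mu]_x \int[mu]_y `|(F y x)%:E| < +oo)%E.
  by apply/(@integrable21ltyP _ _ _ _ _ mu mu G mG).
split.
- by split; [exact: fubini_ae1|exact: fubini_ae2].
- exact: fubini_intg1.
- exact: (@fubini_intg1 (fun y x => F x y)).
- rewrite (fubini_fine1 mF Ffin) (@fubini_fine1 (fun y x => F x y) mF' Ffin'); congr fine.
  exact: (Fubini iG).
Qed.

Definition conv k f (x : R) : R := \int[mu]_t (k (x - t) * f t).

Lemma measurable_convk k : measurable_fun setT k ->
  measurable_fun setT (fun z : R * R => k (z.1 - z.2)).
Proof.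
move=> mk; apply: (measurableT_comp mk).
exact: (measurable_funB measurable_fst measurable_snd).
Qed.

Lemma measurable_convF k f : measurable_fun setT k -> measurable_fun setT f ->
  measurable_fun setT (fun z : R * R => k (z.1 - z.2) * f z.2).
Proof.
move=> mk mf; apply: measurable_funM; first exact: measurable_convk.
exact: (measurableT_comp mf measurable_snd).
Qed.

Lemma measurable_conv k f : measurable_fun setT k -> measurable_fun setT f ->
  measurable_fun setT (conv k f).
Proof.
move=> mk mf; apply: (@measurable_Rint_param (fun x t => k (x - t) * f t)).
exact: measurable_convF.
Qed.

Lemma tonelli_conv (k f : R -> R) : measurable_fun setT k -> measurable_fun setT f ->
  (\int[mu]_x \int[mu]_t `|(k (x - t) * f t)%:E| =
   (\int[mu]_x `|(k x)%:E|) * \int[mu]_x `|(f x)%:E|)%E.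
Proof.
move=> mk mf.
have := @fubini_tonelli _ _ _ _ R mu mu (fun z => `|(k (z.1 - z.2) * f z.2)%:E|%E).
move=> /= ->//; last first.
  apply/measurable_EFinP; apply: measurableT_comp => //.
  exact: (measurable_convF mk mf).
have mk' : measurable_fun setT (fun x : R => `|(k x)%:E|%E).
  by apply: measurableT_comp => //; exact/measurable_EFinP.
have E t : (\int[mu]_x `|(k (x - t) * f t)%:E| = `|(f t)%:E| * \int[mu]_x `|(k x)%:E|)%E.
  under eq_integral do rewrite mulrC EFinM abseM.
  rewrite ge0_integralZl//.
    congr (_ * _)%E; exact: (ge0_integral_shift (- t) mk').
  apply: measurableT_comp => //; apply/measurable_EFinP.
  by apply: (measurableT_comp mk); exact: (@measurable_funD _ _ R setT id (cst (- t))).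
under eq_integral do rewrite E muleC.
rewrite ge0_integralZl//.
- by apply: measurableT_comp => //; exact/measurable_EFinP.
- exact: integral_ge0.
Qed.

Lemma intg_lty k : intg k -> (\int[mu]_x `|(k x)%:E| < +oo)%E.
Proof. by move/integrableP => []. Qed.

Lemma conv_tonelli_lty k f : intg k -> intg f ->
  (\int[mu]_x \int[mu]_t `|(k (x - t) * f t)%:E| < +oo)%E.
Proof.
move=> ik fi; rewrite tonelli_conv; [|exact: intg_measurable..].
by rewrite lte_mul_pinfty ?intg_lty ?ge0_fin_numE ?intg_lty ?integral_ge0.
Qed.

Lemma conv_intg k f : intg k -> intg f -> intg (conv k f).
Proof.
move=> ik fi; have [] // := @fubini_intg (fun x t => k (x - t) * f t).
- by apply: measurable_convF; exact: intg_measurable.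
- exact: conv_tonelli_lty.
Qed.

Lemma Rintegral_conv k f : intg k -> intg f ->
  \int[mu]_x conv k f x = (\int[mu]_x k x) * \int[mu]_x f x.
Proof.
move=> ik fi; have [|_ _ _] := @fubini_intg (fun x t => k (x - t) * f t) _ (conv_tonelli_lty ik fi).
  by apply: measurable_convF; exact: intg_measurable.
rewrite -/(conv k f) => ->.
under eq_Rintegral => t _.
  under eq_Rintegral do rewrite mulrC.
  rewrite Rintegral_intgZ; last exact: (intg_shift (- t)).
  rewrite (Rintegral_shift (- t) ik) mulrC.
  over.
by rewrite Rintegral_intgZ.
Qed.

(** The pointwise bound by the convolution of the absolute values is available where the integrand
    is integrable, that is, for almost every [x] by Fubini; hence the almost everywhere
    comparison. *)
Lemma conv_norm_le k f : intg k -> intg f ->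
  \int[mu]_x `|conv k f x| <= (\int[mu]_x `|k x|) * \int[mu]_x `|f x|.
Proof.
move=> ik fi; rewrite -Rintegral_conv; [|exact: intg_norm..].
have ik' := intg_norm ik; have if' := intg_norm fi.
have [|[a1 _] _ _ _] := @fubini_intg (fun x t => k (x - t) * f t) _ (conv_tonelli_lty ik fi).
  by apply: measurable_convF; exact: intg_measurable.
have i1 := intg_norm (conv_intg ik fi).
have i2 := conv_intg ik' if'.
rewrite -lee_fin.
have fin1 := integrable_fin_num measurableT i1.
have fin2 := integrable_fin_num measurableT i2.
rewrite /Rintegral !fineK//.
apply: ae_ge0_le_integral => //.
- exact: measurable_int i1.
- by move=> x _; rewrite lee_fin; apply: Rintegral_ge0 => t _; rewrite mulr_ge0.
- exact: measurable_int i2.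
apply: ae_imp a1 _ => x ix _; rewrite lee_fin /conv.
apply: (le_trans (le_normr_Rintegral _ ix)) => //.
by under eq_Rintegral do rewrite normrM.
Qed.

Lemma conv_integrand_bounded k f (M x : R) : measurable_fun setT k -> (forall x, `|k x| <= M) ->
  intg f -> intg (fun t => k (x - t) * f t).
Proof.
move=> mk kM fi; apply: (@intg_bounded _ (fun t => k (x - t)) f M) => //.
by apply: (measurableT_comp mk); exact: (@measurable_funB _ _ R setT (cst x) id).
Qed.

Lemma conv_bounded k f (M x : R) : measurable_fun setT k -> (forall x, `|k x| <= M) ->
  intg f -> `|conv k f x| <= M * \int[mu]_t `|f t|.
Proof.
move=> mk kM fi; rewrite -Rintegral_intgZ; last exact: intg_norm.
apply: le_norm_Rint.
- exact: conv_integrand_bounded kM fi.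
- by apply: intgZ; exact: intg_norm.
- by move=> t; rewrite normrM ler_wpM2r.
Qed.

End Convolution.

(** * Fatou's lemma and integrals over intervals *)

Section LineIntegrals.
Context {R : realType}.
Local Notation mu := (@lebesgue_measure R).
Local Notation intg f := (mu.-integrable setT (EFin \o f)).
Implicit Types (f g h k F : R -> R).

Lemma fatou_intg (f_ : nat -> R -> R) f (C : R) :
  (forall n, intg (f_ n)) -> measurable_fun setT f ->
  (forall n x, 0 <= f_ n x) -> (forall x, 0 <= f x) ->
  {ae mu, forall x, f_ n x @[n --> \oo] --> f x} ->
  (forall n, \int[mu]_x f_ n x <= C) -> intg f /\ \int[mu]_x f x <= C.
Proof.
move=> if_ mf f_0 f0 cf leC.
have mf_ n : measurable_fun setT (fun x => (f_ n x)%:E).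
  by apply/measurable_EFinP; exact: intg_measurable.
have le1 : (\int[mu]_x (f x)%:E <= C%:E)%E.
  have := @fatou _ _ R mu setT measurableT (fun n x => (f_ n x)%:E) mf_ (fun n x _ => f_0 n x).
  have -> : (\int[mu]_x limn_einf (fun n => (f_ n x)%:E) = \int[mu]_x (f x)%:E)%E.
    apply: ae_eq_integral => //.
    - rewrite (_ : (fun x => _) = (fun x => (- limn_esup (fun n => - (f_ n x)%:E))%E)).
        apply: measurableT_comp => //; apply: measurable_fun_limn_esup => n.
        by apply: measurableT_comp => //; exact: mf_.
      by apply/funext => x; rewrite -limn_einfN; congr limn_einf; apply/funext => n /=; rewrite opprK.
    - exact/measurable_EFinP.
    apply: ae_imp cf _ => x {}cf _.
    have /cvg_limn_einf_sup[-> _] // : ((f_ n x)%:E @[n --> \oo] --> (f x)%:E)%E.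
    exact: (cvg_comp _ _ cf).
  move=> /le_trans; apply.
  rewrite limn_einf_lim; apply: lime_le; first exact: is_cvg_einfs.
  apply: nearW => n; apply: (@le_trans _ _ (\int[mu]_x (f_ n x)%:E)%E).
    by apply: ereal_inf_lbound; exists n => /=.
  by rewrite -(fineK (integrable_fin_num measurableT (if_ n))) lee_fin; exact: leC.
have fi : intg f.
  apply/integrableP; split; first exact/measurable_EFinP.
  under eq_integral do rewrite /= ger0_norm//.
  exact: le_lt_trans le1 (ltry _).
split => //; rewrite -lee_fin /Rintegral fineK//; exact: integrable_fin_num.
Qed.

Lemma restrict_cvg_itv f (x : R) : (f \_ `[- n%:R, n%:R]) x @[n --> \oo] --> f x.
Proof.
apply: cvg_near_cst; near=> n; rewrite patchE mem_set//= in_itv/= -ler_norml.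
near: n; exact: nbhs_infty_ger.
Unshelve. all: by end_near. Qed.

Lemma intg_restrict (D : set R) f : measurable D -> intg f -> intg (f \_ D).
Proof.
move=> mD fi; rewrite -restrict_EFin.
have [+ _] := @integrable_mkcond _ _ R mu D (EFin \o f) mD; apply.
by apply: integrableS fi.
Qed.

Lemma restrict_EFin_intg (D : set R) f : measurable D ->
  mu.-integrable D (EFin \o f) <-> intg (f \_ D).
Proof.
by move=> mD; rewrite -restrict_EFin; exact: (@integrable_mkcond _ _ R mu D (EFin \o f) mD).
Qed.

Lemma measurable_restrictR (D : set R) f : measurable D -> measurable_fun setT f ->
  measurable_fun setT (f \_ D).
Proof.
by move=> mD mf; apply/(measurable_restrictT f mD); exact: measurable_funTS.
Qed.

Lemma Rint_cvg_itv f : intg f ->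
  \int[mu]_(x in `[- n%:R, n%:R]) f x @[n --> \oo] --> \int[mu]_x f x.
Proof.
move=> fi; under eq_fun do rewrite Rintegral_mkcond.
apply: (@dominated_cvgT _ _ _ (fun x => `|f x|)).
- by move=> n; apply: measurable_restrictR => //; exact: intg_measurable.
- exact: intg_measurable.
- exact: restrict_cvg_itv.
- exact: intg_norm.
- by move=> n x; rewrite patchE; case: ifP => // _; rewrite normr0.
Qed.

Lemma ge0_intg_itv f (C : R) : measurable_fun setT f -> (forall x, 0 <= f x) ->
  (forall n : nat, mu.-integrable `[- n%:R, n%:R] (EFin \o f)) ->
  (forall n : nat, \int[mu]_(x in `[- n%:R, n%:R]) f x <= C) -> intg f.
Proof.
move=> mf f0 fi fC.
have [] // := @fatou_intg (fun n => f \_ `[- n%:R, n%:R]) f C.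
- by move=> n; apply/(restrict_EFin_intg f) => //; exact: fi.
- by move=> n x; rewrite patchE; case: ifP.
- by apply: aeW => x; exact: restrict_cvg_itv.
- by move=> n; rewrite -Rintegral_mkcond.
Qed.

Lemma FTC_Rint f F (a b : R) : a < b -> continuous f ->
  (forall x : R, is_derive x (1 : R) F (f x)) ->
  \int[mu]_(x in `[a, b]) f x = F b - F a.
Proof.
move=> ab cf dF.
have cF : continuous F.
  by move=> x; apply: differentiable_continuous; apply/derivable1_diffP; apply: ex_derive.
rewrite /Rintegral (@continuous_FTC2 _ f F)//.
- by apply: continuous_subspaceT => x; exact: cf.
- split=> [x _||].
  + exact: ex_derive.
  + by apply: cvg_at_right_filter; exact: cF.
  + by apply: cvg_at_left_filter; exact: cF.
- by move=> x _; rewrite derive1E; apply: derive_val.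
Qed.

Lemma continuous_intg_itv f (a b : R) : continuous f -> mu.-integrable `[a, b] (EFin \o f).
Proof.
move=> cf; apply: continuous_compact_integrable; first exact: segment_compact.
exact: continuous_subspaceT.
Qed.

End LineIntegrals.

(** * The Poisson kernel and its conjugate *)

Section Kernels.
Context {R : realType}.
Local Notation mu := (@lebesgue_measure R).
Local Notation intg f := (mu.-integrable setT (EFin \o f)).
Implicit Types (y s u x t a b : R).

Definition pk y u : R := y / (u ^+ 2 + y ^+ 2).
Definition qk y u : R := u / (u ^+ 2 + y ^+ 2).

Lemma den_gt0 y u : 0 < y -> 0 < u ^+ 2 + y ^+ 2.
Proof. by move=> y0; rewrite ltr_wpDl ?sqr_ge0 ?exprn_gt0. Qed.

Lemma den_neq0 y u : 0 < y -> u ^+ 2 + y ^+ 2 != 0.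
Proof. by move=> y0; rewrite gt_eqF ?den_gt0. Qed.

Lemma pk_gt0 y u : 0 < y -> 0 < pk y u.
Proof. by move=> y0; rewrite divr_gt0 ?den_gt0. Qed.

Lemma pk_ge0 y u : 0 < y -> 0 <= pk y u.
Proof. by move=> y0; rewrite ltW ?pk_gt0. Qed.

Lemma pkN y u : pk y (- u) = pk y u.
Proof. by rewrite /pk sqrrN. Qed.

Lemma qkN y u : qk y (- u) = - qk y u.
Proof. by rewrite /qk sqrrN mulNr. Qed.

Lemma pk_le y u : 0 < y -> pk y u <= y^-1.
Proof.
move=> y0; rewrite /pk ler_pdivrMr ?den_gt0// -(@ler_pM2l _ y)// mulrA divff ?gt_eqF// mul1r.
by rewrite -expr2 lerDr sqr_ge0.
Qed.

Lemma pk_norm_le y u : 0 < y -> `|pk y u| <= y^-1.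
Proof. by move=> y0; rewrite ger0_norm ?pk_ge0 ?pk_le. Qed.

Lemma qk_le y u : 0 < y -> `|qk y u| <= y^-1.
Proof.
move=> y0; rewrite /qk normrM normfV (ger0_norm (ltW (den_gt0 u y0))).
rewrite ler_pdivrMr ?den_gt0// -(@ler_pM2l _ y)// mulrA divff ?gt_eqF// mul1r.
rewrite -(real_normK (num_real u)); have := sqr_ge0 (`|u| - y).
have := normr_ge0 u; nra.
Qed.

Lemma continuous_den y : continuous (fun u : R => u ^+ 2 + y ^+ 2).
Proof.
move=> u; apply: cvgD; last exact: cvg_cst.
exact: exprn_continuous.
Qed.

Lemma continuous_pk y : 0 < y -> continuous (pk y).
Proof.
move=> y0 u; apply: cvgM; first exact: cvg_cst.
by apply: cvgV; [exact: den_neq0|exact: continuous_den].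
Qed.

Lemma continuous_qk y : 0 < y -> continuous (qk y).
Proof.
move=> y0 u; apply: cvgM; first exact: cvg_id.
by apply: cvgV; [exact: den_neq0|exact: continuous_den].
Qed.

Lemma measurable_pk y : 0 < y -> measurable_fun setT (pk y).
Proof. by move=> y0; apply: continuous_measurable_fun; exact: continuous_pk. Qed.

Lemma measurable_qk y : 0 < y -> measurable_fun setT (qk y).
Proof. by move=> y0; apply: continuous_measurable_fun; exact: continuous_qk. Qed.

Lemma is_derive_affine (c d u : R) : is_derive u (1 : R) (fun v : R => v * c + d) c.
Proof.
have h := @is_deriveD R _ _ _ (cst d) u 1 _ _ (@is_deriveM R _ id (cst c) u 1 _ _ (is_derive_id _ _) (is_derive_cst _ _ _)) (is_derive_cst _ _ _).
apply: (is_derive_eq h).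
by rewrite addr0 scaler0 add0r /GRing.scale /= mulr1.
Qed.

Lemma is_derive_atan_pk y (u : R) : 0 < y ->
  is_derive u (1 : R) (fun v : R => atan (v / y)) (pk y u).
Proof.
move=> y0.
have h : is_derive u (1 : R) (fun v : R => v / y) (y^-1).
  have := is_derive_affine (y^-1) 0 u.
  by under eq_fun do rewrite addr0.
apply: (is_derive_eq (@is_derive1_comp _ (@atan R) _ _ _ _ (is_derive1_atan _) h)).
have := den_neq0 u y0; have /negbT := gt_eqF y0; rewrite /pk => yn dn.
have e : 1 + (u / y) ^+ 2 = (u ^+ 2 + y ^+ 2) / y ^+ 2 by field.
by rewrite e; field; rewrite dn yn.
Qed.

Lemma is_derive_ln_qk y (u : R) : 0 < y ->
  is_derive u (1 : R) (fun v : R => ln (v ^+ 2 + y ^+ 2) / 2) (qk y u).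
Proof.
move=> y0.
have d1 : is_derive u (1 : R) (fun v : R => v ^+ 2 + y ^+ 2) (2 * u).
  have h := @is_deriveD R _ _ _ (cst (y ^+ 2)) u 1 _ _ (@is_deriveX R _ id 2 u 1 _ (is_derive_id _ _)) (is_derive_cst _ _ _).
  apply: (is_derive_eq h).
  by rewrite addr0 /= expr1 /GRing.scale /= mulr1.
have d2 := @is_derive1_comp _ (@ln R) (fun v : R => v ^+ 2 + y ^+ 2) u _ _ (is_derive1_ln (den_gt0 u y0)) d1.
have h := @is_deriveM R _ _ (cst (2^-1)) u 1 _ _ d2 (is_derive_cst _ _ _).
apply: (is_derive_eq h).
rewrite /= scaler0 add0r /GRing.scale /= /qk.
by have := den_neq0 u y0 => ?; field.
Qed.

Lemma integral_pk_itv y (n : nat) : 0 < y ->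
  \int[mu]_(x in `[- n%:R, n%:R]) pk y x = 2 * atan (n%:R / y).
Proof.
move=> y0; case: n => [|n].
  by rewrite oppr0 set_itv1 Rintegral_set1 mul0r atan0 mulr0.
have lt : - n.+1%:R < n.+1%:R :> R by rewrite (@lt_trans _ _ 0) ?oppr_lt0 ?ltr0n.
rewrite (FTC_Rint lt (continuous_pk y0) (fun x => is_derive_atan_pk x y0)).
by rewrite mulNr atanN; ring.
Qed.

Lemma intg_pk y : 0 < y -> intg (pk y).
Proof.
move=> y0; apply: (@ge0_intg_itv _ _ pi).
- exact: measurable_pk y0.
- by move=> x; exact: pk_ge0.
- by move=> n; apply: continuous_intg_itv; exact: continuous_pk.
- by move=> n; rewrite integral_pk_itv//; have := @atan_ltpi2 R (n%:R / y); lra.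
Qed.

Lemma Rintegral_pk y : 0 < y -> \int[mu]_u pk y u = pi.
Proof.
move=> y0.
have h1 := Rint_cvg_itv (intg_pk y0).
apply: (cvg_unique (@Rhausdorff R) h1).
rewrite /=.
rewrite (_ : (fun n : nat => _) = (fun n : nat => 2 * atan (n%:R / y))); last first.
  by apply/funext => n; rewrite integral_pk_itv.
have -> : pi = 2 * (pi / 2) :> R by field.
apply: cvgM; first exact: cvg_cst.
have c : (fun n : nat => n%:R / y) n @[n --> \oo] --> +oo%R.
  apply/cvgryPge => A; near=> n.
  rewrite ler_pdivlMr//; near: n; exact: nbhs_infty_ger.
apply: (cvg_comp _ _ c); exact: cvgy_atan.
Unshelve. all: by end_near. Qed.

Lemma intg_pk_shift y a : 0 < y -> intg (fun t => pk y (t - a)).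
Proof. by move=> y0; apply: (intg_shift (- a)); exact: intg_pk. Qed.

Lemma Rintegral_pk_shift y a : 0 < y -> \int[mu]_t pk y (t - a) = pi.
Proof. by move=> y0; rewrite (Rintegral_shift (- a) (intg_pk y0)) Rintegral_pk. Qed.

(** [qk] decays like [1 / u] and is not integrable, but a difference of two shifted copies decays
    like [1 / u^2]. Over the common denominator [D1 * D2] the numerator is
    [u v (a - b) + u y^2 - v s^2]. Each term is bounded by a combination of [D1] and [D2] through
    [2 |p q| <= p^2 + q^2], and division by [D1 * D2] leaves multiples of the two Poisson
    kernels. *)
Lemma qkB_bound s y a b t : 0 < s -> 0 < y ->
  `|qk s (t - a) - qk y (t - b)| <=
  (`|a - b| / 2 + s ^+ 2 / y) / s * pk s (t - a) + (`|a - b| / 2 + y ^+ 2 / s) / y * pk y (t - b).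
Proof.
move=> s0 y0.
have d1 := den_gt0 (t - a) s0; have d2 := den_gt0 (t - b) y0.
rewrite /qk /pk.
set u := t - a in d1 *; set v := t - b in d2 *.
set D1 := u ^+ 2 + s ^+ 2 in d1 *; set D2 := v ^+ 2 + y ^+ 2 in d2 *.
have D1n : D1 != 0 by rewrite gt_eqF.
have D2n : D2 != 0 by rewrite gt_eqF.
have sn : s != 0 by rewrite gt_eqF.
have yn : y != 0 by rewrite gt_eqF.
have -> : u / D1 - v / D2 = (u * v * (a - b) + u * y ^+ 2 - v * s ^+ 2) / (D1 * D2).
  have -> : a - b = v - u by rewrite /u /v; ring.
  by rewrite /D1 /D2 in D1n D2n *; field; apply/andP.
rewrite normrM (normfV (D1 * D2)) (ger0_norm (ltW (mulr_gt0 d1 d2))).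
rewrite ler_pdivrMr ?mulr_gt0//.
have -> : ((`|a - b| / 2 + s ^+ 2 / y) / s * (s / D1) + (`|a - b| / 2 + y ^+ 2 / s) / y * (y / D2)) * (D1 * D2)
   = (`|a - b| / 2 + s ^+ 2 / y) * D2 + (`|a - b| / 2 + y ^+ 2 / s) * D1.
  field; rewrite D1n D2n sn yn //.
have h1 : `|u| * y ^+ 2 <= y ^+ 2 / s * D1.
  rewrite mulrC -mulrA ler_pM2l ?exprn_gt0// ler_pdivlMl// /D1 -(real_normK (num_real u)).
  by have := sqr_ge0 (`|u| - s); have := normr_ge0 u; nra.
have h2 : `|v| * s ^+ 2 <= s ^+ 2 / y * D2.
  rewrite mulrC -mulrA ler_pM2l ?exprn_gt0// ler_pdivlMl// /D2 -(real_normK (num_real v)).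
  by have := sqr_ge0 (`|v| - y); have := normr_ge0 v; nra.
have h3 : `|u * v * (a - b)| <= `|a - b| / 2 * (D1 + D2).
  rewrite normrM mulrC -mulrA ler_wpM2l// normrM ler_pdivlMl// /D1 /D2.
  rewrite -(real_normK (num_real u)) -(real_normK (num_real v)).
  by have := sqr_ge0 (`|u| - `|v|); have := sqr_ge0 s; have := sqr_ge0 y; nra.
have t1 := ler_normD (u * v * (a - b) + u * y ^+ 2) (- (v * s ^+ 2)).
have t2 := ler_normD (u * v * (a - b)) (u * y ^+ 2).
rewrite normrN (normrM v) (ger0_norm (sqr_ge0 s)) in t1.
rewrite (normrM u (_ ^+ 2)) (ger0_norm (sqr_ge0 y)) in t2.
lra.
Qed.

Lemma intg_qkB s y a b : 0 < s -> 0 < y ->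
  intg (fun t => qk s (t - a) - qk y (t - b)).
Proof.
move=> s0 y0; apply: (le_intg _ (fun t => qkB_bound a b t s0 y0)).
- apply: measurable_funB; [apply: (measurableT_comp (measurable_qk s0))|apply: (measurableT_comp (measurable_qk y0))]; exact: (@measurable_funD _ _ R setT id (cst _)).
- by apply: intgD; apply: intgZ; exact: intg_pk_shift.
Qed.

(** With [h = 1 / N] this is the logarithm of [((N - a)^2 + s^2) / ((N - b)^2 + y^2)]: the behaviour
    of the primitive at infinity becomes continuity at [h = 0]. *)
Let ratio s y a b (h : R) : R :=
  ln (((1 - a * h) ^+ 2 + (s * h) ^+ 2) / ((1 - b * h) ^+ 2 + (y * h) ^+ 2)).

Lemma qkB_ratio_cvg s y a b : ratio s y a b (n.+1%:R^-1) @[n --> \oo] --> 0.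
Proof.
have c0 : (n.+1%:R^-1 : R) @[n --> \oo] --> 0 by exact: cvg_harmonic.
have e : 0 = ln (((1 - a * 0) ^+ 2 + (s * 0) ^+ 2) / ((1 - b * 0) ^+ 2 + (y * 0) ^+ 2)) :> R.
  by rewrite !mulr0 subr0 expr0n addr0 expr1n divr1 ln1.
rewrite [X in _ --> X]e.
apply: (cvg_comp _ (@ln R)); last first.
  by apply: continuous_ln; rewrite !mulr0 subr0 expr0n addr0 expr1n divr1.
have q (c d : R) : (1 - c * n.+1%:R^-1) ^+ 2 + (d * n.+1%:R^-1) ^+ 2 @[n --> \oo] --> (1 - c * 0) ^+ 2 + (d * 0) ^+ 2.
  have b1 : 1 - c * n.+1%:R^-1 @[n --> \oo] --> (1 - c * 0 : R).
    by apply: cvgB; [exact: cvg_cst|apply: cvgM; [exact: cvg_cst|exact: c0]].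
  have b2 : d * n.+1%:R^-1 @[n --> \oo] --> (d * 0 : R).
    by apply: cvgM; [exact: cvg_cst|exact: c0].
  by apply: cvgD; [exact: (cvgM b1 b1)|exact: (cvgM b2 b2)].
apply: cvgM; first exact: q.
apply: cvgV; last exact: q.
by rewrite !mulr0 subr0 expr0n addr0 expr1n oner_neq0.
Qed.

(** The primitive of the integrand is half the logarithm of a quotient that tends to 1 at both ends
    of [[-N, N]]. *)
Lemma Rintegral_qkB s y a b : 0 < s -> 0 < y ->
  \int[mu]_t (qk s (t - a) - qk y (t - b)) = 0.
Proof.
move=> s0 y0.
have h1 := Rint_cvg_itv (intg_qkB a b s0 y0).
rewrite -cvg_shiftS in h1.
apply: (cvg_unique (@Rhausdorff R) h1).
have e : (fun n : nat => \int[mu]_(t in `[- n.+1%:R, n.+1%:R]) (qk s (t - a) - qk y (t - b))) =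
  (fun n : nat => ratio s y a b (n.+1%:R^-1) / 2 - ratio s y (- a) (- b) (n.+1%:R^-1) / 2).
  apply/funext => n.
  have dsh (c w x : R) : 0 < w -> is_derive x (1 : R) (fun t => ln ((t - c) ^+ 2 + w ^+ 2) / 2) (qk w (x - c)).
    move=> w0.
    have h : is_derive x (1 : R) (fun t : R => t - c) 1.
      by have := is_derive_affine 1 (- c) x; under eq_fun do rewrite mulr1.
    have := @is_derive1_comp _ (fun v : R => ln (v ^+ 2 + w ^+ 2) / 2) (fun t : R => t - c) x _ _ (is_derive_ln_qk (x - c) w0) h.
    by rewrite mulr1.
  have lt : - n.+1%:R < n.+1%:R :> R by rewrite (@lt_trans _ _ 0) ?oppr_lt0 ?ltr0n.
  have ct : continuous (fun t => qk s (t - a) - qk y (t - b)).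
    move=> t; apply: cvgB.
      apply: (cvg_comp (fun t => t - a) (qk s)); last exact: continuous_qk.
      by apply: cvgB; [exact: cvg_id|exact: cvg_cst].
    apply: (cvg_comp (fun t => t - b) (qk y)); last exact: continuous_qk.
    by apply: cvgB; [exact: cvg_id|exact: cvg_cst].
  rewrite (FTC_Rint lt ct (fun x => is_deriveB (dsh a s x s0) (dsh b y x y0))).
  have lnr (c d z w : R) : 0 < z -> 0 < w ->
      ln (((1 - c * n.+1%:R^-1) ^+ 2 + (z * n.+1%:R^-1) ^+ 2) / ((1 - d * n.+1%:R^-1) ^+ 2 + (w * n.+1%:R^-1) ^+ 2))
       = ln ((n.+1%:R - c) ^+ 2 + z ^+ 2) - ln ((n.+1%:R - d) ^+ 2 + w ^+ 2) :> R.
    move=> z0 w0.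
    rewrite -lnV ?posrE ?den_gt0// -lnM ?posrE ?invr_gt0 ?den_gt0//; congr ln.
    have := den_neq0 (n.+1%:R - d) w0.
    have : n.+1%:R != 0 :> R by rewrite pnatr_eq0.
    set N := n.+1%:R => Nn dn.
    have e (p q : R) : (1 - p / N) ^+ 2 + (q / N) ^+ 2 = ((N - p) ^+ 2 + q ^+ 2) / N ^+ 2 by field.
    rewrite !e; set D := _ ^+ 2 + w ^+ 2 in dn *; set C := _ + z ^+ 2.
    by rewrite invf_div mulrA divfK ?expf_neq0.
  rewrite /ratio !lnr// !fctE /=.
  rewrite (_ : (- n.+1%:R - a) ^+ 2 = (n.+1%:R - - a) ^+ 2); last by ring.
  rewrite (_ : (- n.+1%:R - b) ^+ 2 = (n.+1%:R - - b) ^+ 2); last by ring.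
  by ring.
rewrite e.
have -> : 0 = 0 / 2 - 0 / 2 :> R by rewrite mul0r subr0.
by apply: cvgB; apply: cvgM; try exact: cvg_cst; exact: qkB_ratio_cvg.
Qed.

End Kernels.

(** * The Poisson formula on the upper half plane *)

Section Complex.
Context {R : realType}.
Local Notation mu := (@lebesgue_measure R).
Local Notation intg f := (mu.-integrable setT (EFin \o f)).
Local Notation C := (R[i]).
Local Notation cplx x y := (Complex x y : R[i]).
Implicit Types (z w a : C).

Lemma normcD z w : normc (z + w) <= normc z + normc w.
Proof. exact: le_normcD. Qed.

Lemma normcN z : normc (- z) = normc z.
Proof. exact: complex.normcN. Qed.

Lemma normc_ge_Re z : `|complex.Re z| <= normc z.
Proof.
case: z => x y /=; rewrite -(sqrtr_sqr x).
by rewrite ler_wsqrtr// lerDl sqr_ge0.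
Qed.

Lemma normc_ge_Im z : `|complex.Im z| <= normc z.
Proof.
case: z => x y /=; rewrite -(sqrtr_sqr y).
by rewrite ler_wsqrtr// lerDr sqr_ge0.
Qed.

Lemma normc_ge0 z : 0 <= normc z.
Proof. by case: z => x y /=; exact: sqrtr_ge0. Qed.

Lemma normc_le_ReIm z : normc z <= `|complex.Re z| + `|complex.Im z|.
Proof.
case: z => x y /=.
rewrite -[leRHS]ger0_norm ?addr_ge0// -sqrtr_sqr ler_wsqrtr//.
rewrite -(real_normK (num_real x)) -(real_normK (num_real y)) sqrrD.
by rewrite lerD2r lerDl mulrn_wge0// mulr_ge0.
Qed.

Lemma normc_gt0 z : z != 0 -> 0 < normc z.
Proof.
move=> z0; rewrite lt_neqAle normc_ge0 andbT eq_sym.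
by apply: contra z0 => /eqP/eq0_normc ->.
Qed.

Lemma normcX z n : normc (z ^+ n) = normc z ^+ n.
Proof. by elim: n => [|n ih]; rewrite ?expr0 ?normc1// !exprS normcM ih. Qed.

Lemma normc_real (x : R) : normc (x%:C)%C = `|x|.
Proof. by rewrite /= expr0n addr0 sqrtr_sqr. Qed.

Lemma normcB_sym z w : normc (z - w) = normc (w - z).
Proof. by rewrite -normcN opprB. Qed.

Lemma ImB z w : complex.Im (z - w) = complex.Im z - complex.Im w.
Proof. by case: z w => [? ?] [? ?]. Qed.

Lemma ReB z w : complex.Re (z - w) = complex.Re z - complex.Re w.
Proof. by case: z w => [? ?] [? ?]. Qed.

Lemma ReD z w : complex.Re (z + w) = complex.Re z + complex.Re w.
Proof. by case: z w => [? ?] [? ?]. Qed.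

Lemma ImD z w : complex.Im (z + w) = complex.Im z + complex.Im w.
Proof. by case: z w => [? ?] [? ?]. Qed.

Lemma ReM z w : complex.Re (z * w) = complex.Re z * complex.Re w - complex.Im z * complex.Im w.
Proof. by case: z w => [? ?] [? ?]. Qed.

Lemma ImM z w : complex.Im (z * w) = complex.Re z * complex.Im w + complex.Im z * complex.Re w.
Proof. by case: z w => [? ?] [? ?]. Qed.

Lemma pole_neq0 a z : complex.Im a < 0 -> 0 <= complex.Im z -> z - a != 0.
Proof.
move=> a0 z0; apply/eqP => /(congr1 (@complex.Im R)); rewrite ImB /=.
by move/eqP; rewrite gt_eqF// subr_gt0 (lt_le_trans a0).
Qed.

Lemma pole_bound a z : complex.Im a < 0 -> 0 <= complex.Im z ->
  normc (z - a)^-1 <= (- complex.Im a)^-1.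
Proof.
move=> a0 z0; rewrite normcV lef_pV2 ?posrE ?oppr_gt0// ?normc_gt0 ?pole_neq0//.
apply: le_trans (normc_ge_Im _); rewrite ImB.
by apply: le_trans (ler_norm _); lra.
Qed.

(* A substitute for the bounded holomorphic functions on the upper half plane
   that are continuous up to the real line: the uniform closure of the span of
   the constants and the simple poles below the line. The Poisson formula is
   computed for poles; partial fractions make the class an algebra. *)
Inductive alg : (C -> C) -> Prop :=
| alg_pole a : complex.Im a < 0 -> alg (fun z => (z - a)^-1)
| alg_cst c : alg (fun=> c)
| alg_add B1 B2 : alg B1 -> alg B2 -> alg (fun z => B1 z + B2 z)
| alg_scale c B : alg B -> alg (fun z => c * B z)
| alg_lim (Bn : nat -> C -> C) B : (forall n, alg (Bn n)) ->
    (forall e : R, 0 < e -> exists n, forall z, 0 <= complex.Im z ->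
       normc (B z - Bn n z) <= e) -> alg B.

Lemma alg_lim_ex B : (forall e : R, 0 < e -> exists2 B', alg B' &
    forall z, 0 <= complex.Im z -> normc (B z - B' z) <= e) -> alg B.
Proof.
move=> h.
have {}h n : exists B', alg B' /\ forall z, 0 <= complex.Im z -> normc (B z - B' z) <= n.+1%:R^-1.
  by have [|B' aB' hB'] := h n.+1%:R^-1; [rewrite invr_gt0|exists B'].
have [Bn hBn] := choice h.
apply: (@alg_lim Bn) => [n|e e0]; first by have [] := hBn n.
have /cvgr0Pnorm_le/(_ _ e0)[N _ hN] := @cvg_harmonic R.
exists N => z z0.
have [_ /(_ z z0) /le_trans] := hBn N; apply.
by apply: le_trans (hN N (leqnn N)); exact: ler_norm.
Qed.

(** Only the closed upper half plane matters to [alg]: its closure constructor compares functions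
    there, so a function equal to a member on that set is a limit of that member. *)
Lemma alg_ext B B' : alg B -> (forall z, 0 <= complex.Im z -> B' z = B z) -> alg B'.
Proof.
move=> aB e; apply: alg_lim_ex => d d0; exists B => // z z0.
by rewrite e// subrr normc0 ltW.
Qed.

Lemma alg_bounded B : alg B -> exists2 M : R, 0 < M &
  forall z, 0 <= complex.Im z -> normc (B z) <= M.
Proof.
elim => {B}.
- move=> a a0; exists (- complex.Im a)^-1; first by rewrite invr_gt0 oppr_gt0.
  by move=> z; exact: pole_bound.
- move=> c; exists (normc c + 1); first by rewrite ltr_wpDl// normc_ge0.
  by move=> z _; rewrite lerDl.
- move=> B1 B2 _ [M1 M10 h1] _ [M2 M20 h2]; exists (M1 + M2); first exact: addr_gt0.
  by move=> z z0; apply: (le_trans (normcD _ _)); rewrite lerD ?h1 ?h2.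
- move=> c B _ [M M0 h]; exists ((normc c + 1) * M).
    by rewrite mulr_gt0// ltr_wpDl// normc_ge0.
  move=> z z0; rewrite normcM ler_pM ?normc_ge0 ?h//.
  by rewrite lerDl.
- move=> Bn B _ ih h; have [//|n hn] := h 1 _.
  have [M M0 hM] := ih n; exists (1 + M); first by rewrite addr_gt0.
  move=> z z0; rewrite -[B z](subrK (Bn n z)).
  by apply: (le_trans (normcD _ _)); rewrite lerD ?hn ?hM.
Qed.

Lemma pole_diff a b z : complex.Im a < 0 -> complex.Im b < 0 -> 0 <= complex.Im z ->
  normc ((z - a)^-1 - (z - b)^-1) <= normc (a - b) * ((- complex.Im a)^-1 * (- complex.Im b)^-1).
Proof.
move=> a0 b0 z0.
have -> : (z - a)^-1 - (z - b)^-1 = (a - b) * ((z - a)^-1 * (z - b)^-1).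
  by have := pole_neq0 a0 z0; have := pole_neq0 b0 z0 => ? ?; field; apply/andP.
by rewrite !normcM ler_wpM2l ?normc_ge0// ler_pM ?normc_ge0 ?pole_bound.
Qed.

(** Two distinct poles separate by partial fractions. A double pole does not; it is a uniform limit
    of products of distinct ones, obtained by moving one pole downwards. *)
Lemma alg_mul_pole a B : complex.Im a < 0 -> alg B -> alg (fun z => (z - a)^-1 * B z).
Proof.
move=> a0; elim => {B}.
- have neq b : complex.Im b < 0 -> a != b -> alg (fun z => (z - a)^-1 * (z - b)^-1).
    move=> b0 ab.
    apply: (@alg_ext (fun z => (a - b)^-1 * ((z - a)^-1 + (-1) * (z - b)^-1))).
      by apply: alg_scale; apply: alg_add; [|apply: alg_scale]; exact: alg_pole.
    move=> z z0; have := pole_neq0 a0 z0; have := pole_neq0 b0 z0.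
    have : a - b != 0 by rewrite subr_eq0.
    by move=> ? ? ?; field; apply/and3P.
  move=> b b0; have [ab|] := eqVneq a b; last exact: neq.
  subst b; apply: alg_lim_ex => e e0.
  (* Moving the pole down by [d] keeps its distance to the half plane at least [n = - Im a], so the
     product changes by at most [d / n^3]. *)
  pose d := Num.min 1 (e * (- complex.Im a) ^+ 3).
  have d0 : 0 < d by rewrite lt_min ltr01 mulr_gt0// exprn_gt0 ?oppr_gt0.
  pose b := a - cplx 0 d.
  have Imb : complex.Im b = complex.Im a - d by rewrite /b ImB.
  have b1 : complex.Im b < 0 by rewrite Imb; lra.
  exists (fun z => (z - a)^-1 * (z - b)^-1).
    apply: neq => //; apply/eqP => /(congr1 (@complex.Im R)); rewrite Imb; lra.
  move=> z z0; rewrite -mulrBr normcM.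
  apply: (@le_trans _ _ ((- complex.Im a)^-1 * (d * ((- complex.Im a)^-1 * (- complex.Im a)^-1)))).
    apply: ler_pM; rewrite ?normc_ge0 ?pole_bound//.
    apply: (le_trans (pole_diff _ _ _)) => //.
    have -> : normc (a - b) = d.
      by rewrite /b opprB addrCA subrr addr0 /= expr0n add0r sqrtr_sqr gtr0_norm.
    rewrite ler_wpM2l ?(ltW d0)// ler_wpM2l ?invr_ge0 ?oppr_ge0 ?(ltW a0)//.
    by rewrite lef_pV2 ?posrE ?oppr_gt0// Imb; lra.
  have n0 : 0 < - complex.Im a by rewrite oppr_gt0.
  have : d <= e * (- complex.Im a) ^+ 3 by rewrite ge_min lexx orbT.
  move: n0; set n := - complex.Im a => n0 dn.
  have -> : n^-1 * (d * (n^-1 * n^-1)) = d / n ^+ 3 by field; rewrite gt_eqF.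
  by rewrite ler_pdivrMr// exprn_gt0.
- move=> c; apply: (alg_ext (alg_scale c (alg_pole a0))) => z _; exact: mulrC.
- move=> B1 B2 _ h1 _ h2; apply: (alg_ext (alg_add h1 h2)) => z _; exact: mulrDr.
- move=> c B _ h; apply: (alg_ext (alg_scale c h)) => z _; exact: mulrCA.
- move=> Bn B _ ih h; apply: (alg_lim ih) => e e0.
  have [|n hn] := h (e * (- complex.Im a)); first by rewrite mulr_gt0 ?oppr_gt0.
  exists n => z z0; rewrite -mulrBr normcM.
  have -> : e = (- complex.Im a)^-1 * (e * (- complex.Im a)) by field; rewrite lt_eqF.
  by apply: ler_pM; rewrite ?normc_ge0 ?pole_bound ?hn.
Qed.

Lemma alg_mul B1 B2 : alg B1 -> alg B2 -> alg (fun z => B1 z * B2 z).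
Proof.
move=> + a2; elim => {B1}.
- by move=> a a0; exact: alg_mul_pole.
- by move=> c; exact: alg_scale.
- move=> B B' _ h1 _ h2; apply: (alg_ext (alg_add h1 h2)) => z _; exact: mulrDl.
- move=> c B _ h; apply: (alg_ext (alg_scale c h)) => z _; by rewrite mulrA.
- move=> Bn B _ ih h; apply: (alg_lim ih) => e e0.
  have [M M0 hM] := alg_bounded a2.
  have [|n hn] := h (e / M); first by rewrite divr_gt0.
  exists n => z z0; rewrite -mulrBl normcM.
  have -> : e = e / M * M by rewrite divfK ?gt_eqF.
  by apply: ler_pM; rewrite ?normc_ge0 ?hn ?hM.
Qed.

(** The geometric series of [A] converges uniformly on the half plane, and its partial sums lie in
    the algebra. *)
Lemma alg_neumann A (r : R) : alg A -> r < 1 ->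
  (forall z, 0 <= complex.Im z -> normc (A z) <= r) -> alg (fun z => (1 - A z)^-1).
Proof.
move=> aA r1 hA.
pose S n z := \sum_(k < n) A z ^+ k.
have aS n : alg (S n).
  elim: n => [|n ih].
    by apply: (alg_ext (alg_cst 0)) => z _; rewrite /S big_ord0.
  apply: (alg_ext (alg_add (alg_cst 1) (alg_mul aA ih))) => z _.
  rewrite /S big_ord_recl expr0 mulr_sumr; congr (_ + _).
  by apply: eq_bigr => k _; rewrite -exprS.
have r0 : 0 <= r by have := hA 0 (lexx _); apply: le_trans; exact: normc_ge0.
have lb z : 0 <= complex.Im z -> 1 - r <= normc (1 - A z).
  move=> z0; have := normcD (1 - A z) (A z); rewrite subrK normc1.
  by have := hA z z0; lra.
have nz z : 0 <= complex.Im z -> 1 - A z != 0.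
  move=> z0; apply: contraTneq (lb z z0) => ->; rewrite normc0 -ltNge; lra.
apply: (alg_lim aS) => e e0.
have : r ^+ n @[n --> \oo] --> 0 by apply: cvg_expr; rewrite ger0_norm.
move/cvgr0Pnorm_le => /(_ (e * (1 - r))) [|N _ hN]; first by rewrite mulr_gt0// subr_gt0.
exists N => z z0.
have -> : (1 - A z)^-1 - S N z = A z ^+ N * (1 - A z)^-1.
  apply: (mulIf (nz z z0)); rewrite mulrBl mulrVK ?unitfE ?nz// mulVf ?nz//.
  have E : S N z * (A z - 1) = A z ^+ N - 1 by rewrite mulrC /S -subrX1.
  by rewrite -(opprB (A z)) mulrN E; ring.
rewrite normcM normcX normcV ler_pdivrMr ?normc_gt0 ?nz//.
apply: (@le_trans _ _ (r ^+ N)).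
  by rewrite lerXn2r ?nnegrE ?normc_ge0 ?hA.
apply: (@le_trans _ _ (e * (1 - r))).
  by have := hN N (leqnn _); rewrite /= ger0_norm// exprn_ge0.
by rewrite ler_pM2l// lb.
Qed.

(** The two parts are stated separately because the integral takes real functions; [pi] is the mass
    of [pk y]. *)
Definition poisson (B : C -> C) (x y : R) : Prop :=
  [/\ \int[mu]_t (pk y (x - t) * complex.Re (B (t%:C)%C)) = pi * complex.Re (B (cplx x y))
   & \int[mu]_t (pk y (x - t) * complex.Im (B (t%:C)%C)) = pi * complex.Im (B (cplx x y))].

Definition bmeas (B : C -> C) : Prop :=
  [/\ measurable_fun setT (fun t : R => complex.Re (B (t%:C)%C)),
      measurable_fun setT (fun t : R => complex.Im (B (t%:C)%C)) &
      exists M : R, forall t : R, normc (B (t%:C)%C) <= M].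

Lemma poisson_intg B (x y : R) : 0 < y -> bmeas B ->
  intg (fun t => pk y (x - t) * complex.Re (B (t%:C)%C)) /\
  intg (fun t => pk y (x - t) * complex.Im (B (t%:C)%C)).
Proof.
move=> y0 [mR mI [M hM]].
have ip : intg (fun t => pk y (x - t)) by apply: (intg_refl x); exact: intg_pk.
split; under [X in intg X]eq_fun do rewrite mulrC; apply: (@intg_bounded _ _ _ M) => // t.
  exact: le_trans (normc_ge_Re _) (hM t).
exact: le_trans (normc_ge_Im _) (hM t).
Qed.

Lemma Rintegral_pk_refl (x y : R) : 0 < y -> \int[mu]_t pk y (x - t) = pi.
Proof. by move=> y0; rewrite (Rintegral_refl x (intg_pk y0)) Rintegral_pk. Qed.

Lemma le_epsilon_eq (u v K : R) : (forall e, 0 < e -> `|u - v| <= K * e) -> u = v.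
Proof.
move=> h; apply/eqP; rewrite -subr_eq0 -normr_le0; apply/ler_addgt0Pl => e e0.
rewrite addr0; have K0 : 0 < `|K| + 1 by rewrite ltr_wpDl.
apply: (le_trans (h (e / (`|K| + 1)) _)); first by rewrite divr_gt0.
rewrite mulrCA ler_piMr ?(ltW e0)// ler_pdivrMr// mul1r.
by have := ler_norm K; lra.
Qed.

(** Both sides are continuous for the uniform norm: an error [e] in [B] costs at most [pi * e] on
    each side, whence the [2 * pi]. *)
Lemma poisson_lim B (x y : R) : 0 < y -> bmeas B ->
  (forall e : R, 0 < e -> exists B', [/\ bmeas B', poisson B' x y &
     forall z, 0 <= complex.Im z -> normc (B z - B' z) <= e]) -> poisson B x y.
Proof.
move=> y0 mB h.
have ip : intg (fun t => pk y (x - t)) by apply: (intg_refl x); exact: intg_pk.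
have [iR iI] := poisson_intg x y0 mB.
have pi0 := @pi_ge0 R.
have xy0 : 0 <= complex.Im (cplx x y) by exact: ltW.
split; apply: (@le_epsilon_eq _ _ (2 * pi)) => e e0; have [B' [mB' [pR pI] hB']] := h e e0;
  have [iR' iI'] := poisson_intg x y0 mB'.
- apply: (@le_trans _ _ (`|\int[mu]_t (pk y (x - t) * complex.Re (B (t%:C)%C)) - \int[mu]_t (pk y (x - t) * complex.Re (B' (t%:C)%C))| +
    `|pi * complex.Re (B' (cplx x y)) - pi * complex.Re (B (cplx x y))|)).
    by rewrite -pR; apply: le_trans (ler_normD _ _); rewrite addrA subrK.
  have -> : 2 * pi * e = e * pi + pi * e by ring.
  apply: lerD.
    rewrite -Rintegral_intgB// -(Rintegral_pk_refl x y0) -Rintegral_intgZ//.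
    apply: le_norm_Rint; [exact: intgB|exact: intgZ|move=> t].
    rewrite -mulrBr normrM (ger0_norm (pk_ge0 _ y0)) mulrC ler_wpM2r ?pk_ge0//.
    by rewrite -ReB; apply: le_trans (normc_ge_Re _) _; exact: hB'.
  rewrite -mulrBr normrM (ger0_norm pi0) ler_wpM2l// distrC -ReB.
  by apply: le_trans (normc_ge_Re _) _; exact: hB'.
- apply: (@le_trans _ _ (`|\int[mu]_t (pk y (x - t) * complex.Im (B (t%:C)%C)) - \int[mu]_t (pk y (x - t) * complex.Im (B' (t%:C)%C))| +
    `|pi * complex.Im (B' (cplx x y)) - pi * complex.Im (B (cplx x y))|)).
    by rewrite -pI; apply: le_trans (ler_normD _ _); rewrite addrA subrK.
  have -> : 2 * pi * e = e * pi + pi * e by ring.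
  apply: lerD.
    rewrite -Rintegral_intgB// -(Rintegral_pk_refl x y0) -Rintegral_intgZ//.
    apply: le_norm_Rint; [exact: intgB|exact: intgZ|move=> t].
    rewrite -mulrBr normrM (ger0_norm (pk_ge0 _ y0)) mulrC ler_wpM2r ?pk_ge0//.
    by rewrite -ImB; apply: le_trans (normc_ge_Im _) _; exact: hB'.
  rewrite -mulrBr normrM (ger0_norm pi0) ler_wpM2l// distrC -ImB.
  by apply: le_trans (normc_ge_Im _) _; exact: hB'.
Qed.

Lemma pole_real (a b t : R) : 0 < b ->
  (((t%:C)%C - cplx a (- b))^-1 : C) = cplx (qk b (t - a)) (- pk b (t - a)).
Proof.
move=> b0; rewrite /qk /pk.
have -> : (t%:C)%C - cplx a (- b) = cplx (t - a) b.
  by apply/eqP; rewrite eq_complex /= opprK add0r !eqxx.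
apply: (mulIf (_ : cplx (t - a) b != 0)).
  by rewrite eq_complex /= negb_and (gt_eqF b0) orbT.
rewrite mulVf; last by rewrite eq_complex /= negb_and (gt_eqF b0) orbT.
have := den_neq0 (t - a) b0; set D := _ + _ => D0.
by apply/eqP; rewrite eq_complex /=; apply/andP; split; apply/eqP; field.
Qed.

Lemma bmeas_pole a : complex.Im a < 0 -> bmeas (fun z => (z - a)^-1).
Proof.
case: a => a b /= b0.
have b1 : 0 < - b by rewrite oppr_gt0.
split.
- rewrite (_ : (fun t : R => _) = (fun t : R => qk (- b) (t - a))).
    apply: (measurableT_comp (measurable_qk b1)); exact: (@measurable_funD _ _ R setT id (cst (- a))).
  by apply/funext => t; rewrite -[in LHS](opprK b) pole_real.
- rewrite (_ : (fun t : R => _) = (fun t : R => - pk (- b) (t - a))).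
    apply: measurableT_comp => //.
    apply: (measurableT_comp (measurable_pk b1)); exact: (@measurable_funD _ _ R setT id (cst (- a))).
  by apply/funext => t; rewrite -[in LHS](opprK b) pole_real.
- by exists (- b)^-1 => t; exact: pole_bound.
Qed.

Lemma bmeas_alg B : alg B -> bmeas B.
Proof.
move=> aB; suff [h1 h2] : measurable_fun setT (fun t : R => complex.Re (B (t%:C)%C)) /\
      measurable_fun setT (fun t : R => complex.Im (B (t%:C)%C)).
  by split => //; have [M _ hM] := alg_bounded aB; exists M => t; exact: hM.
elim: aB => {B}.
- by move=> a /bmeas_pole [].
- by move=> c; split; exact: measurable_cst.
- move=> B1 B2 _ [h1 h2] _ [h3 h4]; split.
    by under eq_fun do rewrite ReD; exact: measurable_funD.
  by under eq_fun do rewrite ImD; exact: measurable_funD.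
- move=> c B _ [h1 h2]; split.
    by under eq_fun do rewrite ReM; apply: measurable_funB; exact: measurable_funM.
  by under eq_fun do rewrite ImM; apply: measurable_funD; exact: measurable_funM.
- move=> Bn B _ ih h.
  have {}h (k : nat) : exists n, forall z, 0 <= complex.Im z -> normc (B z - Bn n z) <= k.+1%:R^-1.
    by apply: h; rewrite invr_gt0.
  have [s hs] := choice h.
  split.
  + apply: (@measurable_fun_cvg _ _ R setT (fun k (t : R) => complex.Re (Bn (s k) (t%:C)%C)) (fun t : R => complex.Re (B (t%:C)%C))).
      by move=> k; have [] := ih (s k).
    move=> t _; apply/cvgrPdist_le => e e0.
    have /cvgr0Pnorm_le/(_ _ e0) := @cvg_harmonic R; apply: filterS => k; apply: le_trans.
    rewrite -ReB; apply: (le_trans (normc_ge_Re _)); apply: le_trans (ler_norm _); exact: hs.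
  + apply: (@measurable_fun_cvg _ _ R setT (fun k (t : R) => complex.Im (Bn (s k) (t%:C)%C)) (fun t : R => complex.Im (B (t%:C)%C))).
      by move=> k; have [] := ih (s k).
    move=> t _; apply/cvgrPdist_le => e e0.
    have /cvgr0Pnorm_le/(_ _ e0) := @cvg_harmonic R; apply: filterS => k; apply: le_trans.
    rewrite -ImB; apply: (le_trans (normc_ge_Im _)); apply: le_trans (ler_norm _); exact: hs.
Qed.

(** Put [z = x + i y], with conjugate [Z], and [K = 1 / (z - A)]. Partial fractions write
    [pk y (x - t) / (t - A)] as [K * pk y (x - t)] plus a multiple of [1 / (t - A) - 1 / (t - Z)].
    The first term integrates to [pi * K]. Both poles of the second lie below the line, and its
    integral vanishes: the [qk] parts by [Rintegral_qkB], the [pk] parts because all Poisson kernels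
    have the same mass. The multiple has [A - Z] as a denominator, hence the assumption that they
    differ. *)
Lemma poisson_pole_neq (a b x y : R) : 0 < b -> 0 < y -> cplx a (- b) != cplx x (- y) ->
  poisson (fun z => (z - cplx a (- b))^-1) x y.
Proof.
move=> b0 y0 ne.
set A := cplx a (- b) in ne *; set Z := cplx x (- y) in ne *.
set K := (cplx x y - A)^-1.
set c := - (y%:C)%C * K / (A - Z).
have ip : intg (fun t => pk y (x - t)) by apply: (intg_refl x); exact: intg_pk.
have key t : pk y (x - t) = complex.Re (((pk y (x - t))%:C)%C : C) by [].
have id1 (t : R) : ((pk y (x - t))%:C)%C * ((t%:C)%C - A)^-1 =
   ((pk y (x - t))%:C)%C * K + c * cplx (qk b (t - a) - qk y (t - x)) (- (pk b (t - a) - pk y (t - x))).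
  have -> : cplx (qk b (t - a) - qk y (t - x)) (- (pk b (t - a) - pk y (t - x))) =
     ((t%:C)%C - A)^-1 - ((t%:C)%C - Z)^-1.
    rewrite /A /Z !pole_real//; apply/eqP; rewrite eq_complex /=.
    by apply/andP; split; apply/eqP; ring.
  have n1 : (t%:C)%C - A != 0 by apply: pole_neq0 => //=; rewrite oppr_lt0.
  have n2 : (t%:C)%C - Z != 0 by apply: pole_neq0 => //=; rewrite oppr_lt0.
  have n3 : cplx x y - A != 0 by apply: pole_neq0 => /=; [rewrite oppr_lt0|exact: ltW].
  have n4 : A - Z != 0 by rewrite subr_eq0.
  have n5 : (t%:C)%C - cplx x y != 0.
    apply/eqP => /(congr1 (@complex.Im R)) /=; rewrite sub0r => /eqP.
    by rewrite oppr_eq0 gt_eqF.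
  have -> : ((pk y (x - t))%:C)%C = (y%:C)%C / (((t%:C)%C - cplx x y) * ((t%:C)%C - Z)) :> C.
    have -> : ((t%:C)%C - cplx x y) * ((t%:C)%C - Z) = (((x - t) ^+ 2 + y ^+ 2)%:C)%C :> C.
      by apply/eqP; rewrite eq_complex /=; apply/andP; split; apply/eqP; ring.
    by rewrite /pk rmorphM/= fmorphV.
  rewrite /c /K; field; rewrite n1 n2 n3 n4 n5 //.
have ib := intg_qkB a x b0 y0.
have ip2 : intg (fun t => pk b (t - a) - pk y (t - x)) by apply: intgB; exact: intg_pk_shift.
have z2 : \int[mu]_t (pk b (t - a) - pk y (t - x)) = 0.
  by rewrite Rintegral_intgB ?Rintegral_pk_shift ?subrr//; exact: intg_pk_shift.
have z1 := Rintegral_qkB a x b0 y0.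
have ppi := Rintegral_pk_refl x y0.
split.
- transitivity (\int[mu]_t (complex.Re K * pk y (x - t) + (complex.Re c * (qk b (t - a) - qk y (t - x)) +
      complex.Im c * (pk b (t - a) - pk y (t - x))))).
    apply: eq_Rintegral => t _.
    have := congr1 (@complex.Re R) (id1 t).
    by rewrite ReD !ReM /= !mul0r !subr0 => ->; ring.
  rewrite Rintegral_intgD; [|exact: intgZ|by apply: intgD; exact: intgZ].
  rewrite Rintegral_intgD; [|exact: intgZ|exact: intgZ].
  by rewrite (Rintegral_intgZ _ ip) (Rintegral_intgZ _ ib) (Rintegral_intgZ _ ip2) z1 z2 ppi !mulr0 !addr0 mulrC.
- transitivity (\int[mu]_t (complex.Im K * pk y (x - t) + (complex.Im c * (qk b (t - a) - qk y (t - x)) +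
      (- complex.Re c) * (pk b (t - a) - pk y (t - x))))).
    apply: eq_Rintegral => t _.
    have := congr1 (@complex.Im R) (id1 t).
    by rewrite ImD !ImM /= !mul0r !addr0 => ->; ring.
  rewrite Rintegral_intgD; [|exact: intgZ|by apply: intgD; exact: intgZ].
  rewrite Rintegral_intgD; [|exact: intgZ|exact: intgZ].
  by rewrite (Rintegral_intgZ _ ip) (Rintegral_intgZ _ ib) (Rintegral_intgZ _ ip2) z1 z2 ppi !mulr0 !addr0 mulrC.
Qed.

(** A pole located at the conjugate of the evaluation point is reached as a limit of poles slightly
    below it. *)
Lemma poisson_pole a (x y : R) : complex.Im a < 0 -> 0 < y ->
  poisson (fun z => (z - a)^-1) x y.
Proof.
case: a => a b /= b0 y0; rewrite -(opprK b).
have b1 : 0 < - b by rewrite oppr_gt0.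
have [e|ne] := eqVneq (cplx a (- - b)) (cplx x (- y)); last exact: poisson_pole_neq.
have b2 : complex.Im (cplx a (- - b)) < 0 by rewrite /= opprK.
apply: poisson_lim => //; first exact: bmeas_pole.
move=> d d0.
(* By [pole_diff] a downward displacement [h] costs at most [h / b^2]. *)
pose h := d * (- b) ^+ 2.
have h0 : 0 < h by rewrite mulr_gt0// exprn_gt0.
have b3 : complex.Im (cplx a (- (- b + h))) < 0 by rewrite /= oppr_lt0 addr_gt0.
exists (fun z => (z - cplx a (- (- b + h)))^-1); split.
- exact: bmeas_pole.
- apply: poisson_pole_neq => //; first by rewrite addr_gt0.
  rewrite -e; apply/eqP => /(congr1 (@complex.Im R)) /=; lra.
- move=> z z0; apply: (le_trans (pole_diff b2 b3 z0)).
  have -> : normc (cplx a (- - b) - cplx a (- (- b + h))) = h.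
    have -> : cplx a (- - b) - cplx a (- (- b + h)) = cplx 0 h.
      by apply/eqP; rewrite eq_complex /= subrr eqxx /=; apply/eqP; ring.
    by rewrite /= expr0n add0r sqrtr_sqr gtr0_norm.
  rewrite /= !opprK /h.
  apply: (@le_trans _ _ (d * (- b) ^+ 2 * ((- b)^-1 * (- b)^-1))).
    rewrite ler_wpM2l ?(ltW h0)// ler_wpM2l ?invr_ge0 ?(ltW b1)//.
    by rewrite lef_pV2 ?posrE ?addr_gt0// lerDl ltW.
  rewrite le_eqVlt; apply/orP; left; apply/eqP; field; by rewrite lt_eqF.
Qed.

Lemma poisson_alg B (x y : R) : 0 < y -> alg B -> poisson B x y.
Proof.
move=> y0; elim => {B}.
- by move=> a a0; exact: poisson_pole.
- have ip : intg (fun t => pk y (x - t)) by apply: (intg_refl x); exact: intg_pk.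
  move=> c; split; rewrite -(Rintegral_pk_refl x y0) [RHS]mulrC -Rintegral_intgZ//; apply: eq_Rintegral => t _; exact: mulrC.
- move=> B1 B2 a1 [h1 h2] a2 [h3 h4].
  have [i1 i2] := poisson_intg x y0 (bmeas_alg a1).
  have [i3 i4] := poisson_intg x y0 (bmeas_alg a2).
  split.
    by rewrite ReD mulrDr -h1 -h3 -Rintegral_intgD//; apply: eq_Rintegral => t _; rewrite ReD mulrDr.
  by rewrite ImD mulrDr -h2 -h4 -Rintegral_intgD//; apply: eq_Rintegral => t _; rewrite ImD mulrDr.
- move=> c B a1 [h1 h2].
  have [i1 i2] := poisson_intg x y0 (bmeas_alg a1).
  split.
    rewrite ReM mulrBr !(mulrCA pi) -h1 -h2 -!Rintegral_intgZ// -Rintegral_intgB//; try exact: intgZ.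
    by apply: eq_Rintegral => t _; rewrite ReM; ring.
  rewrite ImM mulrDr !(mulrCA pi) -h1 -h2 -!Rintegral_intgZ// -Rintegral_intgD//; try exact: intgZ.
  by apply: eq_Rintegral => t _; rewrite ImM; ring.
- move=> Bn B an ih h.
  have aB : alg B by exact: alg_lim an h.
  apply: poisson_lim => //; first exact: bmeas_alg.
  move=> e e0; have [n hn] := h e e0; exists (Bn n); split => //.
  exact: bmeas_alg.
Qed.

End Complex.

(** * The Cauchy integral as a uniform limit of poles *)

Section CauchyIntegral.
Context {R : realType}.
Local Notation mu := (@lebesgue_measure R).
Local Notation intg f := (mu.-integrable setT (EFin \o f)).
Local Notation C := (R[i]).
Local Notation cplx x y := (Complex x y : R[i]).
Implicit Types (z w a : C) (f g : R -> R).

Lemma conv_pk_intg (y x : R) f : 0 < y -> intg f -> intg (fun t => pk y (x - t) * f t).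
Proof.
move=> y0; apply: conv_integrand_bounded; first exact: measurable_pk.
by move=> u; exact: pk_norm_le.
Qed.

Lemma conv_qk_intg (y x : R) f : 0 < y -> intg f -> intg (fun t => qk y (x - t) * f t).
Proof.
move=> y0; apply: conv_integrand_bounded; first exact: measurable_qk.
by move=> u; exact: qk_le.
Qed.

Lemma convDr_pk (y x : R) f g : 0 < y -> intg f -> intg g ->
  conv (pk y) (fun t => f t + g t) x = conv (pk y) f x + conv (pk y) g x.
Proof.
move=> y0 fi gi; rewrite /conv -Rintegral_intgD; [|exact: conv_pk_intg..].
by apply: eq_Rintegral => t _; rewrite mulrDr.
Qed.

Lemma convDr_qk (y x : R) f g : 0 < y -> intg f -> intg g ->
  conv (qk y) (fun t => f t + g t) x = conv (qk y) f x + conv (qk y) g x.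
Proof.
move=> y0 fi gi; rewrite /conv -Rintegral_intgD; [|exact: conv_qk_intg..].
by apply: eq_Rintegral => t _; rewrite mulrDr.
Qed.

Definition FC f (x y : R) : C := cplx (conv (pk y) f x) (conv (qk y) f x).
(** Raising [F] by [eta] makes it bounded on the closed half plane, whereas the Cauchy integral
    itself need not be bounded near the line. *)
Definition FCs (eta : R) f z : C := FC f (complex.Re z) (complex.Im z + eta).

Lemma FCD (x y : R) f g : 0 < y -> intg f -> intg g ->
  FC (fun t => f t + g t) x y = FC f x y + FC g x y.
Proof.
by move=> y0 fi gi; rewrite /FC convDr_pk// convDr_qk//; apply/eqP; rewrite eq_complex /= !eqxx.
Qed.

Lemma FC_bound (x y : R) f : 0 < y -> intg f ->
  normc (FC f x y) <= 2 * (y^-1 * \int[mu]_t `|f t|).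
Proof.
move=> y0 fi; apply: (le_trans (normc_le_ReIm _)).
rewrite mulr2n mulrDl mul1r /=; apply: lerD.
  apply: conv_bounded => //; first exact: measurable_pk.
  by move=> u; exact: pk_norm_le.
apply: conv_bounded => //; first exact: measurable_qk.
by move=> u; exact: qk_le.
Qed.

Lemma FCs_bound (eta : R) f z : 0 < eta -> intg f -> 0 <= complex.Im z ->
  normc (FCs eta f z) <= 2 * (eta^-1 * \int[mu]_t `|f t|).
Proof.
move=> e0 fi z0; apply: (le_trans (FC_bound _ _ fi)); first exact: ltr_wpDl.
rewrite ler_pM2l// ler_wpM2r//; first by apply: Rintegral_ge0.
by rewrite lef_pV2 ?posrE// ?lerDr// ltr_wpDl.
Qed.

(** As a function of the evaluation point, the Cauchy kernel is a simple pole at [u - i eta]; this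
    is what brings Cauchy integrals into [alg]. *)
Lemma kern_pole (eta u : R) z : 0 < eta -> 0 <= complex.Im z ->
  cplx (pk (complex.Im z + eta) (complex.Re z - u)) (qk (complex.Im z + eta) (complex.Re z - u))
  = cplx 0 1 * (z - cplx u (- eta))^-1.
Proof.
case: z => x y /= e0 y0.
have Y0 : 0 < y + eta by rewrite ltr_wpDl.
have ne : cplx x y - cplx u (- eta) != 0.
  by rewrite eq_complex /= opprK negb_and (gt_eqF Y0) orbT.
apply: (mulIf ne); rewrite mulfVK//.
have := den_neq0 (x - u) Y0; rewrite /pk /qk; set D := _ ^+ 2 + _ => D0.
have DE : D = (x - u) ^+ 2 + (y + eta) ^+ 2 by [].
apply/eqP; rewrite eq_complex /= opprK; apply/andP; split; apply/eqP; first by field.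
by rewrite -[RHS](divff D0) {3}DE; field.
Qed.

Lemma kern_diff (eta u v : R) z : 0 < eta -> 0 <= complex.Im z ->
  `|pk (complex.Im z + eta) (complex.Re z - u) - pk (complex.Im z + eta) (complex.Re z - v)| <= `|u - v| / eta ^+ 2 /\
  `|qk (complex.Im z + eta) (complex.Re z - u) - qk (complex.Im z + eta) (complex.Re z - v)| <= `|u - v| / eta ^+ 2.
Proof.
move=> e0 z0.
have h : normc (cplx 0 1 * (z - cplx u (- eta))^-1 - cplx 0 1 * (z - cplx v (- eta))^-1) <= `|u - v| / eta ^+ 2.
  rewrite -mulrBr normcM.
  have -> : normc (cplx 0 1) = 1 by rewrite /= expr0n add0r expr1n sqrtr1.
  rewrite mul1r; apply: (le_trans (pole_diff _ _ z0)); rewrite /= ?oppr_lt0//.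
  by rewrite !opprK addNr expr0n addr0 sqrtr_sqr expr2 invfM.
rewrite -!kern_pole// in h.
by split; apply: le_trans h; [apply: le_trans (normc_ge_Re _)|apply: le_trans (normc_ge_Im _)].
Qed.

(** Mass within [delta] of [u] acts like a point mass at [u], whose Cauchy integral is a single
    pole. *)
Lemma FCs_cell (eta delta u : R) f : 0 < eta -> 0 <= delta -> intg f ->
  (forall s, f s != 0 -> `|s - u| <= delta) ->
  exists2 B, alg B & forall z, 0 <= complex.Im z ->
    normc (FCs eta f z - B z) <= 2 * (delta / eta ^+ 2) * \int[mu]_t `|f t|.
Proof.
move=> e0 d0 fi supp; set m := \int[mu]_t f t.
exists (fun z => (m%:C)%C * (cplx 0 1 * (z - cplx u (- eta))^-1)).
  by do 2 apply: alg_scale; apply: alg_pole; rewrite /= oppr_lt0.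
move=> z z0; rewrite -kern_pole//.
have Y0 : 0 < complex.Im z + eta by rewrite ltr_wpDl.
apply: (le_trans (normc_le_ReIm _)).
rewrite -mulrA mulr2n mulrDl mul1r.
have if' := intg_norm fi.
apply: lerD; rewrite /= mul0r ?subr0 ?addr0 /m -Rintegral_intgZ//.
- rewrite [m * _]mulrC -[X in conv _ _ _ - X]Rintegral_intgZ// -Rintegral_intgB//; [|exact: conv_pk_intg|exact: intgZ].
  apply: le_norm_Rint; [by apply: intgB; [exact: conv_pk_intg|exact: intgZ]|exact: intgZ|move=> t].
  rewrite -mulrBl normrM; have [->|ft] := eqVneq (f t) 0; first by rewrite normr0 !mulr0.
  rewrite ler_wpM2r//; apply: (le_trans (kern_diff _ _ e0 z0).1).
  by rewrite ler_wpM2r ?supp// invr_ge0 sqr_ge0.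
- rewrite [m * _]mulrC -[X in conv _ _ _ - X]Rintegral_intgZ// -Rintegral_intgB//; [|exact: conv_qk_intg|exact: intgZ].
  apply: le_norm_Rint; [by apply: intgB; [exact: conv_qk_intg|exact: intgZ]|exact: intgZ|move=> t].
  rewrite -mulrBl normrM; have [->|ft] := eqVneq (f t) 0; first by rewrite normr0 !mulr0.
  rewrite ler_wpM2r//; apply: (le_trans (kern_diff _ _ e0 z0).2).
  by rewrite ler_wpM2r ?supp// invr_ge0 sqr_ge0.
Qed.

(** A Riemann sum with one pole per cell of length [delta]. The error in a cell is proportional to
    the [L^1] norm of [f] on that cell, so the errors add up to the same bound for any number of
    cells. *)
Lemma FCs_cells (eta delta : R) (m : nat) : 0 < eta -> 0 <= delta ->
  forall (u : R) f, intg f -> (forall s, f s != 0 -> u <= s < u + m%:R * delta) ->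
  exists2 B, alg B & forall z, 0 <= complex.Im z ->
    normc (FCs eta f z - B z) <= 2 * (delta / eta ^+ 2) * \int[mu]_t `|f t|.
Proof.
move=> e0 d0; elim: m => [|m ih] u f fi supp.
  apply: (@FCs_cell _ _ u) => // s /supp; rewrite mul0r addr0 => /andP[us su].
  by have := le_lt_trans us su; rewrite ltxx.
pose A := [set` `]-oo, (u + delta)[ : interval R].
have mA : measurable A by exact: measurable_itv.
have mAc : measurable (~` A) by exact: measurableC.
have fE t : f t = (f \_ A) t + (f \_ (~` A)) t.
  by rewrite !patchE in_setC; case: (t \in A) => /=; rewrite ?addr0 ?add0r.
have nE t : `|f t| = `|(f \_ A) t| + `|(f \_ (~` A)) t|.
  by rewrite !patchE in_setC; case: (t \in A) => /=; rewrite ?normr0 ?addr0 ?add0r.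
have i1 : intg (f \_ A) by exact: intg_restrict.
have i2 : intg (f \_ (~` A)) by exact: intg_restrict.
have [|B1 aB1 h1] := @FCs_cell eta delta u (f \_ A) e0 d0 i1.
  move=> s; rewrite patchE; case: ifPn; last by rewrite eqxx.
  rewrite inE /A /= in_itv /= => su /supp /andP[us _].
  by rewrite ger0_norm ?subr_ge0// lerBlDl ltW.
have [|B2 aB2 h2] := ih (u + delta) _ i2.
  move=> s; rewrite patchE in_setC; case: ifPn; last by rewrite eqxx.
  rewrite notin_setE /A /= in_itv /= => su /supp /andP[us su'].
  apply/andP; split; first by rewrite leNgt; apply/negP.
  have -> // : u + delta + m%:R * delta = u + m.+1%:R * delta.
  by rewrite -natr1; ring.
exists (fun z => B1 z + B2 z); first exact: alg_add.
move=> z z0.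
have Y0 : 0 < complex.Im z + eta by rewrite ltr_wpDl.
rewrite (_ : f = (fun t => (f \_ A) t + (f \_ (~` A)) t)); last exact/funext.
rewrite /FCs FCD//.
under eq_Rintegral => t _ do rewrite -fE nE.
rewrite Rintegral_intgD; [|exact: intg_norm..].
rewrite mulrDr opprD addrACA; apply: (le_trans (normcD _ _)).
by apply: lerD; [exact: h1|exact: h2].
Qed.

Lemma FCs_alg (eta : R) f : 0 < eta -> intg f -> alg (FCs eta f).
Proof.
move=> e0 fi.
pose D n := [set` `[(- n%:R)%R, n%:R[ : interval R].
have mD n : measurable (D n) by exact: measurable_itv.
have step n : alg (FCs eta (f \_ (D n))).
  have ifn : intg (f \_ (D n)) by exact: intg_restrict.
  apply: alg_lim_ex => e ep.
  set I := \int[mu]_t `|(f \_ (D n)) t|.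
  have I0 : 0 <= I by exact: Rintegral_ge0.
  (* The cells will have length [2 n / (m + 1)]; [m] makes the bound of [FCs_cells] at most [e]. *)
  have [m hm] : exists m : nat, 2 * ((2 * n%:R) / eta ^+ 2) * I / e <= m.+1%:R.
    have [m _ hm] := nbhs_infty_ger (2 * ((2 * n%:R) / eta ^+ 2) * I / e).
    by exists m; apply: (le_trans (hm m (leqnn m))); rewrite ler_nat.
  have d0 : 0 <= 2 * n%:R / m.+1%:R :> R by rewrite divr_ge0.
  have [|B aB hB] := @FCs_cells eta (2 * n%:R / m.+1%:R) m.+1 e0 d0 (- n%:R) _ ifn.
    move=> s; rewrite patchE; case: ifPn; last by rewrite eqxx.
    rewrite inE /D /= in_itv /= => /andP[-> sn] _ /=.
    by rewrite mulrC divfK ?pnatr_eq0// ; lra.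
  exists B => // z z0; apply: (le_trans (hB z z0)).
  rewrite ler_pdivrMr// in hm; apply: le_trans (_ : (2 * (2 * n%:R / eta ^+ 2) * I) / m.+1%:R <= _).
    rewrite -/I le_eqVlt; apply/orP; left; apply/eqP; field.
    by rewrite nat1r pnatr_eq0 (gt_eqF e0).
  by rewrite ler_pdivrMr ?ltr0n// [e * _]mulrC.
apply: (alg_lim step) => e ep.
have : \int[mu]_t `|(f \_ (~` (D n))) t| @[n --> \oo] --> \int[mu]_t (cst (0:R) t).
  apply: (@dominated_cvgT _ _ _ (fun x => `|f x|)).
  - move=> n; apply: measurableT_comp => //; apply: measurable_restrictR; first exact: measurableC.
    exact: intg_measurable.
  - exact: measurable_cst.
  - move=> x; apply: cvg_near_cst; near=> n.
    rewrite patchE in_setC (_ : x \in D n) /= ?normr0// inE /D /= in_itv /=.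
    apply/andP; split.
      rewrite lerNl; apply: (@le_trans _ _ `|x|); first by rewrite -normrN ler_norm.
      near: n; exact: nbhs_infty_ger.
    apply: (@le_lt_trans _ _ `|x|); first exact: ler_norm.
    near: n; exact: nbhs_infty_gtr.
  - exact: intg_norm.
  - by move=> n x; rewrite normr_id patchE; case: ifP => // _; rewrite normr0.
rewrite Rintegral_cst// mul0r => /cvgr0Pnorm_le /(_ (e * eta / 2)) [|N _ hN].
  by rewrite divr_gt0// mulr_gt0.
exists N => z z0.
have i1 : intg (f \_ (D N)) by exact: intg_restrict.
have i2 : intg (f \_ (~` (D N))) by apply: intg_restrict => //; exact: measurableC.
have Y0 : 0 < complex.Im z + eta by rewrite ltr_wpDl.
have -> : FCs eta f z - FCs eta (f \_ (D N)) z = FCs eta (f \_ (~` (D N))) z.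
  rewrite /FCs {1}(_ : f = (fun t => (f \_ (D N)) t + (f \_ (~` (D N))) t)).
    by rewrite FCD// addrC addKr.
  apply/funext => t.
  by rewrite !patchE in_setC; case: (t \in D N) => /=; rewrite ?addr0 ?add0r.
apply: (le_trans (FCs_bound e0 i2 z0)).
rewrite mulrCA ler_pdivrMl//; have := hN N (leqnn _); rewrite /= ger0_norm; last exact: Rintegral_ge0.
by lra.
Unshelve. all: by end_near. Qed.

Lemma FC_Re_ge0 (x y : R) f : 0 < y -> (forall t, 0 <= f t) -> 0 <= complex.Re (FC f x y).
Proof. by move=> y0 f0; apply: Rintegral_ge0 => t _; rewrite mulr_ge0 ?pk_ge0. Qed.

Lemma normc_addr_ge (lam : R) z : 0 <= lam -> 0 <= complex.Re z ->
  lam <= normc ((lam%:C)%C + z) /\ normc z <= normc ((lam%:C)%C + z).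
Proof.
move=> l0 z0; split.
  apply: le_trans (normc_ge_Re _); rewrite ReD /=.
  by apply: le_trans (ler_norm _); rewrite lerDl.
case: z z0 => x y /= x0; rewrite ler_wsqrtr// add0r lerD2r.
by rewrite lerXn2r ?nnegrE ?lerDr// addr_ge0.
Qed.

Lemma normc_addr_gt0 (lam : R) z : 0 < lam -> 0 <= complex.Re z ->
  (lam%:C)%C + z != 0.
Proof.
move=> l0 z0; apply/eqP => e; have [] := normc_addr_ge (ltW l0) z0.
by rewrite e normc0 leNgt l0.
Qed.

Lemma normc_resolvent_le (lam : R) z : 0 < lam -> 0 <= complex.Re z ->
  normc ((lam%:C)%C + z)^-1 <= lam^-1.
Proof.
move=> l0 z0; rewrite normcV lef_pV2 ?posrE ?(normc_addr_ge (ltW l0) z0).1//.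
by rewrite normc_gt0// normc_addr_gt0.
Qed.

(** The Neumann series of [1 / (lam + F)] need not converge when [F] is large against [lam]. It is
    first applied with [l = 2 M + lam], where [|F / l| <= 1/2]. Then [1 / (lam + F)] is the product
    of [1 / (l + F)] and the inverse of [1 - (l - lam) / (l + F)]; the last quotient has norm at
    most [1 - lam / l < 1] because the real part of [F] is nonnegative. *)
Lemma resolvent_alg (eta lam : R) f : 0 < eta -> intg f -> (forall t, 0 <= f t) -> 0 < lam ->
  alg (fun z => ((lam%:C)%C + FCs eta f z)^-1).
Proof.
move=> e0 fi f0 l0.
have aF := FCs_alg e0 fi.
have [M M0 hM] := alg_bounded aF.
have Rege z : 0 <= complex.Im z -> 0 <= complex.Re (FCs eta f z).
  by move=> z0; apply: FC_Re_ge0 => //; rewrite ltr_wpDl.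
pose l := 2 * M + lam.
have lp : 0 < l by rewrite addr_gt0// mulr_gt0.
have lne : (l%:C)%C != 0 :> C by rewrite eq_complex /= eqxx andbT gt_eqF.
have normV (r : R) : 0 < r -> normc ((r%:C)%C^-1) = r^-1.
  by move=> r0; rewrite normcV normc_real gtr0_norm.
have a1 : alg (fun z => ((l%:C)%C + FCs eta f z)^-1).
  have a2 : alg (fun z => (1 - (- (l%:C)%C^-1) * FCs eta f z)^-1).
    apply: (@alg_neumann _ (fun z => (- (l%:C)%C^-1) * FCs eta f z) (2^-1)).
    - exact: alg_scale.
    - by rewrite invf_lt1// ltr1n.
    - move=> z z0; rewrite normcM normcN normV// ler_pdivrMl//.
      by apply: (le_trans (hM z z0)); rewrite /l; lra.
  apply: (alg_ext (alg_scale ((l%:C)%C^-1) a2)) => z z0.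
  have n1 := normc_addr_gt0 lp (Rege z z0).
  rewrite -invfM; congr (_^-1).
  by rewrite mulNr opprK mulrDr mulr1 mulrA divff// mul1r.
have a3 : alg (fun z => (1 - ((l - lam)%:C)%C * ((l%:C)%C + FCs eta f z)^-1)^-1).
  apply: (@alg_neumann _ (fun z => ((l - lam)%:C)%C * ((l%:C)%C + FCs eta f z)^-1) (1 - lam / l)).
  - exact: alg_scale.
  - by rewrite gtrBl divr_gt0.
  - move=> z z0; rewrite normcM normc_real ger0_norm; last by rewrite /l; lra.
    have -> : 1 - lam / l = (l - lam) * l^-1 by field; rewrite gt_eqF.
    rewrite ler_wpM2l//; first by rewrite /l; lra.
    exact: normc_resolvent_le lp (Rege z z0).
apply: (alg_ext (alg_mul a1 a3)) => z z0.
have n1 := normc_addr_gt0 lp (Rege z z0).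
have n2 := normc_addr_gt0 l0 (Rege z z0).
have e : 1 - ((l - lam)%:C)%C * ((l%:C)%C + FCs eta f z)^-1 = ((lam%:C)%C + FCs eta f z) / ((l%:C)%C + FCs eta f z).
  by rewrite rmorphB /=; field.
by rewrite e; field; rewrite n1 n2.
Qed.

End CauchyIntegral.

(** * The weak type estimate *)

Section WeakType.
Context {R : realType}.
Local Notation mu := (@lebesgue_measure R).
Local Notation intg f := (mu.-integrable setT (EFin \o f)).
Local Notation C := (R[i]).
Implicit Types (z w a : C) (f g h : R -> R).

(* Iterating this bound replaces the layer cake decomposition of [pk]. *)
Lemma pk_dyadic (y u : R) : 0 < y ->
  pk y u <= y^-1 * \1_(ball (0 : R) (3 * y)) u + 3 / 4 * pk (2 * y) u.
Proof.
move=> y0; have y2 : 0 < 2 * y by rewrite mulr_gt0.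
rewrite indicE; case: (boolP (u \in _)) => /= hu.
  rewrite mulr1; apply: (le_trans (pk_le _ y0)).
  by rewrite lerDl mulr_ge0 ?pk_ge0// divr_ge0.
have {}hu : 3 * y <= `|u|.
  by move: hu; rewrite notin_setE /ball /= sub0r normrN => /negP; rewrite -leNgt.
rewrite mulr0 add0r /pk.
have d1 := den_gt0 u y0; have d2 := den_gt0 u y2.
rewrite ler_pdivrMr// mulrAC mulrA ler_pdivlMr//.
have : (3 * y) ^+ 2 <= u ^+ 2.
  by rewrite -[u ^+ 2]real_normK ?num_real// lerXn2r ?nnegrE// mulr_ge0// ltW.
move: d1 d2; set v := u ^+ 2; nra.
Qed.

Lemma measure_ball (x r : R) : 0 <= r -> mu (ball x r) = (r *+ 2)%:E.
Proof. exact: lebesgue_measure_ball. Qed.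

Lemma intg_indic_ball (x r : R) f : intg f -> intg (fun t => \1_(ball x r) t * f t).
Proof.
move=> fi; apply: (@intg_bounded _ _ _ 1) => //.
  by apply: measurable_indic; exact: measurable_ball.
by move=> t; rewrite indicE; case: (_ \in _); rewrite ?normr1 ?normr0.
Qed.

Lemma conv_pk_dyadic (y x : R) h : 0 < y -> intg h -> (forall t, 0 <= h t) ->
  conv (pk y) h x <= y^-1 * \int[mu]_t (\1_(ball x (3 * y)) t * h t) + 3 / 4 * conv (pk (2 * y)) h x.
Proof.
move=> y0 hi h0; have y2 : 0 < 2 * y by rewrite mulr_gt0.
have ib := intg_indic_ball x (3 * y) hi.
rewrite /conv -!Rintegral_intgZ//; last exact: conv_pk_intg.
rewrite -Rintegral_intgD; [|exact: intgZ|by apply: intgZ; exact: conv_pk_intg].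
apply: le_Rint; [exact: conv_pk_intg|by apply: intgD; apply: intgZ; [|exact: conv_pk_intg]|].
move=> t; have := pk_dyadic (x - t) y0.
have -> : \1_(ball (0 : R) (3 * y)) (x - t) = \1_(ball x (3 * y)) t :> R.
  rewrite !indicE; congr (nat_of_bool _)%:R.
  by apply/idP/idP; rewrite !inE /ball /= sub0r normrN.
by move=> /(ler_wpM2r (h0 t)); rewrite mulrDl !mulrA.
Qed.

Lemma conv_pk_le_norm (y x : R) h : 0 < y -> intg h -> (forall t, 0 <= h t) ->
  conv (pk y) h x <= y^-1 * \int[mu]_t h t.
Proof.
move=> y0 hi h0; rewrite -Rintegral_intgZ//.
apply: le_Rint; [exact: conv_pk_intg|exact: intgZ|move=> t].
by rewrite ler_wpM2r ?pk_le.
Qed.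

(** Writing [P_y] for the Poisson integral at [x], the dyadic bound gives [P_y <= 6 M + 3/4 P_2y],
    the ball of radius [3 y] contributing [y^-1 * 6 y * M]. The fixed point of the recursion is
    [6 M / (1 - 3/4) = 24 M], and the remainder after [n] doublings is at most [(3/4)^n * N / y]. *)
Lemma conv_pk_le_avg (x M : R) h : intg h -> (forall t, 0 <= h t) ->
  (forall r, 0 < r -> \int[mu]_t (\1_(ball x r) t * h t) <= 2 * r * M) ->
  forall y, 0 < y -> conv (pk y) h x <= 24 * M.
Proof.
move=> hi h0 avg.
set N := \int[mu]_t h t.
have N0 : 0 <= N by exact: Rintegral_ge0.
have it n : forall y, 0 < y -> conv (pk y) h x <= 24 * M + (3 / 4) ^+ n * (N / y).
  have M0 : 0 <= M.
    have := avg 1 ltr01; have : 0 <= \int[mu]_t (\1_(ball x 1) t * h t).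
      by apply: Rintegral_ge0 => t _; rewrite mulr_ge0// indicE.
    lra.
  elim: n => [|n ih] y y0.
    rewrite expr0 mul1r; apply: (le_trans (conv_pk_le_norm x y0 hi h0)).
    by rewrite mulrC lerDr mulr_ge0.
  have y2 : 0 < 2 * y by rewrite mulr_gt0.
  apply: (le_trans (conv_pk_dyadic x y0 hi h0)).
  have h1 : y^-1 * \int[mu]_t (\1_(ball x (3 * y)) t * h t) <= 6 * M.
    rewrite ler_pdivrMl//; apply: (le_trans (avg (3 * y) _)); first by rewrite mulr_gt0.
    lra.
  have h2 := ih _ y2.
  have h3 : N / (2 * y) <= N / y.
    by rewrite ler_wpM2l// lef_pV2 ?posrE//; lra.
  rewrite exprS -mulrA.
  have h4 : (3 / 4) ^+ n * (N / (2 * y)) <= (3 / 4) ^+ n * (N / y).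
    by rewrite ler_wpM2l// exprn_ge0// divr_ge0.
  lra.
move=> y y0; apply/ler_addgt0Pr => e e0.
have lt1 : `|3 / 4 : R| < 1 by rewrite ger0_norm ?divr_ge0//; lra.
have /cvgr0Pnorm_le/(_ (e / (N / y + 1))) := cvg_expr lt1.
have p1 : 0 < N / y + 1 by rewrite ltr_wpDl// divr_ge0// ltW.
case=> [|n _ hn]; first by rewrite divr_gt0.
apply: (le_trans (it n y y0)); rewrite lerD2l.
have := hn n (leqnn n); rewrite /= ger0_norm ?exprn_ge0 ?divr_ge0// ler_pdivlMr//.
apply: le_trans; rewrite ler_wpM2l ?exprn_ge0 ?divr_ge0//.
by rewrite lerDl.
Qed.

Lemma HL_avg (x M : R) h : intg h -> (forall t, 0 <= h t) ->
  (HL_maximal h x <= M%:E)%E ->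
  forall r, 0 < r -> \int[mu]_t (\1_(ball x r) t * h t) <= 2 * r * M.
Proof.
move=> hi h0 HL r r0.
have : (iavg h (ball x r) <= M%:E)%E.
  apply: le_trans HL; apply: ereal_sup_ubound; exists r => //=.
  by rewrite in_itv /= r0.
rewrite /iavg measure_ball ?(ltW r0)//.
have -> : (\int[mu]_(y in ball x r) `|(h y)%:E| = (\int[mu]_t (\1_(ball x r) t * h t))%:E)%E.
  rewrite /Rintegral fineK; last by apply: integrable_fin_num => //; exact: intg_indic_ball.
  rewrite [LHS]integral_mkcond; apply: eq_integral => t _.
  rewrite patchE indicE; case: (t \in _); rewrite ?mul1r ?mul0r//=.
  by rewrite ger0_norm.
have r2 : r *+ 2 != 0 by rewrite mulrn_eq0 /= gt_eqF.
rewrite inver (negbTE r2) -EFinM lee_fin ler_pdivrMl ?mulrn_wgt0//.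
by rewrite mulr_natl.
Qed.

Lemma conv_pk_le_HL (x M : R) h : intg h -> (forall t, 0 <= h t) ->
  (HL_maximal h x <= M%:E)%E ->
  forall y, 0 < y -> conv (pk y) h x <= 24 * M.
Proof. by move=> hi h0 HL; apply: conv_pk_le_avg => //; exact: HL_avg. Qed.

(** On the right half plane this is [z / (lam + z)], with values in the disc of diameter [[0, 1]].
    The form chosen exhibits the resolvent, so that membership in [alg] follows from
    [resolvent_alg]. *)
Definition cayley (lam : R) z : C := 1 - (lam%:C)%C * ((lam%:C)%C + z)^-1.

Lemma cayleyE (lam : R) z : 0 < lam -> 0 <= complex.Re z ->
  cayley lam z = z * ((lam%:C)%C + z)^-1.
Proof. by move=> l0 z0; rewrite /cayley; have := normc_addr_gt0 l0 z0 => ?; field. Qed.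

Lemma cayley_Re (lam : R) z : 0 < lam -> 0 <= complex.Re z ->
  complex.Re (cayley lam z) = (complex.Re z * (lam + complex.Re z) + complex.Im z ^+ 2) /
     ((lam + complex.Re z) ^+ 2 + complex.Im z ^+ 2).
Proof.
move=> l0 z0; case: z z0 => a b /= a0.
have d0 : 0 < (lam + a) ^+ 2 + b ^+ 2 by rewrite ltr_pwDl ?sqr_ge0// exprn_gt0// ltr_wpDr.
have dn : (lam + a) ^+ 2 + b ^+ 2 != 0 by rewrite gt_eqF.
by rewrite !add0r mul0r subr0; field.
Qed.

Lemma cayley_Re_ge0 (lam : R) z : 0 < lam -> 0 <= complex.Re z ->
  0 <= complex.Re (cayley lam z).
Proof.
move=> l0 z0; rewrite cayley_Re//; apply: divr_ge0.
  by rewrite addr_ge0 ?sqr_ge0// mulr_ge0// addr_ge0// ltW.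
by rewrite addr_ge0 ?sqr_ge0.
Qed.

Lemma cayley_Re_ge (lam : R) z : 0 < lam -> 0 <= complex.Re z -> lam <= normc z ->
  4^-1 <= complex.Re (cayley lam z).
Proof.
move=> l0 z0 lz; rewrite cayley_Re//; case: z z0 lz => a b /= a0 lz.
have d0 : 0 < (lam + a) ^+ 2 + b ^+ 2 by rewrite ltr_pwDl ?sqr_ge0// exprn_gt0// ltr_wpDr.
rewrite ler_pdivlMr//.
have : lam ^+ 2 <= a ^+ 2 + b ^+ 2.
  rewrite -[leRHS]sqr_sqrtr ?addr_ge0 ?sqr_ge0//.
  by rewrite lerXn2r ?nnegrE ?(ltW l0)// sqrtr_ge0.
nra.
Qed.

Lemma cayley_norm_le (lam : R) z : 0 < lam -> 0 <= complex.Re z ->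
  normc (cayley lam z) <= normc z / lam.
Proof.
move=> l0 z0; rewrite cayleyE// normcM ler_wpM2l ?normc_ge0//.
exact: normc_resolvent_le.
Qed.

(** The factor 3 is that of the maximal inequality, and [2 * pi] bounds the mass in [U_intg]. The
    level [1/49] is small enough: where [lam <= |F|] the Poisson integral is at least
    [pi / 4 >= 1/2], while a maximal function below [1/49] would bound it by [24/49]. *)
Definition wt0 : R := 3 * 49 * (2 * pi).
(** Splitting [f] into two parts costs a factor 2, and halving the level for each of them
    another. *)
Definition wtC : R := 4 * wt0.

Lemma wt0_gt0 : 0 < wt0.
Proof. by rewrite /wt0; apply: mulr_gt0; apply: mulr_gt0; rewrite ?ltr0n// pi_gt0. Qed.

Lemma wtC_gt0 : 0 < wtC.
Proof. by rewrite /wtC; apply: mulr_gt0; [rewrite ltr0n|exact: wt0_gt0]. Qed.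

Section nonneg.
Variables (f : R -> R) (lam : R).
Hypotheses (fi : intg f) (f0 : forall t, 0 <= f t) (l0 : 0 < lam).

Let U (x y : R) := complex.Re (cayley lam (FC f x y)).

Let U_ge0 (x y : R) : 0 < y -> 0 <= U x y.
Proof. by move=> y0; apply: cayley_Re_ge0 => //; exact: FC_Re_ge0. Qed.

Let U_alg (eta : R) : 0 < eta -> alg (fun z => cayley lam (FCs eta f z)).
Proof.
move=> e0; apply: (alg_ext (alg_add (alg_cst 1) (alg_scale (- (lam%:C)%C) (resolvent_alg e0 fi f0 l0)))) => z _.
by rewrite /cayley mulNr.
Qed.

Let U_meas (eta : R) : 0 < eta -> measurable_fun setT (U ^~ eta).
Proof.
move=> e0; have [+ _ _] := bmeas_alg (U_alg e0).
by rewrite /FCs /= add0r.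
Qed.

Let U_poisson (x y eta : R) : 0 < y -> 0 < eta ->
  conv (pk y) (U ^~ eta) x = pi * U x (y + eta).
Proof.
move=> y0 e0; have [+ _] := poisson_alg x y0 (U_alg e0).
by rewrite /FCs /= add0r.
Qed.

Let U_intg0 (x y eta : R) : 0 < y -> 0 < eta -> intg (fun t => pk y (x - t) * U t eta).
Proof.
move=> y0 e0; have [+ _] := poisson_intg x y0 (bmeas_alg (U_alg e0)).
by rewrite /FCs /= add0r.
Qed.

(** [n * pk n t] tends to 1, so by Fatou and the Poisson formula the mass of [U] at height [eta] is
    at most the lower limit of [n * pi * U 0 (n + eta)]. This stays bounded because [F] is
    [O(1 / y)] at height [y]. *)
Let U_intg (eta : R) : 0 < eta ->
  intg (U ^~ eta) /\ \int[mu]_t U t eta <= 2 * pi * \int[mu]_t f t / lam.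
Proof.
move=> e0.
set N := \int[mu]_t f t.
have N0 : 0 <= N by exact: Rintegral_ge0.
have NE : \int[mu]_t `|f t| = N by apply: eq_Rintegral => t _; rewrite ger0_norm.
apply: (@fatou_intg _ (fun n t => n.+1%:R * (pk n.+1%:R (0 - t) * U t eta))).
- by move=> n; apply: intgZ; apply: U_intg0.
- exact: U_meas.
- by move=> n t; rewrite mulr_ge0// mulr_ge0 ?pk_ge0 ?U_ge0.
- by move=> t; exact: U_ge0.
- apply: aeW => t.
  have c0 : (n.+1%:R^-1 : R) @[n --> \oo] --> 0 by exact: cvg_harmonic.
  have c1 : (1 + (t * n.+1%:R^-1) ^+ 2)^-1 @[n --> \oo] --> (1 + (t * 0) ^+ 2)^-1.
    have c2 : t * n.+1%:R^-1 @[n --> \oo] --> (t * 0 : R).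
      by apply: cvgM; [exact: cvg_cst|exact: c0].
    apply: cvgV; first by rewrite mulr0 expr0n addr0 oner_neq0.
    by apply: cvgD; [exact: cvg_cst|exact: (cvgM c2 c2)].
  rewrite mulr0 expr0n addr0 invr1 in c1.
  rewrite -[X in _ --> X]mul1r.
  rewrite (_ : (fun n => _) = (fun n => (1 + (t * n.+1%:R^-1) ^+ 2)^-1 * U t eta)).
    by apply: cvgM; [exact: c1|exact: cvg_cst].
  apply/funext => n; rewrite mulrA; congr (_ * _); rewrite sub0r pkN /pk.
  have n1 : n.+1%:R != 0 :> R by rewrite pnatr_eq0.
  have d1 := @den_neq0 R n.+1%:R t (ltr0Sn _ n).
  have -> : 1 + (t / n.+1%:R) ^+ 2 = (t ^+ 2 + n.+1%:R ^+ 2) / n.+1%:R ^+ 2.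
    by rewrite mulrDl divff ?expf_neq0// expr_div_n addrC.
  by rewrite invf_div mulrA expr2.
- move=> n; rewrite Rintegral_intgZ; last exact: U_intg0.
  have n0 : 0 < n.+1%:R :> R by rewrite ltr0n.
  have := U_poisson 0 n0 e0; rewrite /conv => ->.
  have Y0 : 0 < n.+1%:R + eta by exact: addr_gt0.
  have h : U 0 (n.+1%:R + eta) <= 2 * (n.+1%:R^-1 * N) / lam.
    apply: (le_trans (ler_norm _)); apply: (le_trans (normc_ge_Re _)).
    apply: (le_trans (cayley_norm_le l0 (FC_Re_ge0 _ Y0 f0))).
    rewrite ler_wpM2r ?invr_ge0 ?(ltW l0)//.
    apply: (le_trans (FC_bound _ Y0 fi)); rewrite NE ler_pM2l// ler_wpM2r//.
    by rewrite lef_pV2 ?posrE// lerDl ltW.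
  have -> : 2 * pi * N / lam = n.+1%:R * (pi * (2 * (n.+1%:R^-1 * N) / lam)).
    by field; rewrite nat1r pnatr_eq0 gt_eqF.
  by rewrite ler_pM2l// ler_wpM2l// pi_ge0.
Qed.

(* Where [lam <= |F|], the real part of the Cayley transform
   [F / (lam + F)] is at least [1/4], while its integral over a horizontal line
   is [O(|f|_1 / lam)]; the maximal inequality then applies to it. *)
Lemma weak_max : exists H : set R, [/\ measurable H,
    (mu H <= (wt0 * \int[mu]_t f t / lam)%:E)%E &
    forall x y, 0 < y -> lam <= normc (FC f x y) -> H x].
Proof.
pose eta n : R := n.+1%:R^-1.
have eta0 n : 0 < eta n by rewrite invr_gt0.
have lU n : locally_integrable setT (U ^~ (eta n)).
  by apply: open_integrable_locally; [exact: openT|exact: (U_intg (eta0 n)).1].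
pose Hn n := [set x | ((49^-1)%:E < HL_maximal (U ^~ (eta n)) x)%E].
have mHn n : measurable (Hn n).
  rewrite -[X in measurable X]setTI; apply: emeasurable_fun_o_infty => //.
  exact: measurable_HL_maximal.
(* The union of the [G N] is the set of points lying in [Hn n] for all large [n]. The uniform bound
   on the measures of the [Hn n] carries over to it, as the [G N] increase. *)
pose G N := \bigcap_(n in [set n | (N <= n)%N]) Hn n.
have mG N : measurable (G N) by apply: bigcap_measurable => //; exists N => /=.
have mU : measurable (\bigcup_N G N) by exact: bigcup_measurable.
exists (\bigcup_N G N); split => //.
- have hG : {homo G : n m / (n <= m)%N >-> (n <= m)%O}.
    by move=> n m nm; apply/subsetPset => x Gx k /= mk; apply: Gx; exact: leq_trans mk.
  have cG := @nondecreasing_cvg_mu _ (measurableTypeR R) R mu G mG mU hG.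
  rewrite -(cvg_lim _ cG)//; apply: lime_le; first exact: cvgP cG.
  apply: nearW => n.
  apply: (@le_trans _ _ (mu (Hn n))).
    apply: le_measure => [||x Gx]; [exact: (mem_set (mG n))|exact: (mem_set (mHn n))|exact: (Gx n (leqnn n))].
  apply: (le_trans (maximal_inequality (lU n) _)); first by rewrite invr_gt0.
  have [ui uN] := U_intg (eta0 n).
  have -> : (\int[mu]_y `|(U y (eta n))%:E| = (\int[mu]_y (U y (eta n)))%:E)%E.
    rewrite /Rintegral fineK; last exact: integrable_fin_num.
    by apply: eq_integral => t _; rewrite /= ger0_norm// U_ge0.
  rewrite -EFinM lee_fin invrK.
  have -> : wt0 * \int[mu]_t f t / lam = (3 * 49) * (2 * pi * \int[mu]_t f t / lam) by rewrite /wt0; ring.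
  by rewrite ler_pM2l.
- move=> x y y0 hl.
  have /cvgr0Pnorm_lt/(_ _ y0)[N _ hN] := @cvg_harmonic R.
  exists N => // n /= Nn; rewrite /Hn /= ltNge; apply/negP => HL.
  have ey : eta n < y by apply: le_lt_trans (hN n Nn); exact: ler_norm.
  have y1 : 0 < y - eta n by rewrite subr_gt0.
  have := conv_pk_le_HL (U_intg (eta0 n)).1 (fun t => U_ge0 t (eta0 n)) HL y1.
  rewrite U_poisson// subrK.
  have := cayley_Re_ge l0 (FC_Re_ge0 x y0 f0) hl; rewrite -/(U x y).
  have := @pi_ge2 R; nra.
Qed.

End nonneg.

Definition fpos f t := (`|f t| + f t) / 2.
Definition fneg f t := (`|f t| - f t) / 2.

Lemma fpos_ge0 f t : 0 <= fpos f t.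
Proof. by rewrite /fpos; have := lerNnormlW (lexx `|f t|); have := ler_norm (- f t); rewrite normrN; lra. Qed.

Lemma fneg_ge0 f t : 0 <= fneg f t.
Proof. by rewrite /fneg; have := ler_norm (f t); lra. Qed.

Lemma fpos_fneg f t : f t = fpos f t + (-1) * fneg f t.
Proof. by rewrite /fpos /fneg; lra. Qed.

Lemma fpos_intg f : intg f -> intg (fpos f).
Proof.
move=> fi; rewrite /fpos; under [X in intg X]eq_fun do rewrite mulrC.
by apply: intgZ; apply: intgD => //; exact: intg_norm.
Qed.

Lemma fneg_intg f : intg f -> intg (fneg f).
Proof.
move=> fi; rewrite /fneg; under [X in intg X]eq_fun do rewrite mulrC.
by apply: intgZ; apply: intgB => //; exact: intg_norm.
Qed.

Lemma fpos_le f t : fpos f t <= `|f t|.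
Proof. by rewrite /fpos; have := ler_norm (f t); lra. Qed.

Lemma fneg_le f t : fneg f t <= `|f t|.
Proof. by rewrite /fneg; have := ler_norm (- f t); rewrite normrN; lra. Qed.

Lemma convZr_qk (y x c : R) g : 0 < y -> intg g ->
  conv (qk y) (fun t => c * g t) x = c * conv (qk y) g x.
Proof.
move=> y0 gi; rewrite /conv -Rintegral_intgZ; last exact: conv_qk_intg.
by apply: eq_Rintegral => t _; rewrite mulrCA.
Qed.

Lemma convZr_pk (y x c : R) g : 0 < y -> intg g ->
  conv (pk y) (fun t => c * g t) x = c * conv (pk y) g x.
Proof.
move=> y0 gi; rewrite /conv -Rintegral_intgZ; last exact: conv_pk_intg.
by apply: eq_Rintegral => t _; rewrite mulrCA.
Qed.

Lemma conv_qk_fposneg (y x : R) f : 0 < y -> intg f ->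
  conv (qk y) f x = conv (qk y) (fpos f) x - conv (qk y) (fneg f) x.
Proof.
move=> y0 fi; rewrite {1}(_ : f = fun t => fpos f t + (-1) * fneg f t); last first.
  by apply/funext => t; rewrite -fpos_fneg.
rewrite convDr_qk//; [|exact: fpos_intg|by apply: intgZ; exact: fneg_intg].
by rewrite convZr_qk ?mulN1r//; exact: fneg_intg.
Qed.

Lemma weak_max_qk f (lam : R) : intg f -> 0 < lam -> exists H : set R, [/\ measurable H,
    (mu H <= (wtC * \int[mu]_t `|f t| / lam)%:E)%E &
    forall x y, 0 < y -> lam <= `|conv (qk y) f x| -> H x].
Proof.
move=> fi l0; have l2 : 0 < lam / 2 by rewrite divr_gt0.
have ip := fpos_intg fi; have im := fneg_intg fi.
have [H1 [mH1 muH1 hH1]] := weak_max ip (fpos_ge0 f) l2.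
have [H2 [mH2 muH2 hH2]] := weak_max im (fneg_ge0 f) l2.
exists (H1 `|` H2); split; first exact: measurableU.
- apply: (@le_trans _ _ (mu H1 + mu H2)%E); first exact: measureU2.
  apply: (le_trans (leeD muH1 muH2)); rewrite -EFinD lee_fin.
  have h1 : \int[mu]_t fpos f t <= \int[mu]_t `|f t|.
    by apply: le_Rint => //; [exact: intg_norm|move=> t; exact: fpos_le].
  have h2 : \int[mu]_t fneg f t <= \int[mu]_t `|f t|.
    by apply: le_Rint => //; [exact: intg_norm|move=> t; exact: fneg_le].
  have -> : wtC * \int[mu]_t `|f t| / lam =
     wt0 * \int[mu]_t `|f t| / (lam / 2) + wt0 * \int[mu]_t `|f t| / (lam / 2).
    by rewrite /wtC; field; rewrite gt_eqF.
  have l2' : 0 <= (lam / 2)^-1 by rewrite invr_ge0 ltW.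
  have p1 := ltW wt0_gt0.
  apply: lerD; apply: (ler_wpM2r l2'); exact: (ler_wpM2l p1).
- move=> x y y0; rewrite conv_qk_fposneg// => hl.
  have [h|h] := leP (lam / 2) (normc (FC (fpos f) x y)); first by left; exact: hH1 h.
  right; apply: (hH2 x y y0).
  have := ler_normB (conv (qk y) (fpos f) x) (conv (qk y) (fneg f) x).
  have := normc_ge_Im (FC (fpos f) x y); have := normc_ge_Im (FC (fneg f) x y) => /=.
  move: h; rewrite /FC /=; lra.
Qed.

End WeakType.

(** * Almost everywhere boundary values *)

Section LebesguePoints.
Context {R : realType}.
Local Notation mu := (@lebesgue_measure R).
Local Notation intg f := (mu.-integrable setT (EFin \o f)).
Implicit Types (f g h k : R -> R).

Lemma cvg0rP (F : R -> R) (l : R) : F y @[y --> 0^'+] --> l <->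
  (forall e, 0 < e -> exists2 d : R, 0 < d & forall y, 0 < y -> y < d -> `|F y - l| <= e).
Proof.
split.
  move=> /cvgrPdist_le h e e0; have := h e e0.
  case=> d /= d0 hd; exists d => // y y0 yd.
  by rewrite distrC; apply: hd => //=; rewrite sub0r normrN gtr0_norm.
move=> h; apply/cvgrPdist_le => e e0; have [d d0 hd] := h e e0.
near=> y; rewrite distrC; apply: hd; near: y.
  exact: nbhs_right_gt.
exact: nbhs_right_lt.
Unshelve. all: by end_near. Qed.

(** The recursion holds only below [y0], and the a priori bound blows up at 0. Halving from [y0]
    downwards first gives the uniform bound [4 e + K], where [4 e = e / (1 - 3/4)]. Then [n] further
    uses of the recursion, possible for [y < y0 / 2^n], shrink the excess by [(3/4)^n]. The total is
    [8 e], hence the division of [e'] by 8. *)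
Lemma recursion_cvg0 (Phi : R -> R) (N : R) :
  (forall y, 0 < y -> 0 <= Phi y) ->
  (forall y, 0 < y -> Phi y <= N / y + N) -> 0 <= N ->
  (forall e, 0 < e -> exists2 y0 : R, 0 < y0 & forall y, 0 < y -> y < y0 ->
     Phi y <= e + 3 / 4 * Phi (2 * y)) ->
  Phi y @[y --> 0^'+] --> 0.
Proof.
move=> P0 PN N0 rec; apply/cvg0rP => e' e'0.
have [|y0 y00 hy0] := rec (e' / 8) _; first by rewrite divr_gt0.
set e := e' / 8 in hy0; have e0 : 0 < e by rewrite divr_gt0.
pose K := N / y0 + N.
have K0 : 0 <= K by rewrite addr_ge0// divr_ge0// ltW.
have bd m : forall y, 0 < y -> y0 / 2 ^+ m <= y -> Phi y <= 4 * e + K.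
  elim: m => [|m ih] y yp.
    rewrite expr0 divr1 => h; apply: (le_trans (PN y yp)).
    have : N / y <= N / y0 by rewrite ler_wpM2l// lef_pV2 ?posrE.
    by rewrite /K; lra.
  move=> h; have [yy|yy] := ltP y y0; last first.
    apply: (le_trans (PN y yp)).
    have : N / y <= N / y0 by rewrite ler_wpM2l// lef_pV2 ?posrE.
    by rewrite /K; lra.
  apply: (le_trans (hy0 y yp yy)).
  have y2 : 0 < 2 * y by rewrite mulr_gt0.
  have := ih _ y2; rewrite -ler_pdivrMl// => ih'.
  have : Phi (2 * y) <= 4 * e + K.
    by apply: ih'; move: h; rewrite exprS invfM mulrCA.
  lra.
have bd' y : 0 < y -> Phi y <= 4 * e + K.
  move=> yp; have lt1 : `|2^-1 : R| < 1 by rewrite ger0_norm// invf_lt1// ltr1n.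
  have /cvgr0Pnorm_le/(_ (y / y0)) := cvg_expr lt1.
  case=> [|m _ hm]; first by rewrite divr_gt0.
  apply: (bd m) => //; have := hm m (leqnn m); rewrite /= ger0_norm ?exprn_ge0//.
  by rewrite ler_pdivlMr// exprVn mulrC.
have sm n : forall y, 0 < y -> 2 ^+ n * y < y0 -> Phi y <= 4 * e + (3 / 4) ^+ n * (4 * e + K).
  elim: n => [|n ih] y yp h.
    by rewrite expr0 mul1r; apply: (le_trans (bd' y yp)); lra.
  have yy : y < y0.
    apply: le_lt_trans h; rewrite ler_peMl ?(ltW yp)//.
    by apply: exprn_ege1; rewrite ler1n.
  apply: (le_trans (hy0 y yp yy)).
  have y2 : 0 < 2 * y by rewrite mulr_gt0.
  have := ih _ y2; rewrite mulrA -exprSr => /(_ h).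
  rewrite exprS; lra.
have lt1 : `|3 / 4 : R| < 1 by rewrite ger0_norm ?divr_ge0//; lra.
have p1 : 0 < 4 * e + K by rewrite ltr_pwDl// mulr_gt0.
have /cvgr0Pnorm_le/(_ (4 * e / (4 * e + K))) := cvg_expr lt1.
case=> [|n _ hn]; first by rewrite divr_gt0// mulr_gt0.
exists (y0 / 2 ^+ n); first by rewrite divr_gt0// exprn_gt0.
move=> y yp yn; rewrite subr0 ger0_norm ?P0//.
apply: (le_trans (sm n y yp _)); first by rewrite mulrC -ltr_pdivlMr// exprn_gt0.
have := hn n (leqnn n); rewrite /= ger0_norm ?exprn_ge0 ?divr_ge0// ler_pdivlMr//.
have : e' = 8 * e by rewrite /e; field.
lra.
Qed.

Section point.
Variables (f : R -> R) (x : R).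
Hypotheses (fi : intg f) (lx : lebesgue_pt f x).

Let h t := `|f t - f x|.
Let Phi y := conv (pk y) h x.

Let mh : measurable_fun setT h.
Proof.
apply: measurableT_comp => //; apply: measurable_funB => //.
exact: intg_measurable.
Qed.

(** [h] is in general not integrable, because of the constant [f x]; only its products with bounded
    integrable kernels are. *)
Let hi (k : R -> R) (M : R) : measurable_fun setT k -> (forall u, `|k u| <= M) -> intg k ->
  intg (fun t => k (x - t) * h t).
Proof.
move=> mk kM ki.
have mk' : measurable_fun setT (fun t : R => k (x - t)).
  by apply: (measurableT_comp mk); exact: (@measurable_funB _ _ R setT (cst x) id).
apply: (@le_intg _ _ (fun t => `|k (x - t) * f t| + `|f x| * `|k (x - t)|)).
- by apply: measurable_funM.
- move=> t; rewrite !normrM /h normr_id [`|f x| * _]mulrC -mulrDr ler_wpM2l//.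
  exact: ler_normB.
- apply: intgD; first by apply: intg_norm; exact: conv_integrand_bounded kM fi.
  by apply: intgZ; apply: intg_norm; exact: (intg_refl x).
Qed.

Let hpk y : 0 < y -> intg (fun t => pk y (x - t) * h t).
Proof.
move=> y0; apply: (@hi _ (y^-1)); first exact: measurable_pk.
- by move=> u; exact: pk_norm_le.
- exact: intg_pk.
Qed.

Let hball r : intg (fun t => \1_(ball x r) t * h t).
Proof.
have e : (fun t => \1_(ball x r) t * h t) = (fun t => \1_(ball (0:R) r) (x - t) * h t).
  apply/funext => t; congr (_ * _); rewrite !indicE; congr (nat_of_bool _)%:R.
  by apply/idP/idP; rewrite !inE /ball /= sub0r normrN.
rewrite e; apply: (@hi _ 1).
- by apply: measurable_indic; exact: measurable_ball.
- by move=> u; rewrite indicE; case: (_ \in _); rewrite ?normr1 ?normr0.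
- have -> : ball (0 : R) r = [set` `](- r), r[ : interval R].
    by apply/seteqP; split => u /=; rewrite /ball /= sub0r normrN in_itv /= ltr_norml.
  exact: integrable_indic_itv.
Qed.

Let Phi_ge0 y : 0 < y -> 0 <= Phi y.
Proof.
by move=> y0; apply: Rintegral_ge0 => t _; exact: mulr_ge0 (pk_ge0 _ y0) (normr_ge0 _).
Qed.

Lemma lebesgue_pt_pk : Phi y @[y --> 0^'+] --> 0.
Proof.
set N := \int[mu]_t `|f t| + pi * `|f x|.
have p0 := @pi_ge0 R.
have I0 : 0 <= \int[mu]_t `|f t| by exact: Rintegral_ge0.
apply: (@recursion_cvg0 _ N).
- exact: Phi_ge0.
- move=> y y0.
  have i1 : intg (fun t => pk y (x - t)) by apply: (intg_refl x); exact: intg_pk.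
  apply: (@le_trans _ _ (y^-1 * \int[mu]_t `|f t| + `|f x| * \int[mu]_t (pk y (x - t)))).
    rewrite -Rintegral_intgZ; last exact: intg_norm.
    rewrite -Rintegral_intgZ// -Rintegral_intgD; [|by apply: intgZ; exact: intg_norm|exact: intgZ].
    apply: le_Rint; [exact: hpk|by apply: intgD; apply: intgZ => //; exact: intg_norm|move=> t].
    apply: (@le_trans _ _ (pk y (x - t) * `|f t| + pk y (x - t) * `|f x|)).
      by rewrite -mulrDr ler_wpM2l ?pk_ge0// /h; exact: ler_normB.
    by rewrite [pk _ _ * `|f x|]mulrC lerD2r ler_wpM2r ?pk_le.
  rewrite Rintegral_pk_refl// /N mulrDl [`|f x| * pi]mulrC.
  have q0 : 0 <= pi * `|f x| / y by rewrite divr_ge0 ?(ltW y0)// mulr_ge0.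
  by rewrite [y^-1 * _]mulrC -addrA lerD2l addrA lerDr addr_ge0.
- by rewrite /N addr_ge0// mulr_ge0.
- move=> e e0.
  (* The ball of radius [3 y] has length [6 y], so an average of [e / 6] contributes [e] after
     division by [y]. *)
  have e6 : 0 < e / 6 by rewrite divr_gt0.
  have : \forall r \near 0^'+, (davg f x r <= (e / 6)%:E)%E.
    have := lx; rewrite /lebesgue_pt => /fine_cvgP[fin]; move/cvgr0Pnorm_le/(_ _ e6).
    move=> H; near=> r.
    have fr : davg f x r \is a fin_num by near: r.
    rewrite -(fineK fr) lee_fin; apply: le_trans (ler_norm _) _; by near: r.
  case=> d /= d0 hd.
  exists (d / 3); first by rewrite divr_gt0.
  move=> y y0 yd.
  have y3 : 0 < 3 * y by rewrite mulr_gt0.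
  have : (davg f x (3 * y)%R <= (e / 6)%:E)%E.
    by apply: hd => //=; rewrite sub0r normrN gtr0_norm// mulrC -ltr_pdivlMr.
  rewrite /davg /iavg measure_ball ?(ltW y3)//.
  have -> : (\int[mu]_(y in ball x (3 * y)) `|((center (f x) \o f) y)%:E| = (\int[mu]_t (\1_(ball x (3 * y)) t * h t))%:E)%E.
    rewrite /Rintegral fineK; last by apply: integrable_fin_num => //; exact: hball.
    rewrite [LHS]integral_mkcond; apply: eq_integral => t _.
    by rewrite patchE indicE; case: (t \in _); rewrite ?mul1r ?mul0r.
  have r2 : 3 * y *+ 2 != 0 by rewrite mulrn_eq0 /= gt_eqF.
  rewrite inver (negbTE r2) -EFinM lee_fin ler_pdivrMl ?mulrn_wgt0// => havg.
  have y2 : 0 < 2 * y by rewrite mulr_gt0.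
  apply: (@le_trans _ _ (y^-1 * \int[mu]_t (\1_(ball x (3 * y)) t * h t) + 3 / 4 * Phi (2 * y))).
    rewrite /Phi /conv -Rintegral_intgZ; last exact: hball.
    rewrite -Rintegral_intgZ; last exact: hpk.
    rewrite -Rintegral_intgD; [|by apply: intgZ; exact: hball|by apply: intgZ; exact: hpk].
    apply: le_Rint; [exact: hpk|by apply: intgD; apply: intgZ; [exact: hball|exact: hpk]|].
    move=> t; have := pk_dyadic (x - t) y0.
    have -> : \1_(ball (0 : R) (3 * y)) (x - t) = \1_(ball x (3 * y)) t :> R.
      rewrite !indicE; congr (nat_of_bool _)%:R.
      by apply/idP/idP; rewrite !inE /ball /= sub0r normrN.
    by move=> /(ler_wpM2r (normr_ge0 (f t - f x))); rewrite mulrDl !mulrA.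
  rewrite lerD2r ler_pdivrMl//; apply: (le_trans havg).
  rewrite -mulr_natr; lra.
Unshelve. all: by end_near. Qed.

(** Domination by the Poisson kernel reduces everything to [lebesgue_pt_pk]. It serves for [pk]
    itself, for [tk - qk] with mass 0, and for the indicator of a ball divided by its radius, with
    mass 2. *)
Lemma lebesgue_pt_kernel (K : R -> R -> R) (M c : R) :
  (forall y, 0 < y -> measurable_fun setT (K y)) ->
  (forall y u, 0 < y -> `|K y u| <= M * pk y u) ->
  (forall y, 0 < y -> \int[mu]_u K y u = c) ->
  conv (K y) f x @[y --> 0^'+] --> c * f x.
Proof.
move=> mK KM Kc.
have M0 : 0 <= M.
  have := le_trans (normr_ge0 _) (KM 1 0 ltr01); rewrite pmulr_lge0//; exact: pk_gt0.
apply/cvg0rP => e e0.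
have [|d d0 hd] := (cvg0rP Phi 0).1 lebesgue_pt_pk (e / (M + 1)).
  by rewrite divr_gt0// ltr_wpDl.
exists d => // y y0 yd; have := hd y y0 yd; rewrite subr0 ger0_norm; last exact: Phi_ge0.
rewrite ler_pdivlMr ?ltr_wpDl// => hP.
have Kb u : `|K y u| <= M * y^-1.
  by apply: (le_trans (KM y u y0)); rewrite ler_wpM2l ?pk_le.
have Ki : intg (K y).
  apply: (@le_intg _ _ (fun u => M * pk y u)); [exact: mK|by move=> u; exact: KM|].
  by apply: intgZ; exact: intg_pk.
have i1 := conv_integrand_bounded x (mK y y0) Kb fi.
have i2 : intg (fun t => K y (x - t)) by exact: (intg_refl x).
have -> : conv (K y) f x - c * f x = \int[mu]_t (K y (x - t) * (f t - f x)).
  rewrite -(Kc y y0) -(Rintegral_refl x Ki) mulrC -Rintegral_intgZ// -Rintegral_intgB//; last exact: intgZ.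
  by apply: eq_Rintegral => t _; rewrite mulrBr [f x * _]mulrC.
apply: (@le_trans _ _ (M * Phi y)); last first.
  apply: le_trans hP; rewrite mulrDr mulr1 [M * _]mulrC lerDl.
  exact: Phi_ge0.
rewrite /Phi /conv -Rintegral_intgZ; last exact: hpk.
apply: le_norm_Rint.
- have := intgB i1 (intgZ (f x) i2).
  by apply: eq_integrable => // t _ /=; rewrite mulrBr [f x * _]mulrC.
- by apply: intgZ; exact: hpk.
- by move=> t; rewrite normrM mulrA ler_wpM2r// KM.
Qed.

Lemma lebesgue_pt_pk_cvg : conv (pk y) f x @[y --> 0^'+] --> pi * f x.
Proof.
apply: (@lebesgue_pt_kernel pk 1).
- by move=> y; exact: measurable_pk.
- by move=> y u y0; rewrite mul1r ger0_norm ?pk_ge0.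
- exact: Rintegral_pk.
Qed.

End point.

Definition tk (e u : R) : R := \1_[set v : R | e < `|v|] u * u^-1.

Lemma tkE (e u : R) : tk e u = if e < `|u| then u^-1 else 0.
Proof.
rewrite /tk indicE; have [h|h] := boolP (e < `|u|).
  by rewrite mem_set ?mul1r.
by rewrite memNset ?mul0r//=; exact/negP.
Qed.

Lemma tkN (e u : R) : tk e (- u) = - tk e u.
Proof. by rewrite !tkE normrN invrN; case: ifP; rewrite ?oppr0. Qed.

Lemma tk_le (e u : R) : 0 < e -> `|tk e u| <= e^-1.
Proof.
move=> e0; rewrite tkE; case: ifPn => h; last by rewrite normr0 invr_ge0 ltW.
by rewrite normfV lef_pV2 ?posrE ?ltW// (lt_trans e0).
Qed.

Lemma measurable_tail_set (e : R) : measurable [set v : R | e < `|v|].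
Proof.
have -> : [set v : R | e < `|v|] = ~` [set` `[(- e), e] : interval R].
  apply/seteqP; split => v /=; rewrite in_itv /= -ler_norml leNgt; first by move=> ->.
  by move/negP; rewrite negbK.
exact: measurableC.
Qed.

(** [qk y] tends to the inverse pointwise as [y] tends to 0, even at 0, where [0^-1 = 0] is the
    value of every [qk y]. *)
Lemma measurable_inv : measurable_fun setT (GRing.inv : R -> R).
Proof.
apply: (@measurable_fun_cvg _ _ R setT (fun n : nat => qk (n.+1%:R^-1)) (GRing.inv : R -> R)).
  by move=> n; apply: measurable_qk; rewrite invr_gt0.
move=> v _; have [->|v0] := eqVneq v 0.
  by under eq_fun do rewrite /qk mul0r; rewrite invr0; exact: cvg_cst.
have -> : v^-1 = v / (v ^+ 2 + 0 ^+ 2) by rewrite expr0n addr0; field.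
apply: cvgM; first exact: cvg_cst.
apply: cvgV; first by rewrite expr0n addr0 expf_neq0.
apply: cvgD; first exact: cvg_cst.
have c0 : (n.+1%:R^-1 : R) @[n --> \oo] --> 0 by exact: cvg_harmonic.
exact: (cvgM c0 c0).
Qed.

Lemma measurable_tk (e : R) : measurable_fun setT (tk e).
Proof.
apply: measurable_funM; last exact: measurable_inv.
by apply: measurable_indic; exact: measurable_tail_set.
Qed.

Lemma tk_qk_le (e u : R) : 0 < e -> `|tk e u - qk e u| <= 2 * pk e u.
Proof.
move=> e0; have d := den_gt0 u e0; rewrite tkE; case: ifPn => h.
  have u0 : u != 0 by rewrite -normr_gt0 (lt_trans e0).
  rewrite /qk /pk.
  have -> : u^-1 - u / (u ^+ 2 + e ^+ 2) = e ^+ 2 / (u * (u ^+ 2 + e ^+ 2)).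
    by field; rewrite u0 gt_eqF.
  rewrite normrM normfV (normrM u) (ger0_norm (ltW d)) (ger0_norm (sqr_ge0 e)) invfM !mulrA.
  rewrite ler_wpM2r ?invr_ge0 ?(ltW d)// ler_pdivrMr ?normr_gt0//.
  nra.
rewrite sub0r normrN /qk /pk normrM normfV (ger0_norm (ltW d)) mulrA ler_wpM2r ?invr_ge0 ?(ltW d)//.
move: h; rewrite -leNgt; lra.
Qed.

Lemma odd_Rint0 k : intg k -> (forall u, k (- u) = - k u) -> \int[mu]_u k u = 0.
Proof.
move=> ki ko; have := Rintegral_refl 0 ki.
have -> : \int[mu]_x k (0 - x) = - \int[mu]_x k x.
  rewrite -mulN1r -Rintegral_intgZ//; apply: eq_Rintegral => t _.
  by rewrite sub0r ko mulN1r.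
lra.
Qed.

(** The difference of the two kernels is odd, hence of mass 0, and dominated by [pk]. So the
    truncated integrals that define [hilbert] and the conjugate Poisson integrals have the same
    limit at a Lebesgue point. *)
Lemma lebesgue_pt_tk_qk f x : intg f -> lebesgue_pt f x ->
  conv (tk y) f x - conv (qk y) f x @[y --> 0^'+] --> 0.
Proof.
move=> fi lx.
have mK y : 0 < y -> measurable_fun setT (fun u => tk y u - qk y u).
  by move=> y0; apply: measurable_funB; [exact: measurable_tk|exact: measurable_qk].
have h : conv (fun u => tk y u - qk y u) f x @[y --> 0^'+] --> 0 * f x.
  apply: (@lebesgue_pt_kernel f x fi lx _ 2) => //.
  - by move=> y u y0; exact: tk_qk_le.
  - move=> y y0; apply: odd_Rint0.
      apply: (@le_intg _ _ (fun u => 2 * pk y u)); [exact: mK|by move=> u; exact: tk_qk_le|].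
      by apply: intgZ; exact: intg_pk.
    by move=> u; rewrite tkN qkN opprB opprK addrC.
rewrite mul0r in h; apply/cvg0rP => e e0; have [d d0 hd] := (cvg0rP _ _).1 h e e0.
exists d => // y y0 yd; have := hd y y0 yd; congr (`|_ - _| <= _).
have i1 := conv_integrand_bounded x (measurable_tk y) (fun u => tk_le u y0) fi.
have i2 := conv_qk_intg x y0 fi.
by rewrite /conv -Rintegral_intgB//; apply: eq_Rintegral => t _; rewrite mulrBl.
Qed.

Lemma ae_lebesgue_pt f : intg f -> {ae mu, forall x, lebesgue_pt f x}.
Proof.
by move=> fi; apply: lebesgue_differentiation; apply: open_integrable_locally => //; exact: openT.
Qed.

End LebesguePoints.

(** * Almost everywhere convergence of the conjugate Poisson integral *)

Section AeConvergence.
Context {R : realType}.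
Local Notation mu := (@lebesgue_measure R).
Local Notation intg f := (mu.-integrable setT (EFin \o f)).
Local Notation cplx x y := (Complex x y : R[i]).
Implicit Types (f g h k : R -> R).

(** The [f_ n] have no common dominating function, but [|f_ n - f| - |f_ n| + |f|] lies between 0
    and [2 |f|]. Dominated convergence applies to it, and the bound on the norms absorbs the other
    two terms. *)
Lemma scheffe (f_ : nat -> R -> R) f : (forall n, intg (f_ n)) -> intg f ->
  {ae mu, forall x, f_ n x @[n --> \oo] --> f x} ->
  (forall n, \int[mu]_x `|f_ n x| <= \int[mu]_x `|f x|) ->
  \int[mu]_x `|f_ n x - f x| @[n --> \oo] --> 0.
Proof.
move=> if_ fi cf le.
pose th n x := `|f_ n x - f x| - `|f_ n x| + `|f x|.
have i1 n : intg (fun x => `|f_ n x - f x|) by apply: intg_norm; exact: intgB.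
have i2 n : intg (fun x => `|f_ n x - f x| - `|f_ n x|) by apply: intgB => //; exact: intg_norm.
have i3 := intg_norm fi.
have ith n : intg (th n) by exact: intgD.
have th0 n x : 0 <= th n x.
  by rewrite /th; have := ler_normB (f_ n x - f x) (- f x); rewrite opprK subrK normrN; lra.
have th2 n x : `|th n x| <= 2 * `|f x|.
  rewrite ger0_norm ?th0// /th; have := ler_normB (f_ n x) (f x); lra.
have cth : \int[mu]_x th n x @[n --> \oo] --> \int[mu]_x (cst (0 : R) x).
  have [] // := @dominated_cvgR R setT th (cst 0) (fun x => 2 * `|f x|) measurableT.
  - by move=> n; exact: intg_measurable.
  - apply: ae_imp cf _ => x cx _.
    have -> : cst (0 : R) x = `|f x - f x| - `|f x| + `|f x| by rewrite subrr normr0 sub0r addNr.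
    apply: cvgD; last exact: cvg_cst.
    apply: cvgB; apply: cvg_norm => //.
    by apply: cvgB => //; exact: cvg_cst.
  - exact: intgZ.
  - by apply: aeW => x n _; exact: th2.
rewrite Rintegral_cst// mul0r in cth.
apply: (squeeze_cvgr _ (cvg_cst 0) cth); apply: nearW => n.
apply/andP; split; first exact: Rintegral_ge0.
rewrite /th Rintegral_intgD// Rintegral_intgB//; last exact: intg_norm.
by have := le n; lra.
Qed.

Lemma measurable_abs_param (F : R -> R -> R) :
  measurable_fun setT (fun z : R * R => F z.1 z.2) ->
  measurable_fun setT (fun t : R => \int[mu]_s `|(F t s)%:E|)%E.
Proof.
move=> mF.
apply: (measurable_fun_fubini_tonelli_F (m2 := mu) (fun z : measurableTypeR R * measurableTypeR R => `|(F z.1 z.2)%:E|%E)) => //.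
by apply/measurable_EFinP; apply: measurableT_comp => //; exact: mF.
Qed.

Lemma measurable_section (F : R -> R -> R) t :
  measurable_fun setT (fun z : R * R => F z.1 z.2) -> measurable_fun setT (F t).
Proof. by move=> mF; exact: (measurableT_comp mF (@measurable_pair1 _ _ R R t)). Qed.

Lemma fubini_bounded (b F : R -> R -> R) (M : R) :
  measurable_fun setT (fun z : R * R => b z.1 z.2) ->
  measurable_fun setT (fun z : R * R => F z.1 z.2) ->
  (forall t s, `|b t s| <= M) ->
  (\int[mu]_x \int[mu]_y `|(F x y)%:E| < +oo)%E ->
  (\int[mu]_x \int[mu]_y `|(b x y * F x y)%:E| < +oo)%E.
Proof.
move=> mb mF bM fin.
have M0 : 0 <= M by apply: le_trans (bM 0 0).
have mbF : measurable_fun setT (fun z : R * R => (fun t s => b t s * F t s) z.1 z.2).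
  exact: measurable_funM.
have mabs (E : R -> R -> R) t : measurable_fun setT (fun z : R * R => E z.1 z.2) ->
    measurable_fun setT (fun s : R => `|(E t s)%:E|%E).
  move=> mE; apply: measurableT_comp => //; apply/measurable_EFinP.
  exact: measurable_section mE.
apply: (@le_lt_trans _ _ (\int[mu]_t (M%:E * \int[mu]_s `|(F t s)%:E|))%E).
  apply: ge0_le_integral => //.
  - by move=> t _; apply: integral_ge0.
  - exact: (measurable_abs_param mbF).
  - by apply: measurable_funeM; exact: measurable_abs_param.
  - move=> t _; rewrite -ge0_integralZl//; last exact: mabs.
    apply: ge0_le_integral => //.
    + exact: (mabs (fun t s => b t s * F t s)).
    + by apply: measurable_funeM; exact: mabs.
    + by move=> s _; rewrite -EFinM lee_fin normrM ler_wpM2r.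
rewrite ge0_integralZl//; last 2 first.
- exact: measurable_abs_param.
- by move=> t _; exact: integral_ge0.
by rewrite lte_mul_pinfty.
Qed.

Lemma fubini_tensor (k f : R -> R) : intg k -> intg f ->
  (\int[mu]_x \int[mu]_y `|(k x * f y)%:E| < +oo)%E.
Proof.
move=> ik fi.
have mk : measurable_fun setT (fun x : R => `|(k x)%:E|%E).
  by apply: measurableT_comp => //; apply/measurable_EFinP; exact: intg_measurable.
have mf : measurable_fun setT (fun x : R => `|(f x)%:E|%E).
  by apply: measurableT_comp => //; apply/measurable_EFinP; exact: intg_measurable.
have e (x : R) : (\int[mu]_y `|(k x * f y)%:E| = (\int[mu]_y `|(f y)%:E|) * `|(k x)%:E|)%E.
  by under eq_integral do rewrite EFinM abseM; rewrite ge0_integralZl// muleC.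
under eq_integral do rewrite e.
rewrite ge0_integralZl//; last exact: integral_ge0.
by rewrite lte_mul_pinfty ?integral_ge0 ?ge0_fin_numE ?intg_lty ?integral_ge0.
Qed.

(** [k1] is only assumed bounded, as [qk] is not integrable. Each order of convolution is a double
    integral of a bounded factor times an integrable one; after Fubini the inner integrals agree by
    a change of variable. *)
Lemma conv_comm k1 k2 f (M x : R) : measurable_fun setT k1 -> (forall u, `|k1 u| <= M) ->
  intg k2 -> intg f -> conv k1 (conv k2 f) x = conv k2 (conv k1 f) x.
Proof.
move=> mk1 k1M ik2 fi.
have mk2 := intg_measurable ik2; have mf := intg_measurable fi.
have mk1' : measurable_fun setT (fun t : R => k1 (x - t)).
  by apply: (measurableT_comp mk1); exact: (@measurable_funB _ _ R setT (cst x) id).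
have ik2' : intg (fun t : R => k2 (x - t)) by exact: (intg_refl x).
have mk2' := intg_measurable ik2'.
pose F1 t s := k2 (t - s) * f s.
pose F2 r s := k2 (x - r) * f s.
pose G t s := k1 (x - t) * F1 t s.
pose G' r s := k1 (r - s) * F2 r s.
have mF1 : measurable_fun setT (fun z : R * R => F1 z.1 z.2) by exact: measurable_convF.
have mb1 : measurable_fun setT (fun z : R * R => k1 (x - z.1)) by exact: (measurableT_comp mk1' measurable_fst).
have mF2 : measurable_fun setT (fun z : R * R => F2 z.1 z.2).
  by apply: measurable_funM; [exact: (measurableT_comp mk2' measurable_fst)|exact: (measurableT_comp mf measurable_snd)].
have mG : measurable_fun setT (fun z : R * R => G z.1 z.2) by exact: measurable_funM.
have mG' : measurable_fun setT (fun z : R * R => G' z.1 z.2).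
  by apply: measurable_funM => //; exact: measurable_convk.
have fF1 : (\int[mu]_x \int[mu]_y `|(F1 x y)%:E| < +oo)%E by exact: conv_tonelli_lty.
have fG : (\int[mu]_t \int[mu]_s `|(G t s)%:E| < +oo)%E.
  exact: (@fubini_bounded (fun t s => k1 (x - t)) F1 M mb1 mF1).
have fG' : (\int[mu]_t \int[mu]_s `|(G' t s)%:E| < +oo)%E.
  exact: (@fubini_bounded (fun r s => k1 (r - s)) F2 M (measurable_convk mk1) mF2 _ (fubini_tensor ik2' fi)).
have [_ iG _ e1] := fubini_intg mG fG.
have [_ _ _ e2] := fubini_intg mG' fG'.
have l1 : \int[mu]_t \int[mu]_s G t s = conv k1 (conv k2 f) x.
  have mc : measurable_fun setT (fun t : R => k1 (x - t) * conv k2 f t).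
    by apply: measurable_funM; [exact: mk1'|exact: measurable_conv].
  apply: (@Rintegral_ae R _ (fun t => k1 (x - t) * conv k2 f t) iG mc _).2.
  by apply: ae_imp (fubini_ae1 mF1 fF1) _ => t it; rewrite /G Rintegral_intgZ.
have l2 : conv k2 (conv k1 f) x = \int[mu]_t \int[mu]_s G' t s.
  apply: eq_Rintegral => r _; rewrite /conv -Rintegral_intgZ; last exact: (conv_integrand_bounded r mk1 k1M fi).
  by apply: eq_Rintegral => s _; rewrite /G' /F2 mulrCA.
rewrite -l1 l2 e1 e2; apply: eq_Rintegral => s _.
have i3 : intg (G'^~ s).
  rewrite /G' /F2; under [X in intg X]eq_fun do rewrite [k2 _ * _]mulrC mulrA.
  apply: (@intg_bounded _ (fun r => k1 (r - s) * f s) (fun r => k2 (x - r)) (M * `|f s|)).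
  - apply: measurable_funM; last exact: measurable_cst.
    apply: (measurableT_comp mk1); exact: (@measurable_funB _ _ R setT id (cst s)).
  - by move=> r; rewrite normrM ler_wpM2r.
  - exact: ik2'.
(* The reflection [r = x + s - t] turns [k1 (r - s) * k2 (x - r)] into [k1 (x - t) * k2 (t - s)]. *)
rewrite -(Rintegral_refl (x + s) i3); apply: eq_Rintegral => t _.
rewrite /G /G' /F1 /F2; congr (k1 _ * (k2 _ * _)); ring.
Qed.

(** A change of height displaces the pole along the imaginary axis, so [pole_diff] applies. *)
Lemma kern_diff_y (u y1 y2 : R) : 0 < y1 -> 0 < y2 ->
  `|pk y1 u - pk y2 u| <= `|y1 - y2| / (y1 * y2) /\
  `|qk y1 u - qk y2 u| <= `|y1 - y2| / (y1 * y2).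
Proof.
move=> y10 y20.
have z0 : 0 <= complex.Im (cplx u 0) by [].
have h : normc (cplx 0 1 * (cplx u 0 - cplx 0 (- y1))^-1 - cplx 0 1 * (cplx u 0 - cplx 0 (- y2))^-1) <= `|y1 - y2| / (y1 * y2).
  rewrite -mulrBr normcM.
  have -> : normc (cplx 0 1) = 1 by rewrite /= expr0n add0r expr1n sqrtr1.
  rewrite mul1r; apply: (le_trans (pole_diff _ _ z0)); rewrite /= ?oppr_lt0//.
  by rewrite !opprK subrr expr0n add0r sqrtr_sqr -normrN opprD !opprK invfM.
rewrite -!kern_pole// /= !add0r !subr0 in h.
split; apply: le_trans h.
  exact: (normc_ge_Re (cplx (pk y1 u - pk y2 u) (qk y1 u - qk y2 u))).
exact: (normc_ge_Im (cplx (pk y1 u - pk y2 u) (qk y1 u - qk y2 u))).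
Qed.

Lemma conv_diff_y f (x y1 y2 : R) : 0 < y1 -> 0 < y2 -> intg f ->
  `|conv (pk y1) f x - conv (pk y2) f x| <= `|y1 - y2| / (y1 * y2) * \int[mu]_t `|f t| /\
  `|conv (qk y1) f x - conv (qk y2) f x| <= `|y1 - y2| / (y1 * y2) * \int[mu]_t `|f t|.
Proof.
move=> y10 y20 fi; have ni := intg_norm fi.
split; rewrite -Rintegral_intgZ// /conv -Rintegral_intgB; try (by [exact: conv_pk_intg|exact: conv_qk_intg]);
  apply: le_norm_Rint; try exact: intgZ; try (by apply: intgB; [exact: conv_pk_intg|exact: conv_pk_intg]);
  try (by apply: intgB; [exact: conv_qk_intg|exact: conv_qk_intg]).
- by move=> t; rewrite -mulrBl normrM ler_wpM2r// (kern_diff_y _ y10 y20).1.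
- by move=> t; rewrite -mulrBl normrM ler_wpM2r// (kern_diff_y _ y10 y20).2.
Qed.

(** This is the Poisson formula for the raised Cauchy integral [FCs s f]. *)
Lemma conv_pk_semigroup f (x y s : R) : 0 < y -> 0 < s -> intg f ->
  conv (pk y) (conv (pk s) f) x = pi * conv (pk (y + s)) f x /\
  conv (pk y) (conv (qk s) f) x = pi * conv (qk (y + s)) f x.
Proof.
move=> y0 s0 fi; have [] := poisson_alg x y0 (FCs_alg s0 fi).
by rewrite /FCs /FC /= add0r.
Qed.

Lemma conv_qk_pk f (x y s : R) : 0 < y -> 0 < s -> intg f ->
  conv (qk y) (conv (pk s) f) x = pi * conv (qk (s + y)) f x.
Proof.
move=> y0 s0 fi; rewrite (@conv_comm _ _ _ (y^-1))//.
- exact: (conv_pk_semigroup x s0 y0 fi).2.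
- exact: measurable_qk.
- by move=> u; exact: qk_le.
- exact: intg_pk.
Qed.

Definition psm (s : R) f x := pi^-1 * conv (pk s) f x.

Lemma psm_intg (s : R) f : 0 < s -> intg f -> intg (psm s f).
Proof. by move=> s0 fi; apply: intgZ; apply: conv_intg => //; exact: intg_pk. Qed.

Lemma psm_norm_le (s : R) f : 0 < s -> intg f ->
  \int[mu]_x `|psm s f x| <= \int[mu]_x `|f x|.
Proof.
move=> s0 fi; have p0 := @pi_gt0 R; have ip := intg_pk s0.
have -> : \int[mu]_x `|psm s f x| = pi^-1 * \int[mu]_x `|conv (pk s) f x|.
  rewrite -Rintegral_intgZ; last by apply: intg_norm; exact: conv_intg.
  by apply: eq_Rintegral => x _; rewrite /psm normrM gtr0_norm// invr_gt0.
rewrite ler_pdivrMl//; apply: (le_trans (conv_norm_le ip fi)).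
rewrite ler_wpM2r//; first exact: Rintegral_ge0.
rewrite -(Rintegral_pk s0) le_eqVlt; apply/orP; left; apply/eqP.
by apply: eq_Rintegral => t _; rewrite ger0_norm// pk_ge0.
Qed.

Lemma cvg_at_right_seq (F : R -> R) (l : R) (s : nat -> R) : F y @[y --> 0^'+] --> l ->
  (forall n, 0 < s n) -> s n @[n --> \oo] --> 0 -> F (s n) @[n --> \oo] --> l.
Proof. by move=> /cvg_at_rightP h s0 cs; exact: h. Qed.

Lemma psm_cvg_L1 (s : nat -> R) f : (forall n, 0 < s n) -> s n @[n --> \oo] --> 0 ->
  intg f -> \int[mu]_x `|psm (s n) f x - f x| @[n --> \oo] --> 0.
Proof.
move=> s0 cs fi; apply: scheffe => //.
- by move=> n; exact: psm_intg.
- apply: ae_imp (ae_lebesgue_pt fi) _ => x lx.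
  have p0 : pi != 0 :> R by rewrite gt_eqF// pi_gt0.
  rewrite -[X in _ --> X](mulKf p0); apply: cvgM; first exact: cvg_cst.
  exact: (cvg_at_right_seq (lebesgue_pt_pk_cvg fi lx)).
- by move=> n; exact: psm_norm_le.
Qed.

Lemma cauchy0r (F : R -> R) :
  (forall e, 0 < e -> exists2 d : R, 0 < d & forall y y', 0 < y -> y < d -> 0 < y' -> y' < d ->
     `|F y - F y'| <= e) -> exists l : R, F y @[y --> 0^'+] --> l.
Proof.
move=> h; apply/cvg_ex; apply: cauchy_cvg; apply/cauchyP => e e0.
have [|d d0 hd] := h (e / 2); first by rewrite divr_gt0.
have d2 : 0 < d / 2 by rewrite divr_gt0.
exists (F (d / 2)).
rewrite /nbhs /=; near=> y.
apply: (@le_lt_trans _ _ (e / 2)); last by rewrite ltr_pdivrMr// ltr_pMr// ltr1n.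
apply: hd => //; first by rewrite ltr_pdivrMr// ltr_pMr// ltr1n.
Unshelve. all: by end_near. Qed.

Lemma negligible_small (A : set R) :
  (forall e : R, 0 < e -> exists H, [/\ measurable H, (mu H <= e%:E)%E & A `<=` H]) ->
  mu.-negligible A.
Proof.
move=> h.
have {}h (n : nat) : exists H, [/\ measurable H, (mu H <= (n.+1%:R^-1)%:E)%E & A `<=` H].
  by apply: h; rewrite invr_gt0.
have [H hH] := choice h.
have mI : measurable (\bigcap_n H n) by apply: bigcapT_measurable => n; have [] := hH n.
exists (\bigcap_n H n); split => //.
- apply/eqP; rewrite eq_le measure_ge0 andbT; apply/lee_addgt0Pr => e e0; rewrite add0e.
  have /cvgr0Pnorm_le/(_ _ e0)[n _ hn] := @cvg_harmonic R.
  have [mH muH _] := hH n.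
  apply: (@le_trans _ _ (mu (H n))).
    by apply: le_measure => [||x]; [exact: (mem_set mI)|exact: (mem_set mH)|apply].
  apply: (le_trans muH); rewrite lee_fin; apply: le_trans (hn n (leqnn n)); exact: ler_norm.
- by move=> x Ax n _; have [_ _] := hH n; apply.
Qed.

Let Bad f (j : nat) : set R := [set x | forall d, 0 < d -> exists y y', [/\ 0 < y < d, 0 < y' < d &
   j.+1%:R^-1 < `|conv (qk y) f x - conv (qk y') f x|]].

(** Split [f] into its Poisson smoothing [g] at height [s] and a rest [d] of small [L^1] norm. [Q g]
    at height [y] is [Q f] at height [s + y], hence continuous down to [y = 0], and the weak type
    estimate makes [Q d] smaller than [lam] at all heights outside a set of measure at most [e]. The
    oscillation consists of four terms of size [lam], so [lam] is a quarter of [1 / (j + 1)]. *)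
Let Bad_negl f j : intg f -> mu.-negligible (Bad f j).
Proof.
move=> fi; apply: negligible_small => e e0.
pose lam : R := j.+1%:R^-1 / 4.
have l0 : 0 < lam by rewrite divr_gt0// invr_gt0.
have p0 := @pi_gt0 R.
have K0 := @wtC_gt0 R; set K := wtC in K0.
have [n hn] : exists n : nat, \int[mu]_x `|psm (n.+1%:R^-1) f x - f x| <= e * lam / K.
  have sp n : 0 < n.+1%:R^-1 :> R by rewrite invr_gt0.
  have /cvgr0Pnorm_le/(_ (e * lam / K))[|n _ hn] := psm_cvg_L1 sp (@cvg_harmonic R) fi.
    by rewrite divr_gt0// mulr_gt0.
  by exists n; apply: le_trans (hn n (leqnn n)); exact: ler_norm.
set s := n.+1%:R^-1 in hn.
have s0 : 0 < s by rewrite invr_gt0.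
pose g := psm s f; have gi : intg g by exact: psm_intg.
pose d x := f x - g x; have di : intg d by exact: intgB.
have [H [mH muH hH]] := weak_max_qk di l0.
exists H; split => //.
  apply: (le_trans muH); rewrite lee_fin -/K ler_pdivrMr// -ler_pdivlMl//.
  rewrite mulrC; apply: le_trans hn; rewrite le_eqVlt; apply/orP; left; apply/eqP.
  by apply: eq_Rintegral => x _; rewrite distrC.
move=> x Bx; apply: contrapT => nH.
have hd y : 0 < y -> `|conv (qk y) d x| < lam.
  by move=> y0; rewrite ltNge; apply/negP => /(hH x y y0).
have Qf y : 0 < y -> conv (qk y) f x = conv (qk y) d x + conv (qk (s + y)) f x.
  move=> y0; have -> : conv (qk (s + y)) f x = conv (qk y) g x.
    rewrite /g /psm convZr_qk//; last by apply: conv_intg => //; exact: intg_pk.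
    by rewrite conv_qk_pk// mulKf// gt_eqF.
  rewrite -convDr_qk//; congr (conv _ _ x); apply/funext => t.
  by rewrite /d subrK.
set N := \int[mu]_t `|f t|.
have N0 : 0 <= N by exact: Rintegral_ge0.
have Qs y : 0 < y -> `|conv (qk (s + y)) f x - conv (qk s) f x| <= y * (N / s ^+ 2).
  move=> y0; have sy : 0 < s + y by exact: addr_gt0.
  apply: (le_trans (conv_diff_y x sy s0 fi).2).
  rewrite addrC addKr gtr0_norm// mulrAC -!mulrA ler_pM2l// ler_wpM2l//.
  by rewrite expr2 lef_pV2 ?posrE ?mulr_gt0// ler_pM2r// lerDl ltW.
have [|y [y' [/andP[y0 yd] /andP[y'0 y'd]]]] := Bx (lam / (N / s ^+ 2 + 1)).
  by rewrite divr_gt0// ltr_wpDl// divr_ge0// sqr_ge0.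
have P0 : 0 < N / s ^+ 2 + 1 by rewrite ltr_wpDl// divr_ge0// sqr_ge0.
have small z : 0 < z -> z < lam / (N / s ^+ 2 + 1) -> z * (N / s ^+ 2) <= lam.
  move=> z0; rewrite ltr_pdivlMr// => /ltW; apply: le_trans.
  by rewrite ler_pM2l// lerDl.
have := Qs y y0; have := Qs y' y'0; have := small y y0 yd; have := small y' y'0 y'd.
rewrite (Qf y y0) (Qf y' y'0).
have := hd y y0; have := hd y' y'0.
have -> : j.+1%:R^-1 = 4 * lam by rewrite /lam; field; rewrite nat1r pnatr_eq0.
set a := conv (qk y) d x; set a' := conv (qk y') d x; set b := conv (qk (s + y)) f x;
  set b' := conv (qk (s + y')) f x; set c := conv (qk s) f x.
have -> : a + b - (a' + b') = (a - a') + ((b - c) - (b' - c)) by ring.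
have := ler_normD (a - a') ((b - c) - (b' - c)).
have := ler_normB a a'; have := ler_normB (b - c) (b' - c); lra.
Qed.

Lemma qk_ae_cvg f : intg f -> {ae mu, forall x, exists l : R, conv (qk y) f x @[y --> 0^'+] --> l}.
Proof.
move=> fi.
have h j : {ae mu, forall x, ~ Bad f j x}.
  by rewrite /almost_everywhere; apply: negligibleS (Bad_negl j fi) => x /contrapT.
apply: ae_imp (ae_foralln h) _ => x hx; apply: cauchy0r => e e0.
have /cvgr0Pnorm_le/(_ _ e0)[j _ hj] := @cvg_harmonic R.
have je : j.+1%:R^-1 <= e by apply: le_trans (hj j (leqnn j)); exact: ler_norm.
apply: contrapT => H; apply: (hx j) => d d0.
apply: contrapT => H'; apply: H; exists d => // y y' y0 yd y'0 y'd.
rewrite leNgt; apply/negP => lt; apply: H'; exists y, y'; split; [exact/andP|exact/andP|].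
exact: le_lt_trans lt.
Qed.

End AeConvergence.

(** * The Hilbert transform *)

Section Hilbert.
Context {R : realType}.
Local Notation mu := (@lebesgue_measure R).
Local Notation intg f := (mu.-integrable setT (EFin \o f)).
Implicit Types (f g h k : R -> R).

Lemma cvg0r_eq (F G : R -> R) (l : R) : (forall y, 0 < y -> F y = G y) ->
  F y @[y --> 0^'+] --> l -> G y @[y --> 0^'+] --> l.
Proof.
move=> FG; apply: cvg_trans; apply: near_eq_cvg; near=> y.
by apply: FG; near: y; exact: nbhs_right_gt.
Unshelve. all: by end_near. Qed.

Lemma trunc_convE f (x e : R) :
  \int[mu]_(t in [set t | e < `|x - t|]) (f t / (x - t)) = conv (tk e) f x.
Proof.
rewrite Rintegral_mkcond; apply: eq_Rintegral => t _; rewrite patchE tkE.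
case: ifPn => h.
  by move: h; rewrite inE /= => ->; rewrite mulrC.
by move: h; rewrite notin_setE /= => /negP/negbTE ->; rewrite mul0r.
Qed.

Lemma hilbertE f x : hilbert f x = pi^-1 * lim (conv (tk e) f x @[e --> (0 : R)^'+]).
Proof. by rewrite /hilbert; under eq_fun do rewrite trunc_convE. Qed.

Lemma hilbert_cvg f (x l : R) : conv (tk e) f x @[e --> 0^'+] --> l -> hilbert f x = pi^-1 * l.
Proof. by move=> h; rewrite hilbertE; congr (_ * _); exact: (cvg_lim (@Rhausdorff R) h). Qed.

Lemma hilbert_lebesgue f (x l : R) : intg f -> lebesgue_pt f x ->
  conv (qk y) f x @[y --> 0^'+] --> l -> hilbert f x = pi^-1 * l.
Proof.
move=> fi lx cl; apply: hilbert_cvg.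
have h : (conv (tk y) f x - conv (qk y) f x) + conv (qk y) f x @[y --> 0^'+] --> 0 + l.
  by apply: cvgD => //; exact: lebesgue_pt_tk_qk.
by rewrite add0r in h; apply: cvg0r_eq h => y _; rewrite subrK.
Qed.

Lemma hilbert_ae f : intg f ->
  {ae mu, forall x, conv (qk y) f x @[y --> 0^'+] --> pi * hilbert f x}.
Proof.
move=> fi; apply: ae_imp2 (ae_lebesgue_pt fi) (qk_ae_cvg fi) _ => x lx [l cl].
by rewrite (hilbert_lebesgue fi lx cl) mulrA divff ?mul1r// gt_eqF// pi_gt0.
Qed.

Lemma hilbert_ae_eq f g : intg f ->
  {ae mu, forall x, conv (qk y) f x @[y --> 0^'+] --> pi * g x} ->
  {ae mu, forall x, hilbert f x = g x}.
Proof.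
move=> fi h; apply: ae_imp2 (hilbert_ae fi) h _ => x h1 h2.
have : pi * hilbert f x = pi * g x by exact: (cvg_unique (@Rhausdorff R) h1 h2).
by move/(mulfI (lt0r_neq0 (pi_gt0 R))).
Qed.

Lemma hilbert_linear_ae (a : R) f g : intg f -> intg g ->
  {ae mu, forall x, hilbert (fun x => a * f x + g x) x = a * hilbert f x + hilbert g x}.
Proof.
move=> fi gi.
have ai : intg (fun x => a * f x) by exact: intgZ.
apply: (@hilbert_ae_eq _ (fun x => a * hilbert f x + hilbert g x)); first exact: intgD.
apply: ae_imp2 (hilbert_ae fi) (hilbert_ae gi) _ => x h1 h2.
rewrite mulrDr mulrCA.
have h : a * conv (qk y) f x + conv (qk y) g x @[y --> 0^'+] --> a * (pi * hilbert f x) + pi * hilbert g x.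
  by apply: cvgD; [apply: cvgM; [exact: cvg_cst|exact: h1]|exact: h2].
by apply: cvg0r_eq h => y y0; rewrite convDr_qk// convZr_qk.
Qed.

(** Right continuity comes from the strict inequality in [tk]: at [e = |u|] the kernel is 0, as it
    is for all larger levels. *)
Lemma tk_right_cvg (e u : R) (s : nat -> R) : (forall n, e <= s n) -> s n @[n --> \oo] --> e ->
  tk (s n) u @[n --> \oo] --> tk e u.
Proof.
move=> se cs; have [h|h] := ltP e `|u|.
  apply: cvg_near_cst.
  have d0 : 0 < `|u| - e by rewrite subr_gt0.
  move/cvgrPdist_lt : cs => /(_ _ d0); apply: filterS => n hn.
  rewrite !tkE h; case: ifPn => //; rewrite -leNgt => hs.
  by have := ler_norm (s n - e); move: hn; rewrite distrC; lra.
apply: cvg_near_cst; apply: nearW => n; rewrite !tkE !ltNge h.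
by rewrite (le_trans h (se n)).
Qed.

Lemma trunc_right_cvg f (x e : R) (s : nat -> R) : 0 < e -> intg f ->
  (forall n, e <= s n) -> s n @[n --> \oo] --> e ->
  conv (tk (s n)) f x @[n --> \oo] --> conv (tk e) f x.
Proof.
move=> e0 fi se cs.
have mk (d : R) : measurable_fun setT (fun t : R => tk d (x - t) * f t).
  apply: measurable_funM; last exact: intg_measurable.
  by apply: (measurableT_comp (measurable_tk d)); exact: (@measurable_funB _ _ R setT (cst x) id).
apply: (@dominated_cvgT _ _ _ (fun t => e^-1 * `|f t|)) => //.
- by move=> t; apply: cvgM; [exact: tk_right_cvg|exact: cvg_cst].
- by apply: intgZ; exact: intg_norm.
- move=> n t; rewrite normrM ler_wpM2r//; apply: (le_trans (tk_le _ _)).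
    exact: lt_le_trans (se n).
  by rewrite lef_pV2 ?posrE// (lt_le_trans e0).
Qed.

Let rt (i : nat * nat) : R := i.1.+1%:R / i.2.+1%:R.

Let rt_gt0 i : 0 < rt i. Proof. by rewrite divr_gt0. Qed.

Lemma frac_dense (e d : R) : 0 <= e -> e < d -> exists m n : nat, e < m.+1%:R / n.+1%:R /\ m.+1%:R / n.+1%:R < d :> R.
Proof.
move=> e0 ed; have de0 : 0 < d - e by rewrite subr_gt0.
have /cvgr0Pnorm_lt/(_ _ de0)[n _ hn] := @cvg_harmonic R.
have nd : n.+1%:R^-1 < d - e by apply: le_lt_trans (hn n (leqnn n)); exact: ler_norm.
have n0 : 0 < n.+1%:R :> R by rewrite ltr0n.
have en : 0 <= e * n.+1%:R by rewrite mulr_ge0.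
have /andP[h1 h2] := truncn_itv en.
exists (Num.truncn (e * n.+1%:R)), n; split.
  by rewrite ltr_pdivlMr.
rewrite -natr1 mulrDl mul1r; apply: (@le_lt_trans _ _ (e + n.+1%:R^-1)); last by rewrite -ltrBrDl.
by rewrite lerD2r ler_pdivrMr.
Qed.

Lemma frac_right_seq (e d : R) : 0 <= e -> e < d -> exists2 s : nat -> nat * nat,
  (forall n, e < rt (s n) < d) & rt (s n) @[n --> \oo] --> e.
Proof.
move=> e0 ed.
have h n : exists i, e < rt i /\ rt i < Num.min d (e + n.+1%:R^-1).
  have [|m [k [h1 h2]]] := @frac_dense e (Num.min d (e + n.+1%:R^-1)) e0.
    by rewrite lt_min ed /= ltrDl invr_gt0.
  by exists (m, k).
have [s hs] := choice h; exists s.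
  by move=> n; have [-> ] := hs n; rewrite lt_min => /andP[].
apply/cvgrPdist_le => a a0; have /cvgr0Pnorm_le/(_ _ a0) := @cvg_harmonic R.
apply: filterS => n; apply: le_trans.
have [h1] := hs n; rewrite lt_min => /andP[_ h2].
rewrite distrC ger0_norm; last by rewrite subr_ge0 ltW.
apply: (le_trans _ (ler_norm _)); rewrite /harmonic /=.
by rewrite lerBlDl ltW.
Qed.

(* The Cauchy criterion over rational truncation levels. These suffice because
   the truncated integral is right continuous in the level, and they make the
   set where the limit exists Borel. *)
Let Cset f : set R := \bigcap_k \bigcup_j \bigcap_m1 \bigcap_n1 \bigcap_m2 \bigcap_n2
  [set x | rt (m1, n1) < j.+1%:R^-1 -> rt (m2, n2) < j.+1%:R^-1 ->
     `|conv (tk (rt (m1, n1))) f x - conv (tk (rt (m2, n2))) f x| <= k.+1%:R^-1].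

Let measurable_Cset f : intg f -> measurable (Cset f).
Proof.
move=> fi.
apply: bigcapT_measurable => k; apply: bigcupT_measurable => j.
do 4 apply: bigcapT_measurable => ?.
set p := rt _; set q := rt _; set d := _^-1; set e := _^-1.
have [pd|pd] := boolP (p < d); last first.
  rewrite (_ : [set _ | _] = setT)//; by apply/seteqP; split => // x _ /=; rewrite (negbTE pd).
have [qd|qd] := boolP (q < d); last first.
  rewrite (_ : [set _ | _] = setT)//; by apply/seteqP; split => // x _ /= _; rewrite (negbTE qd).
have mc := measurable_conv (measurable_tk _) (intg_measurable fi).
rewrite (_ : [set _ | _] = setT `&` (fun x => `|conv (tk p) f x - conv (tk q) f x|) @^-1` [set` `]-oo, e]]).
  have mf : measurable_fun setT (fun x => `|conv (tk p) f x - conv (tk q) f x|).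
    by apply: measurableT_comp => //; apply: measurable_funB; exact: mc.
  exact: mf.
apply/seteqP; split => x /=; rewrite in_itv /=; first by move=> h; split => //; exact: h.
by move=> [_ h] _ _.
Qed.

Let CsetP f x : intg f -> Cset f x <-> exists l : R, conv (tk e) f x @[e --> 0^'+] --> l.
Proof.
move=> fi; split.
  move=> Cx; apply: cauchy0r => e e0.
  have /cvgr0Pnorm_le/(_ _ e0)[k _ hk] := @cvg_harmonic R.
  have ke : k.+1%:R^-1 <= e by apply: le_trans (hk k (leqnn k)); exact: ler_norm.
  have [//|j _ Hj] := Cx k.
  exists j.+1%:R^-1; first by rewrite invr_gt0.
  move=> y y' y0 yd y'0 y'd.
  have [s hs cs] := frac_right_seq (ltW y0) yd.
  have [s' hs' cs'] := frac_right_seq (ltW y'0) y'd.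
  have hs1 n : y <= rt (s n) by have /andP[/ltW] := hs n.
  have hs1' n : y' <= rt (s' n) by have /andP[/ltW] := hs' n.
  have c1 := @trunc_right_cvg f x _ _ y0 fi hs1 cs.
  have c2 := @trunc_right_cvg f x _ _ y'0 fi hs1' cs'.
  have c3 : `|conv (tk (rt (s n))) f x - conv (tk (rt (s' n))) f x| @[n --> \oo] --> `|conv (tk y) f x - conv (tk y') f x|.
    by apply: cvg_norm; apply: cvgB.
  rewrite -(cvg_lim (@Rhausdorff R) c3).
  apply: limr_le; first exact: cvgP c3.
  apply: nearW => n; apply: le_trans ke.
  case: (s n) (hs n) => m1 n1 /andP[_ h1]; case: (s' n) (hs' n) => m2 n2 /andP[_ h2].
  exact: (Hj m1 I n1 I m2 I n2 I).
move=> [l cl] k _.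
have [|d d0 hd] := (cvg0rP _ _).1 cl (k.+1%:R^-1 / 2); first by rewrite divr_gt0// invr_gt0.
have /cvgr0Pnorm_lt/(_ _ d0)[j _ hj] := @cvg_harmonic R.
have jd : j.+1%:R^-1 < d by apply: le_lt_trans (hj j (leqnn j)); exact: ler_norm.
exists j => // m1 _ n1 _ m2 _ n2 _ /= h1 h2.
have := hd _ (rt_gt0 (m1, n1)) (lt_trans h1 jd).
have := hd _ (rt_gt0 (m2, n2)) (lt_trans h2 jd).
set a := conv _ f x; set b := conv _ f x => hb ha.
have := ler_normB (b - l) (a - l); rewrite opprB addrA subrK.
by move: hb ha; set K := k.+1%:R^-1; lra.
Qed.

Lemma measurable_hilbert f : intg f -> measurable_fun setT (hilbert f).
Proof.
move=> fi.
pose L x : R := lim (conv (tk e) f x @[e --> (0 : R)^'+]).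
suff mL : measurable_fun setT L.
  rewrite (_ : hilbert f = fun x => pi^-1 * L x); last by apply/funext => x; rewrite hilbertE.
  exact: measurable_funM.
have mC := measurable_Cset fi.
(* Off [Cset f] the limit does not exist and [lim] returns [point], so the approximating functions
   take that value there. *)
pose phi (n : nat) x : R := \1_(Cset f) x * conv (tk n.+1%:R^-1) f x + \1_(~` (Cset f)) x * (point : R).
apply: (@measurable_fun_cvg _ _ R setT phi L).
  move=> n; apply: measurable_funD; apply: measurable_funM => //.
  - by apply: measurable_conv; [exact: measurable_tk|exact: intg_measurable].
  - by apply: measurable_indic; exact: measurableC.
move=> x _; have [Cx|nCx] := pselect (Cset f x).
  have [l cl] := (CsetP x fi).1 Cx.
  have -> : L x = l by exact: (cvg_lim (@Rhausdorff R) cl).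
  have sp n : 0 < n.+1%:R^-1 :> R by rewrite invr_gt0.
  have := cvg_at_right_seq cl sp (@cvg_harmonic R).
  apply: cvg_trans; apply: near_eq_cvg; apply: nearW => n.
  by rewrite /phi !indicE mem_set//= memNset ?mul0r ?mul1r ?addr0//; apply.
have -> : L x = point.
  rewrite /L /lim /lim_in /= getPN// => l cl.
  by apply: nCx; apply/(CsetP x fi); exists l.
apply: cvg_near_cst; apply: nearW => n.
by rewrite /phi !indicE memNset//= mem_set ?mul0r ?mul1r ?add0r.
Qed.

End Hilbert.

(** * The identity Q f = P (hilbert f) *)

Section ComplexLimits.
Context {R : realType}.
Local Notation C := (R[i]).
Implicit Types (z w : nat -> C) (a b : C) (F G : R -> C).

Definition ccvg z a :=
  complex.Re (z n) @[n --> \oo] --> complex.Re a /\ complex.Im (z n) @[n --> \oo] --> complex.Im a.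

Lemma ccvg_cst a : ccvg (fun=> a) a.
Proof. by split; exact: cvg_cst. Qed.

Lemma ccvgD z w a b : ccvg z a -> ccvg w b -> ccvg (fun n => z n + w n) (a + b).
Proof.
move=> [h1 h2] [h3 h4]; split.
  by rewrite ReD; under eq_fun do rewrite ReD; apply: cvgD; [exact: h1|exact: h3].
by rewrite ImD; under eq_fun do rewrite ImD; apply: cvgD; [exact: h2|exact: h4].
Qed.

Lemma ccvgM z w a b : ccvg z a -> ccvg w b -> ccvg (fun n => z n * w n) (a * b).
Proof.
move=> [h1 h2] [h3 h4]; split.
  by rewrite ReM; under eq_fun do rewrite ReM; apply: cvgB; apply: cvgM.
by rewrite ImM; under eq_fun do rewrite ImM; apply: cvgD; apply: cvgM.
Qed.

Lemma ccvgB z w a b : ccvg z a -> ccvg w b -> ccvg (fun n => z n - w n) (a - b).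
Proof.
move=> h1 h2; rewrite -mulN1r; under [X in ccvg X]eq_fun do rewrite -mulN1r.
by apply: ccvgD => //; apply: ccvgM => //; exact: ccvg_cst.
Qed.

Lemma ReV a : complex.Re a^-1 = complex.Re a / (complex.Re a ^+ 2 + complex.Im a ^+ 2).
Proof. by case: a. Qed.

Lemma ImV a : complex.Im a^-1 = - (complex.Im a / (complex.Re a ^+ 2 + complex.Im a ^+ 2)).
Proof. by case: a. Qed.

Lemma sqr_norm_neq0 a : a != 0 -> complex.Re a ^+ 2 + complex.Im a ^+ 2 != 0.
Proof.
case: a => x y; rewrite eq_complex negb_and /= => /orP[] h.
  by rewrite gt_eqF// ltr_pwDl// ?sqr_ge0// exprn_even_gt0.
by rewrite gt_eqF// ltr_wpDl// ?sqr_ge0// exprn_even_gt0.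
Qed.

Lemma ccvgV z a : a != 0 -> ccvg z a -> ccvg (fun n => (z n)^-1) a^-1.
Proof.
move=> /sqr_norm_neq0 a0 [h1 h2].
have h : (complex.Re (z n) ^+ 2 + complex.Im (z n) ^+ 2)^-1 @[n --> \oo] --> (complex.Re a ^+ 2 + complex.Im a ^+ 2)^-1.
  apply: cvgV => //; rewrite !expr2; under eq_fun do rewrite !expr2.
  by apply: cvgD; apply: cvgM.
split.
  by rewrite ReV; under eq_fun do rewrite ReV; apply: cvgM.
by rewrite ImV; under eq_fun do rewrite ImV; apply: cvgN; apply: cvgM.
Qed.

Lemma ccvg_norm0 z a : normc (z n - a) @[n --> \oo] --> 0 -> ccvg z a.
Proof.
move=> h; split; apply/cvgrPdist_le => e e0; move/cvgr0Pnorm_le : h => /(_ _ e0);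
  apply: filterS => n; apply: le_trans; rewrite distrC; apply: (le_trans _ (ler_norm _)).
- by rewrite -ReB normc_ge_Re.
- by rewrite -ImB normc_ge_Im.
Qed.

Definition cmeas F := measurable_fun setT (fun t : R => complex.Re (F t)) /\
  measurable_fun setT (fun t : R => complex.Im (F t)).

Lemma cmeas_cst a : cmeas (fun=> a).
Proof. by split; exact: measurable_cst. Qed.

Lemma cmeasD F G : cmeas F -> cmeas G -> cmeas (fun t => F t + G t).
Proof.
move=> [h1 h2] [h3 h4]; split.
  by under eq_fun do rewrite ReD; apply: measurable_funD.
by under eq_fun do rewrite ImD; apply: measurable_funD.
Qed.

Lemma cmeasM F G : cmeas F -> cmeas G -> cmeas (fun t => F t * G t).
Proof.
move=> [h1 h2] [h3 h4]; split.
  by under eq_fun do rewrite ReM; apply: measurable_funB; apply: measurable_funM.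
by under eq_fun do rewrite ImM; apply: measurable_funD; apply: measurable_funM.
Qed.

Lemma cmeasV F : cmeas F -> cmeas (fun t => (F t)^-1).
Proof.
move=> [h1 h2].
have h : measurable_fun setT (fun t : R => (complex.Re (F t) ^+ 2 + complex.Im (F t) ^+ 2)^-1).
  apply: (measurableT_comp measurable_inv).
  under eq_fun do rewrite !expr2.
  by apply: measurable_funD; apply: measurable_funM.
split.
  by under eq_fun do rewrite ReV; apply: measurable_funM.
by under eq_fun do rewrite ImV; apply: measurableT_comp => //; apply: measurable_funM.
Qed.

(* [damp lam a b] is bounded by [2 * lam], dominated by [a - b], and tends to
   [a - b] as [lam] tends to infinity. *)
Definition damp (lam : R) a b : C :=
  (a - b) * ((lam%:C)%C * ((lam%:C)%C + a)^-1) * ((lam%:C)%C * ((lam%:C)%C + b)^-1).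

Lemma cmeas_damp (lam : R) F G : cmeas F -> cmeas G -> cmeas (fun t => damp lam (F t) (G t)).
Proof.
move=> mF mG; apply: cmeasM; first apply: cmeasM.
- apply: cmeasD => //; under [X in cmeas X]eq_fun do rewrite -mulN1r.
  by apply: cmeasM => //; exact: cmeas_cst.
- by apply: cmeasM; [exact: cmeas_cst|apply: cmeasV; apply: cmeasD => //; exact: cmeas_cst].
- by apply: cmeasM; [exact: cmeas_cst|apply: cmeasV; apply: cmeasD => //; exact: cmeas_cst].
Qed.

Lemma ccvg_damp (lam : R) z w a b : 0 < lam -> 0 <= complex.Re a -> 0 <= complex.Re b ->
  ccvg z a -> ccvg w b -> ccvg (fun n => damp lam (z n) (w n)) (damp lam a b).
Proof.
move=> l0 a0 b0 za wb; apply: ccvgM; first apply: ccvgM.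
- exact: ccvgB.
- apply: ccvgM; first exact: ccvg_cst.
  by apply: ccvgV; [exact: normc_addr_gt0|apply: ccvgD => //; exact: ccvg_cst].
- apply: ccvgM; first exact: ccvg_cst.
  by apply: ccvgV; [exact: normc_addr_gt0|apply: ccvgD => //; exact: ccvg_cst].
Qed.

Lemma damp_factor_le (lam : R) a : 0 < lam -> 0 <= complex.Re a ->
  normc ((lam%:C)%C * ((lam%:C)%C + a)^-1) <= 1.
Proof.
move=> l0 a0; rewrite normcM normc_real gtr0_norm//.
rewrite -(@divff _ lam) ?gt_eqF// ler_wpM2l ?(ltW l0)//.
exact: normc_resolvent_le.
Qed.

Lemma damp_le (lam : R) a b : 0 < lam -> 0 <= complex.Re a -> 0 <= complex.Re b ->
  normc (damp lam a b) <= normc (a - b).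
Proof.
move=> l0 a0 b0; rewrite /damp normcM normcM -[leRHS]mulr1 ler_pM ?mulr_ge0 ?normc_ge0//.
  by rewrite -[leRHS]mulr1 ler_wpM2l ?normc_ge0// damp_factor_le.
exact: damp_factor_le.
Qed.

(** Distributing [a - b] gives [lam] times a difference of two products, each of a Cayley transform
    and a damping factor, all of norm at most 1. *)
Lemma damp_bounded (lam : R) a b : 0 < lam -> 0 <= complex.Re a -> 0 <= complex.Re b ->
  normc (damp lam a b) <= 2 * lam.
Proof.
move=> l0 a0 b0.
have -> : damp lam a b = (lam%:C)%C * (cayley lam a * ((lam%:C)%C * ((lam%:C)%C + b)^-1))
    - (lam%:C)%C * (cayley lam b * ((lam%:C)%C * ((lam%:C)%C + a)^-1)).
  by rewrite !cayleyE// /damp; ring.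
have h c d : 0 <= complex.Re c -> 0 <= complex.Re d ->
    normc ((lam%:C)%C * (cayley lam c * ((lam%:C)%C * ((lam%:C)%C + d)^-1))) <= lam.
  move=> c0 d0; rewrite normcM normc_real gtr0_norm// -[leRHS]mulr1 ler_wpM2l ?(ltW l0)//.
  rewrite normcM -[leRHS]mulr1 ler_pM ?normc_ge0 ?damp_factor_le//.
  rewrite cayleyE// normcM normcV.
  have hp := normc_addr_gt0 l0 c0.
  by rewrite ler_pdivrMr ?normc_gt0// mul1r; exact: (normc_addr_ge (ltW l0) c0).2.
apply: (le_trans (normcD _ _)); rewrite normcN mulr_natl mulr2n lerD//; exact: h.
Qed.

Lemma ccvg_damp_oo a b : 0 <= complex.Re a -> 0 <= complex.Re b ->
  ccvg (fun n => damp n.+1%:R a b) (a - b).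
Proof.
move=> a0 b0.
have h c : 0 <= complex.Re c -> ccvg (fun n => (n.+1%:R%:C)%C * ((n.+1%:R%:C)%C + c)^-1) 1.
  move=> c0; apply: ccvg_norm0.
  have n0 n : 0 < n.+1%:R :> R by rewrite ltr0n.
  apply: (@squeeze_cvgr _ _ _ _ (fun=> 0) (fun n : nat => normc c * n.+1%:R^-1)).
  - apply: nearW => n; rewrite normc_ge0/= normcB_sym.
    by have := cayley_norm_le (n0 n) c0.
  - exact: cvg_cst.
  - rewrite -[X in _ --> X](mulr0 (normc c)); apply: cvgM; first exact: cvg_cst.
    exact: cvg_harmonic.
rewrite -[X in ccvg _ X]mulr1 -[X in ccvg _ X]mulr1.
apply: ccvgM; last exact: h.
by apply: ccvgM; [exact: ccvg_cst|exact: h].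
Qed.

End ComplexLimits.

(** * The Poisson representation of the damped functions *)

Section HilbertPoisson.
Context {R : realType}.
Local Notation mu := (@lebesgue_measure R).
Local Notation intg f := (mu.-integrable setT (EFin \o f)).
Local Notation C := (R[i]).
Local Notation cplx x y := (Complex x y : R[i]).
Implicit Types (f g h k : R -> R).

Lemma FC_cvg0 f : intg f -> {ae mu, forall x,
  ccvg (fun n => FC f x n.+1%:R^-1) (cplx (pi * f x) (pi * hilbert f x))}.
Proof.
move=> fi; apply: ae_imp2 (ae_lebesgue_pt fi) (hilbert_ae fi) _ => x lx hx.
have sp n : 0 < n.+1%:R^-1 :> R by rewrite invr_gt0.
split => /=.
  exact: (cvg_at_right_seq (lebesgue_pt_pk_cvg fi lx) sp (@cvg_harmonic R)).
exact: (cvg_at_right_seq hx sp (@cvg_harmonic R)).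
Qed.

Lemma FC_cvgD f (x y : R) : 0 < y -> intg f -> ccvg (fun n => FC f x (y + n.+1%:R^-1)) (FC f x y).
Proof.
move=> y0 fi; have n0 n : 0 < y + n.+1%:R^-1 :> R by rewrite addr_gt0.
have h n := conv_diff_y x (n0 n) y0 fi.
have c : (y ^+ 2)^-1 * (\int[mu]_t `|f t|) * n.+1%:R^-1 @[n --> \oo] --> 0.
  rewrite -[X in _ --> X](mulr0 ((y ^+ 2)^-1 * (\int[mu]_t `|f t|))); apply: cvgM; first exact: cvg_cst.
  exact: cvg_harmonic.
have b n : `|y + n.+1%:R^-1 - y| / ((y + n.+1%:R^-1) * y) * \int[mu]_t `|f t| <=
    (y ^+ 2)^-1 * (\int[mu]_t `|f t|) * n.+1%:R^-1.
  rewrite addrAC subrr add0r ger0_norm ?invr_ge0// [leRHS]mulrC mulrA ler_wpM2r//.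
    by apply: Rintegral_ge0 => t _.
  rewrite ler_wpM2l ?invr_ge0// lef_pV2 ?posrE ?mulr_gt0 ?exprn_gt0// expr2 ler_wpM2r ?(ltW y0)//.
  by rewrite lerDl invr_ge0.
split; apply/cvgrPdist_le => e e0; move/cvgr0Pnorm_le : c => /(_ _ e0); apply: filterS => n hn;
  rewrite distrC /=.
  apply: (le_trans (h n).1); apply: (le_trans (b n)); exact: le_trans (ler_norm _) hn.
apply: (le_trans (h n).2); apply: (le_trans (b n)); exact: le_trans (ler_norm _) hn.
Qed.

Lemma damp_poisson_eta f g (lam x y eta : R) : 0 < lam -> 0 < y -> 0 < eta ->
  intg f -> intg g -> (forall t, 0 <= f t) -> (forall t, 0 <= g t) ->
  measurable_fun setT (fun t : R => complex.Im (damp lam (FC f t eta) (FC g t eta))) /\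
  \int[mu]_t (pk y (x - t) * complex.Im (damp lam (FC f t eta) (FC g t eta))) =
    pi * complex.Im (damp lam (FC f x (y + eta)) (FC g x (y + eta))).
Proof.
move=> l0 y0 e0 fi gi f0 g0.
pose B z := damp lam (FCs eta f z) (FCs eta g z).
have aB : alg B.
  have r k : intg k -> (forall t, 0 <= k t) -> alg (fun z => (lam%:C)%C * ((lam%:C)%C + FCs eta k z)^-1).
    by move=> ki k0; apply: alg_scale; exact: resolvent_alg.
  apply: alg_mul; last exact: r.
  apply: alg_mul; last exact: r.
  apply: (@alg_ext _ (fun z => FCs eta f z + (-1) * FCs eta g z)); last by move=> z _; rewrite mulN1r.
  by apply: alg_add; [|apply: alg_scale]; exact: FCs_alg.
have [_ h] := poisson_alg x y0 aB.
have E t : B (t%:C)%C = damp lam (FC f t eta) (FC g t eta) by rewrite /B /FCs /= add0r.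
split.
  by have [_ m _] := bmeas_alg aB; under eq_fun do rewrite -E.
by rewrite -[RHS]h; apply: eq_Rintegral => t _; rewrite E.
Qed.

Lemma cmeas_bdry f : intg f -> cmeas (fun t => cplx (pi * f t) (pi * hilbert f t)).
Proof.
move=> fi; split => /=; apply: measurable_funM => //; first exact: intg_measurable.
exact: measurable_hilbert.
Qed.

Lemma measurable_pkB (x y : R) : 0 < y -> measurable_fun setT (fun t : R => pk y (x - t)).
Proof.
move=> y0; apply: (measurableT_comp (measurable_pk y0)); exact: (@measurable_funB _ _ R setT (cst x) id).
Qed.

(** The formula at height [eta = 1 / (n + 1)] passes to the boundary: the integrands converge almost
    everywhere, and [2 * lam * pk] dominates them. *)
Lemma damp_poisson f g (lam x y : R) : 0 < lam -> 0 < y ->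
  intg f -> intg g -> (forall t, 0 <= f t) -> (forall t, 0 <= g t) ->
  \int[mu]_t (pk y (x - t) * complex.Im (damp lam (cplx (pi * f t) (pi * hilbert f t))
     (cplx (pi * g t) (pi * hilbert g t)))) =
    pi * complex.Im (damp lam (FC f x y) (FC g x y)).
Proof.
move=> l0 y0 fi gi f0 g0.
have n0 n : 0 < n.+1%:R^-1 :> R by rewrite invr_gt0.
have P n := damp_poisson_eta x l0 y0 (n0 n) fi gi f0 g0.
set L := LHS.
have c1 : pi * complex.Im (damp lam (FC f x (y + n.+1%:R^-1)) (FC g x (y + n.+1%:R^-1))) @[n --> \oo] -->
   pi * complex.Im (damp lam (FC f x y) (FC g x y)).
  apply: cvgM; first exact: cvg_cst.
  have [] // := @ccvg_damp _ lam _ _ _ _ l0 _ _ (FC_cvgD x y0 fi) (FC_cvgD x y0 gi); exact: FC_Re_ge0.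
have c2 : pi * complex.Im (damp lam (FC f x (y + n.+1%:R^-1)) (FC g x (y + n.+1%:R^-1))) @[n --> \oo] --> L.
  under eq_fun do rewrite -(P _).2.
  have [] // := @dominated_cvgR _ setT
   (fun n t => pk y (x - t) * complex.Im (damp lam (FC f t n.+1%:R^-1) (FC g t n.+1%:R^-1)))
   (fun t => pk y (x - t) * complex.Im (damp lam (cplx (pi * f t) (pi * hilbert f t))
     (cplx (pi * g t) (pi * hilbert g t)))) (fun t => 2 * lam * pk y (x - t)).
  - by move=> n; apply: measurable_funM; [exact: measurable_pkB|exact: (P n).1].
  - apply: measurable_funM; first exact: measurable_pkB.
    by have [] := cmeas_damp lam (cmeas_bdry fi) (cmeas_bdry gi).
  - apply: ae_imp2 (FC_cvg0 fi) (FC_cvg0 gi) _ => t h1 h2 _; apply: cvgM; first exact: cvg_cst.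
    have [] // := @ccvg_damp _ lam _ _ _ _ l0 _ _ h1 h2 => /=; by rewrite mulr_ge0// pi_ge0.
  - by apply: intgZ; apply: intg_refl; exact: intg_pk.
  - apply: aeW => t n _; rewrite normrM mulrC [X in _ * X]ger0_norm ?pk_ge0// ler_wpM2r ?pk_ge0//.
    apply: (le_trans (normc_ge_Im _)); apply: damp_bounded => //; exact: FC_Re_ge0.
exact: (cvg_unique (@Rhausdorff R) c2 c1).
Qed.

Lemma hilbert_fposneg f : intg f ->
  {ae mu, forall x, hilbert f x = hilbert (fpos f) x - hilbert (fneg f) x}.
Proof.
move=> fi; apply: ae_imp (hilbert_linear_ae (-1) (fneg_intg fi) (fpos_intg fi)) _ => x.
rewrite (_ : (fun _ => _) = f); last by apply/funext => t; rewrite [RHS]fpos_fneg addrC.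
by move=> ->; rewrite mulN1r addrC.
Qed.

(** The damping is removed by dominated convergence. At the boundary [|damp| <= |a - b|], which is
    at most [pi (|f| + |hilbert f|)] almost everywhere; this is where the integrability of
    [hilbert f] enters. *)
Lemma H1_poisson f (x y : R) : intg f -> intg (hilbert f) -> 0 < y ->
  conv (qk y) f x = conv (pk y) (hilbert f) x.
Proof.
move=> fi hi y0; have p0 := @pi_gt0 R.
have pi_ := fpos_intg fi; have ni := fneg_intg fi.
pose G k t := cplx (pi * k t) (pi * hilbert k t).
have n0 n : 0 < n.+1%:R :> R by rewrite ltr0n.
have P n := damp_poisson x (n0 n) y0 pi_ ni (fpos_ge0 f) (fneg_ge0 f).
have c1 : pi * complex.Im (damp n.+1%:R (FC (fpos f) x y) (FC (fneg f) x y)) @[n --> \oo] -->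
    pi * conv (qk y) f x.
  apply: cvgM; first exact: cvg_cst.
  rewrite conv_qk_fposneg//.
  have [] // := @ccvg_damp_oo _ (FC (fpos f) x y) (FC (fneg f) x y); apply: FC_Re_ge0 => // t.
  - exact: fpos_ge0.
  - exact: fneg_ge0.
have c2 : pi * complex.Im (damp n.+1%:R (FC (fpos f) x y) (FC (fneg f) x y)) @[n --> \oo] -->
    pi * conv (pk y) (hilbert f) x.
  under eq_fun do rewrite -P.
  rewrite /conv -Rintegral_intgZ; last exact: conv_pk_intg.
  have [] // := @dominated_cvgR _ setT
   (fun n t => pk y (x - t) * complex.Im (damp n.+1%:R (G (fpos f) t) (G (fneg f) t)))
   (fun t => pi * (pk y (x - t) * hilbert f t)) (fun t => y^-1 * (pi * (`|f t| + `|hilbert f t|))).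
  - move=> n; apply: measurable_funM; first exact: measurable_pkB.
    by have [] := cmeas_damp n.+1%:R (cmeas_bdry pi_) (cmeas_bdry ni).
  - by apply: measurable_funM => //; apply: measurable_funM; [exact: measurable_pkB|exact: intg_measurable].
  - apply: ae_imp (hilbert_fposneg fi) _ => t ht _.
    rewrite mulrCA; apply: cvgM; first exact: cvg_cst.
    rewrite ht mulrBr.
    have [] // := @ccvg_damp_oo _ (G (fpos f) t) (G (fneg f) t) => /=; rewrite mulr_ge0 ?pi_ge0//.
      exact: fpos_ge0.
    exact: fneg_ge0.
  - by apply: intgZ; apply: intgZ; apply: intgD; exact: intg_norm.
  - apply: ae_imp (hilbert_fposneg fi) _ => t ht n _; rewrite normrM ler_pM ?pk_norm_le//.
    apply: (le_trans (normc_ge_Im _)); apply: (le_trans (damp_le _ _ _)) => //.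
      by rewrite /= mulr_ge0 ?pi_ge0 ?fpos_ge0.
      by rewrite /= mulr_ge0 ?pi_ge0 ?fneg_ge0.
    apply: (le_trans (normc_le_ReIm _)).
    have -> : complex.Re (G (fpos f) t - G (fneg f) t) = pi * f t.
      by rewrite ReB /= [f t]fpos_fneg mulN1r mulrBr.
    have -> : complex.Im (G (fpos f) t - G (fneg f) t) = pi * hilbert f t.
      by rewrite ImB /= ht mulrBr.
    by rewrite !normrM (gtr0_norm p0) mulrDr.
by apply: (mulfI (lt0r_neq0 p0)); exact: (cvg_unique (@Rhausdorff R) c1 c2).
Qed.

(** Seen from the point [n (s + i)] for large [n], an integrable function looks like a point mass at
    0. *)
Lemma conv_scaled_cvg (k : R -> R -> R) f (s c : R) :
  (forall y, 0 < y -> measurable_fun setT (k y)) ->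
  (forall y u, 0 < y -> `|k y u| <= y^-1) ->
  (forall t, n.+1%:R * k n.+1%:R (n.+1%:R * s - t) @[n --> \oo] --> c) ->
  intg f ->
  n.+1%:R * conv (k n.+1%:R) f (n.+1%:R * s) @[n --> \oo] --> c * \int[mu]_t f t.
Proof.
move=> mk kb kc fi; have n0 n : 0 < n.+1%:R :> R by rewrite ltr0n.
have ki n := conv_integrand_bounded (n.+1%:R * s) (mk _ (n0 n)) (fun x => kb _ x (n0 n)) fi.
rewrite -Rintegral_intgZ//.
have E n : n.+1%:R * conv (k n.+1%:R) f (n.+1%:R * s) = \int[mu]_t (n.+1%:R * (k n.+1%:R (n.+1%:R * s - t) * f t)).
  by rewrite /conv Rintegral_intgZ.
under eq_fun do rewrite E.
apply: (@dominated_cvgT _ _ _ (fun t => `|f t|)).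
- by move=> n; apply: intg_measurable; exact: intgZ.
- by apply: intg_measurable; exact: intgZ.
- move=> t; under eq_fun do rewrite mulrA; apply: cvgM; [exact: kc|exact: cvg_cst].
- exact: intg_norm.
- move=> n t; rewrite mulrA normrM -[leRHS]mul1r ler_wpM2r// normrM gtr0_norm//.
  by rewrite -ler_pdivlMl// mulr1 kb.
Qed.

Lemma scaled_pk_cvg (s t : R) : n.+1%:R * pk n.+1%:R (n.+1%:R * s - t) @[n --> \oo] --> (s ^+ 2 + 1)^-1.
Proof.
have E n : n.+1%:R * pk n.+1%:R (n.+1%:R * s - t) = ((s - t * n.+1%:R^-1) ^+ 2 + 1)^-1 :> R.
  have n0 : 0 < n.+1%:R :> R by rewrite ltr0n.
  rewrite /pk.
  have -> : (n.+1%:R * s - t) ^+ 2 + n.+1%:R ^+ 2 = n.+1%:R ^+ 2 * ((s - t * n.+1%:R^-1) ^+ 2 + 1).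
    by field; rewrite gt_eqF.
  by rewrite invfM !mulrA -expr2 divff ?mul1r// gt_eqF// exprn_gt0.
under eq_fun do rewrite E.
apply: cvgV; first by rewrite gt_eqF// ltr_wpDl ?sqr_ge0.
apply: cvgD; last exact: cvg_cst.
have h : s - t * n.+1%:R^-1 @[n --> \oo] --> s.
  rewrite -[X in _ --> X]subr0 -[X in _ --> _ - X](mulr0 t); apply: cvgB; first exact: cvg_cst.
  by apply: cvgM; [exact: cvg_cst|exact: cvg_harmonic].
by rewrite expr2; under eq_fun do rewrite expr2; apply: cvgM.
Qed.

Lemma scaled_qk_cvg (s t : R) : n.+1%:R * qk n.+1%:R (n.+1%:R * s - t) @[n --> \oo] --> s / (s ^+ 2 + 1).
Proof.
have E n : n.+1%:R * qk n.+1%:R (n.+1%:R * s - t) =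
    (s - t * n.+1%:R^-1) * (n.+1%:R * pk n.+1%:R (n.+1%:R * s - t)) :> R.
  have n0 : 0 < n.+1%:R :> R by rewrite ltr0n.
  have := den_neq0 (n.+1%:R * s - t) n0; rewrite /pk /qk; move: (_ ^+ 2 + _ ^+ 2) => D D0.
  by field; rewrite D0 gt_eqF.
under eq_fun do rewrite E.
apply: cvgM; last exact: scaled_pk_cvg.
rewrite -[X in _ --> X]subr0 -[X in _ --> _ - X](mulr0 t); apply: cvgB; first exact: cvg_cst.
by apply: cvgM; [exact: cvg_cst|exact: cvg_harmonic].
Qed.

(** Comparing the leading terms of [Q f = P (hilbert f)] at the points [n (s + i)] gives
    [s * \int f = \int hilbert f] for every [s]; then take [s = 0] and [s = 1]. *)
Lemma H1_mean0 f : intg f -> intg (hilbert f) -> \int[mu]_t f t = 0.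
Proof.
move=> fi hi; have n0 n : 0 < n.+1%:R :> R by rewrite ltr0n.
have h (s : R) : s / (s ^+ 2 + 1) * \int[mu]_t f t = (s ^+ 2 + 1)^-1 * \int[mu]_t hilbert f t.
  have h1 := conv_scaled_cvg (@measurable_qk R) (@qk_le R) (@scaled_qk_cvg s) fi.
  have h2 := conv_scaled_cvg (@measurable_pk R) (@pk_norm_le R) (@scaled_pk_cvg s) hi.
  have E n : n.+1%:R * conv (qk n.+1%:R) f (n.+1%:R * s) = n.+1%:R * conv (pk n.+1%:R) (hilbert f) (n.+1%:R * s).
    by rewrite H1_poisson.
  move: h1; under eq_fun do rewrite E; move=> h1.
  exact: (cvg_unique (@Rhausdorff R) h1 h2).
have := h 0; have := h 1; rewrite !mul0r expr0n expr1n add0r invr1 !mul1r => h1 /esym h0.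
move: h1; rewrite h0 mulr0 => /eqP; rewrite mulf_eq0 => /orP[/eqP|/eqP //].
by move/eqP; rewrite invr_eq0 gt_eqF.
Qed.

End HilbertPoisson.

(** * Density of the test functions *)

Section Cutoff.
Context {R : realType}.
Local Notation mu := (@lebesgue_measure R).
Local Notation intg f := (mu.-integrable setT (EFin \o f)).
Implicit Types (f g h k : R -> R).

(** Replacing [g] by the maximum of [g] and [|f|] makes the bound valid everywhere without changing
    the integral. *)
Lemma le_intg_ae f g : measurable_fun setT f -> intg g ->
  {ae mu, forall x, `|f x| <= g x} -> intg f /\ \int[mu]_x `|f x| <= \int[mu]_x g x.
Proof.
move=> mf gi h.
have mg' : measurable_fun setT (fun x : R => Num.max (g x) `|f x|).
  by apply: measurable_maxr; [exact: intg_measurable|exact: measurableT_comp].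
have [g'i g'E] := @Rintegral_ae R g (fun x => Num.max (g x) `|f x|) gi mg'
  (ae_imp h (fun x hx => esym (max_idPl hx))).
have fi : intg f by apply: le_intg mf _ g'i => x; rewrite le_max lexx orbT.
split => //; rewrite g'E; apply: le_Rint => //; first exact: intg_norm.
by move=> x; rewrite le_max lexx orbT.
Qed.

Lemma intg_ball (x r : R) : intg (\1_(ball x r) : R -> R).
Proof.
apply/integrableP; split.
  by apply/measurable_EFinP; apply: measurable_indic; exact: measurable_ball.
under eq_integral do rewrite /= ger0_norm ?indicE//.
rewrite integral_indic//; last exact: measurable_ball.
rewrite setIT; have [r0|r0] := leP 0 r.
  by apply: (@le_lt_trans _ _ (r *+ 2)%:E); [rewrite -(measure_ball x r0)|exact: ltry].
rewrite (_ : ball x r = set0) ?measure0 ?ltry//.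
by apply/seteqP; split => // t /= xt; have := lt_trans (le_lt_trans (normr_ge0 (x - t)) xt) r0; rewrite ltxx.
Qed.

Lemma Rint_ball (x r : R) : 0 <= r -> \int[mu]_t (\1_(ball x r) t : R) = 2 * r.
Proof.
move=> r0; rewrite /Rintegral integral_indic//; last exact: measurable_ball.
rewrite setIT; transitivity (fine (r *+ 2)%:E); last by rewrite /= mulr_natl.
by congr fine; exact: measure_ball.
Qed.

Lemma indic_ball0 (r u : R) : \1_(ball (0 : R) r) u = (`|u| < r)%R%:R :> R.
Proof.
rewrite indicE; congr (_%:R); congr nat_of_bool; apply/idP/idP; rewrite inE /ball /= sub0r normrN//.
Qed.

Lemma ball_far (a b c r : R) : a < 2 * r -> 3 * r <= c -> c <= a + b -> r <= b.
Proof. lra. Qed.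

Definition tent (r t : R) : R := Num.max 0 (1 - `|t| / r).
(** A weight that is small near 0 and equal to 1 far away. The errors of the cutoff are measured by
    the integral of [trim d * |f|], which tends to 0 as [d] tends to infinity. *)
Definition trim (d t : R) : R := Num.min 1 (`|t| / d).

Lemma tent_ge0 r t : 0 <= tent r t. Proof. by rewrite le_max lexx. Qed.

Lemma tent_le1 r t : 0 < r -> tent r t <= 1.
Proof. by move=> r0; rewrite ge_max ler01 gerBl divr_ge0// ltW. Qed.

Lemma tent_eq0 r t : 0 < r -> r <= `|t| -> tent r t = 0.
Proof.
by move=> r0 rt; apply/max_idPl; rewrite subr_le0 ler_pdivlMr// mul1r.
Qed.

Lemma tent_lip r t s : 0 < r -> `|tent r t - tent r s| <= `|t - s| / r.
Proof.
move=> r0; have h : `|(`|t| / r) - (`|s| / r)| <= `|t - s| / r.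
  by rewrite -mulrBl normrM [X in _ * X]ger0_norm ?invr_ge0 ?(ltW r0)// ler_wpM2r ?invr_ge0 ?(ltW r0)// ler_dist_dist.
apply: le_trans h; rewrite /tent; move: (_ / _) (_ / _) => b a.
rewrite /Num.max; case: ifPn; case: ifPn; rewrite -?leNgt => h1 h2;
  have [h|h] := leP 0 (a - b); rewrite ?(ger0_norm h) ?(ltr0_norm h) ler_norml; apply/andP; split; lra.
Qed.

Lemma trim_ge0 d t : 0 < d -> 0 <= trim d t.
Proof. by move=> d0; rewrite le_min ler01 divr_ge0// ltW. Qed.

Lemma trim_le d r t : 0 < d -> d <= r -> trim r t <= trim d t.
Proof.
move=> d0 dr; rewrite le_min ge_min lexx /= ge_min orbC ler_wpM2l// lef_pV2 ?posrE//.
exact: lt_le_trans dr.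
Qed.

Lemma tent_trim r t : 0 < r -> `|tent r t - 1| <= trim r t.
Proof.
move=> r0; have t0 : 0 <= `|t| / r by rewrite divr_ge0// ltW.
rewrite distrC ger0_norm ?subr_ge0 ?tent_le1// /trim /tent; move: (_ / _) t0 => a a0.
rewrite /Num.max /Num.min; case: ifPn; case: ifPn; rewrite -?leNgt; lra.
Qed.

Lemma tentM_trim r t : 0 < r -> tent r t * `|t| <= r * trim r t.
Proof.
move=> r0; have t0 : 0 <= `|t| / r by rewrite divr_ge0// ltW.
have E : `|t| = `|t| / r * r by rewrite divfK ?gt_eqF.
rewrite {1}E mulrA [leRHS]mulrC ler_wpM2r ?(ltW r0)//.
rewrite le_min; apply/andP; split; last by rewrite -[leRHS]mul1r ler_wpM2r// tent_le1.
have [h|h] := leP r `|t|; first by rewrite tent_eq0// mul0r.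
by rewrite -[leRHS]mulr1 ler_pM ?tent_ge0 ?tent_le1// ler_pdivrMr// mul1r ltW.
Qed.

Lemma measurable_tent r : measurable_fun setT (tent r).
Proof.
apply: measurable_maxr; first exact: measurable_cst.
by apply: measurable_funB; [exact: measurable_cst|apply: measurable_funM => //; exact: measurableT_comp].
Qed.

Lemma measurable_trim d : measurable_fun setT (trim d).
Proof.
apply: measurable_minr; first exact: measurable_cst.
by apply: measurable_funM => //; exact: measurableT_comp.
Qed.

Lemma trim_norm_le d t : 0 < d -> `|trim d t| <= 1.
Proof. by move=> d0; rewrite ger0_norm ?trim_ge0// ge_min lexx. Qed.

Lemma trim_intg d f : 0 < d -> intg f -> intg (fun t => trim d t * `|f t|).
Proof.
move=> d0 fi; apply: (@intg_bounded _ _ _ 1).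
- exact: measurable_trim.
- by move=> t; exact: trim_norm_le.
- exact: intg_norm.
Qed.

Lemma trim_cvg0 f : intg f -> \int[mu]_t (trim n.+1%:R t * `|f t|) @[n --> \oo] --> 0.
Proof.
move=> fi; have n0 n : 0 < n.+1%:R :> R by rewrite ltr0n.
rewrite (_ : 0 = \int[mu]_t (0 : R)); last by rewrite Rintegral_cst ?mul0r.
apply: (@dominated_cvgT _ _ _ (fun t => `|f t|)) => //.
- by move=> n; apply: intg_measurable; exact: trim_intg.
- move=> t; apply: (@squeeze_cvgr _ _ _ _ (fun=> 0) (fun n : nat => `|t| * `|f t| * n.+1%:R^-1)).
  + apply: nearW => n; rewrite mulr_ge0 ?trim_ge0//= mulrAC ler_wpM2r// /trim ge_min lexx orbT//.
  + exact: cvg_cst.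
  + rewrite -[X in _ --> X](mulr0 (`|t| * `|f t|)); apply: cvgM; first exact: cvg_cst.
    exact: cvg_harmonic.
- exact: intg_norm.
- by move=> n t; rewrite normrM normr_id -[leRHS]mul1r ler_wpM2r// trim_norm_le.
Qed.

Lemma tk_cvg0 (u : R) : tk n.+1%:R^-1 u @[n --> \oo] --> u^-1.
Proof.
have [->|u0] := eqVneq u 0.
  apply: cvg_near_cst; apply: nearW => n; rewrite tkE normr0 ltNge invr_ge0 ler0n /=; by rewrite invr0.
have u0' : 0 < `|u| by rewrite normr_gt0.
apply: cvg_near_cst; have /cvgr0Pnorm_lt/(_ _ u0') := @cvg_harmonic R.
by apply: filterS => n hn; rewrite tkE (le_lt_trans _ hn)// ler_norm.
Qed.

(** Up to a factor, the kernel of the commutator of the Hilbert transform with multiplication by the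
    tent. It is bounded because the tent is Lipschitz. *)
Definition tent_quot (r x t : R) : R := (x - t)^-1 * (tent r t - tent r x).

Lemma tent_quot_le r x t : 0 < r -> `|tent_quot r x t| <= r^-1.
Proof.
move=> r0; have [->|xt] := eqVneq x t; first by rewrite /tent_quot !subrr mulr0 normr0 invr_ge0 ltW.
have h : 0 < `|x - t| by rewrite normr_gt0 subr_eq0.
by rewrite /tent_quot normrM normfV mulrC ler_pdivrMr// mulrC distrC tent_lip.
Qed.

(* The difference is at most [2 / r] everywhere and at most
   [2 * `|t| / (r * `|x - t|)]; the latter is used where [d <= `|x - t|]. *)
Lemma tent_quotB_le r d x t : 0 < d -> 0 < r ->
  `|tent_quot r x t - tent_quot r x 0| <= 2 / r * (trim d t + \1_(ball (0 : R) d) (x - t)).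
Proof.
move=> d0 r0; have ri : 0 <= r^-1 by rewrite invr_ge0 ltW.
have h1 : `|tent_quot r x t - tent_quot r x 0| <= 2 / r.
  apply: (le_trans (ler_normB _ _)); rewrite mulr_natl mulr2n lerD// tent_quot_le//.
rewrite indic_ball0; have [xd|xd] := ltP `|x - t| d.
  by apply: (le_trans h1); rewrite ler_peMr ?divr_ge0// ?(ltW r0)// lerDr trim_ge0.
rewrite addr0 /trim minr_pMr ?divr_ge0// ?(ltW r0)// le_min mulr1 h1 /=.
have xt : x != t by rewrite -subr_eq0 -normr_gt0 (lt_le_trans d0).
have dx : 0 < `|x - t| by exact: lt_le_trans xd.
have t00 : tent r 0 = 1 by rewrite /tent normr0 mul0r subr0; apply/max_idPr.
apply: (@le_trans _ _ (2 / r * (`|t| / `|x - t|))); last first.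
  by rewrite ler_wpM2l ?divr_ge0 ?(ltW r0)// ler_wpM2l// lef_pV2.
have l1 := tent_lip t 0 r0; have l2 := tent_lip 0 x r0; rewrite subr0 in l1; rewrite sub0r normrN in l2.
have [x0|x0] := eqVneq x 0.
  rewrite x0 sub0r normrN divff ?mulr1; last by move: xt; rewrite x0 eq_sym -normr_eq0.
  by move: h1; rewrite x0.
(* Between [t] and 0 the tent varies by at most [|t| / r], between 0 and [x] by at most [|x| / r];
   the factor [t / x] in [1 / (x - t) - 1 / x = (t / x) / (x - t)] compensates the latter. *)
have -> : tent_quot r x t - tent_quot r x 0 =
   ((tent r t - tent r 0) / (x - t) + (tent r 0 - tent r x) * (t / x / (x - t))).
  by rewrite /tent_quot subr0; field; rewrite x0 subr_eq0 xt.
apply: (le_trans (ler_normD _ _)).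
have -> : 2 / r * (`|t| / `|x - t|) = `|t| / r / `|x - t| + `|x| / r * (`|t| / `|x| / `|x - t|).
  by field; rewrite !normr_eq0 subr_eq0 x0 xt gt_eqF.
rewrite lerD// !normrM !normfV ?ler_wpM2r// ?invr_ge0//.
Qed.

End Cutoff.

(** * The error of the tent cutoff *)

Section CutoffError.
Context {R : realType}.
Local Notation mu := (@lebesgue_measure R).
Local Notation intg f := (mu.-integrable setT (EFin \o f)).
Variables (f : R -> R) (r d : R).
Hypotheses (fi : intg f) (hi : intg (hilbert f)) (d0 : 0 < d) (dr : d <= r).

Let r0 : 0 < r. Proof. exact: lt_le_trans dr. Qed.
Let chi := tent r.
Let v := \int[mu]_t (trim d t * `|f t|).
Let c := \int[mu]_t (chi t * f t).
Let I := \int[mu]_t chi t.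
Let m := c / I.

(** Multiplication by the tent spoils the zero mean; subtracting [m] beforehand restores it. *)
Definition cutoff t := chi t * (f t - m).

Let chi_norm t : `|chi t| <= 1. Proof. by rewrite ger0_norm ?tent_ge0 ?tent_le1. Qed.

Let chi_intg : intg chi.
Proof.
apply: le_intg (intg_ball 0 r); first exact: measurable_tent.
move=> t; rewrite indic_ball0; case: ltP => h //.
by rewrite /chi tent_eq0// normr0.
Qed.

Let chif_intg : intg (fun t => chi t * f t).
Proof. by apply: (@intg_bounded _ _ _ 1) => //; exact: measurable_tent. Qed.

Let I_ge : r / 2 <= I.
Proof.
have -> : r / 2 = \int[mu]_t (2^-1 * \1_(ball (0 : R) (r / 2)) t).
  rewrite Rintegral_intgZ; last exact: intg_ball.
  by rewrite Rint_ball ?divr_ge0 ?(ltW r0)//; field.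
apply: le_Rint => //; first by apply: intgZ; exact: intg_ball.
move=> t; rewrite indic_ball0; case: ltP => h; last by rewrite mulr0 tent_ge0.
rewrite mulr1 /chi /tent le_max; apply/orP; right.
have : `|t| / r <= 2^-1 by rewrite ler_pdivrMr// mulrC ltW.
lra.
Qed.

Let I_gt0 : 0 < I. Proof. by apply: lt_le_trans I_ge; rewrite divr_gt0. Qed.

Let vi : intg (fun t => trim d t * `|f t|). Proof. exact: trim_intg. Qed.

Let v_ge0 : 0 <= v.
Proof. by apply: Rintegral_ge0 => t _; rewrite mulr_ge0 ?trim_ge0. Qed.

(** As [f] has mean zero, [c] is the integral of [(chi - 1) f], and [1 - chi] is at most
    [trim d]. *)
Let c_le : `|c| <= v.
Proof.
have -> : c = \int[mu]_t ((chi t - 1) * f t).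
  rewrite /c -[LHS]subr0 -[X in _ - X](H1_mean0 fi hi) -Rintegral_intgB//.
  by apply: eq_Rintegral => t _; rewrite mulrBl mul1r.
apply: le_norm_Rint => //.
  by under [X in intg X]eq_fun do rewrite mulrBl mul1r; exact: intgB.
move=> t; rewrite normrM ler_wpM2r//; apply: (le_trans (tent_trim _ r0)); exact: trim_le.
Qed.

Let mI : `|m| * I = `|c|.
Proof. by rewrite /m normrM [X in _ * X * _]ger0_norm ?invr_ge0 ?(ltW I_gt0)// divfK ?gt_eqF. Qed.

Let m_le : `|m| <= 2 * v / r.
Proof.
have h : `|m| * (r / 2) <= v by apply: le_trans c_le; rewrite -mI ler_wpM2l.
by rewrite ler_pdivlMr//; move: h; lra.
Qed.

Lemma cutoff_intg : intg cutoff.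
Proof.
rewrite /cutoff; under [X in intg X]eq_fun do rewrite mulrBr [_ * m]mulrC.
by apply: intgB => //; exact: intgZ.
Qed.

Lemma cutoff_mean0 : \int[mu]_t cutoff t = 0.
Proof.
rewrite /cutoff; under eq_Rintegral do rewrite mulrBr [_ * m]mulrC.
rewrite Rintegral_intgB//; last exact: intgZ.
by rewrite Rintegral_intgZ// /m divfK ?gt_eqF// subrr.
Qed.

Lemma cutoff_supp t : r <= `|t| -> cutoff t = 0.
Proof. by move=> h; rewrite /cutoff /chi tent_eq0// mul0r. Qed.

Lemma cutoff_L1 : \int[mu]_t `|cutoff t - f t| <= 2 * v.
Proof.
apply: (@le_trans _ _ (\int[mu]_t (trim d t * `|f t| + `|m| * chi t))).
  apply: le_Rint.
  - by apply: intg_norm; apply: intgB => //; exact: cutoff_intg.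
  - by apply: intgD => //; exact: intgZ.
  move=> t; have -> : cutoff t - f t = (chi t - 1) * f t - m * chi t by rewrite /cutoff; ring.
  apply: (le_trans (ler_normB _ _)); rewrite !normrM; apply: lerD.
    by rewrite ler_wpM2r//; apply: (le_trans (tent_trim _ r0)); exact: trim_le.
  by rewrite [`|chi t|]ger0_norm ?tent_ge0.
rewrite Rintegral_intgD//; last exact: intgZ.
by rewrite Rintegral_intgZ// mI; move: c_le; rewrite /v; lra.
Qed.

Let far_intg : intg (fun t => `|cutoff t| * `|t|).
Proof.
apply: le_intg (intgZ r (intg_norm cutoff_intg)).
  apply: measurable_funM; last exact: (@normr_measurable R setT).
  exact: (intg_measurable (intg_norm cutoff_intg)).
move=> t; rewrite normrM !normr_id [leRHS]mulrC.
have [h|h] := leP r `|t|; first by rewrite cutoff_supp// normr0 !mul0r.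
by rewrite ler_wpM2l// ltW.
Qed.

Let far_moment : \int[mu]_t (`|cutoff t| * `|t|) <= 2 * r * v.
Proof.
apply: (@le_trans _ _ (\int[mu]_t (r * (trim d t * `|f t|) + r * (`|m| * chi t)))).
  apply: le_Rint.
  - exact: far_intg.
  - by apply: intgD; apply: intgZ; [exact: vi|exact: intgZ].
  move=> t; rewrite /cutoff normrM [`|chi t|]ger0_norm ?tent_ge0// mulrAC.
  have h1 := tentM_trim t r0.
  have h2 : chi t * `|t| <= r * chi t.
    have [h|h] := leP r `|t|; first by rewrite /chi tent_eq0// mul0r mulr0.
    by rewrite mulrC ler_wpM2r ?tent_ge0// ltW.
  apply: (@le_trans _ _ (chi t * `|t| * (`|f t| + `|m|))).
    by rewrite ler_wpM2l ?mulr_ge0 ?tent_ge0// ler_normB.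
  rewrite mulrDr; apply: lerD.
    rewrite mulrA ler_wpM2r//; apply: (le_trans h1); rewrite ler_wpM2l ?(ltW r0)//; exact: trim_le.
  by rewrite mulrCA [_ * `|m|]mulrC ler_wpM2l.
rewrite Rintegral_intgD; [|exact: intgZ|by apply: intgZ; exact: intgZ].
rewrite !Rintegral_intgZ//; last exact: intgZ.
have h : r * `|c| <= r * v by rewrite ler_wpM2l ?(ltW r0).
by rewrite mI; move: h; rewrite -/v; lra.
Qed.

(** Since [cutoff] has mean zero, [1 / (x - t)] may be replaced by
    [1 / (x - t) - 1 / x = t / (x (x - t))]. On the support [|x - t| >= |x| / 2 >= r > e], so the
    truncation is inactive, and [2 / x^2] times the first moment remains, at most [4 r v / x^2].
    Finally [4 / x^2 <= 5 / (x^2 + r^2)] because [|x| >= 2 r]. *)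
Let far (x e : R) : 2 * r <= `|x| -> 0 < e -> e < r -> `|conv (tk e) cutoff x| <= 5 * v * pk r x.
Proof.
move=> rx e0 er.
have x0 : x != 0 by rewrite -normr_gt0 (lt_le_trans _ rx)// mulr_gt0.
have ti := conv_integrand_bounded x (measurable_tk e) (fun u => tk_le u e0) cutoff_intg.
have -> : conv (tk e) cutoff x = \int[mu]_t (tk e (x - t) * cutoff t - x^-1 * cutoff t).
  rewrite Rintegral_intgB//; last by apply: intgZ; exact: cutoff_intg.
  by rewrite Rintegral_intgZ ?cutoff_mean0 ?mulr0 ?subr0//; exact: cutoff_intg.
apply: (@le_trans _ _ (\int[mu]_t (2 / x ^+ 2 * (`|cutoff t| * `|t|)))).
  apply: le_norm_Rint.
  - by apply: intgB => //; apply: intgZ; exact: cutoff_intg.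
  - by apply: intgZ; exact: far_intg.
  move=> t; have [h|h] := leP r `|t|; first by rewrite cutoff_supp// !mulr0 normr0 subrr normr0 mul0r mulr0.
  have xt : `|x| / 2 <= `|x - t| by have := ler_normD (x - t) t; rewrite subrK; move: rx h; lra.
  have xt0 : 0 < `|x - t| by apply: lt_le_trans xt; rewrite divr_gt0// normr_gt0.
  rewrite tkE ifT; last by move: rx xt er; lra.
  rewrite -mulrBl normrM [leRHS]mulrCA [leRHS]mulrC ler_wpM2r//.
  have -> : (x - t)^-1 - x^-1 = t / (x * (x - t)).
    by field; rewrite x0 -normr_eq0 gt_eqF.
  rewrite normrM mulrC ler_wpM2r// normfV normrM -(real_normK (num_real x)).
  rewrite -[2]invrK -invfM lef_pV2 ?posrE ?mulr_gt0 ?exprn_gt0 ?invr_gt0 ?(normr_gt0 x)//.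
  by rewrite mulrC expr2 -mulrA ler_wpM2l.
rewrite Rintegral_intgZ; last exact: far_intg.
apply: (@le_trans _ _ (2 / x ^+ 2 * (2 * r * v))).
  by rewrite ler_wpM2l ?divr_ge0// sqr_ge0.
have -> : 2 / x ^+ 2 * (2 * r * v) = v * (4 * r / x ^+ 2) by field.
have -> : 5 * v * pk r x = v * (5 * r / (x ^+ 2 + r ^+ 2)) by rewrite /pk; ring.
rewrite ler_wpM2l// -!mulrA -[4 * _]mulrC -[5 * _]mulrC -!mulrA ler_wpM2l ?(ltW r0)//.
have x20 : 0 < x ^+ 2 by rewrite exprn_even_gt0.
rewrite [_ * 4]mulrC [_ * 5]mulrC ler_pdivrMr// mulrAC ler_pdivlMr ?den_gt0//.
have : (2 * r) ^+ 2 <= `|x| ^+ 2 by rewrite ler_sqr ?nnegrE ?mulr_ge0// ltW.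
by rewrite real_normK ?num_real// exprMn; lra.
Qed.

(** The odd truncated kernel on the ball of radius [3 r] integrates to 0, so [chi x] times it may be
    subtracted. The integrand is then bounded by the Lipschitz constant [1 / r] on an interval of
    length [6 r], and vanishes outside: [|x| < 2 r] and [|x - t| >= 3 r] force [|t| >= r]. *)
Let tentconv (x e : R) : 0 < e -> `|x| < 2 * r -> `|conv (tk e) chi x| <= 6.
Proof.
move=> e0 xr.
pose b := \1_(ball (0 : R) (3 * r)) : R -> R.
have bi : intg b by exact: intg_ball.
have k1 : intg (fun u => tk e u * b u).
  apply: (@intg_bounded _ _ _ e^-1) => //; first exact: measurable_tk.
  by move=> u; exact: tk_le.
have ko : \int[mu]_u (tk e u * b u) = 0.
  by apply: odd_Rint0 => // u; rewrite tkN /b !indic_ball0 normrN mulNr.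
have k2 := intg_refl x k1.
have k3 : \int[mu]_t (tk e (x - t) * b (x - t)) = 0 by rewrite (Rintegral_refl x k1).
have ci := conv_integrand_bounded x (measurable_tk e) (fun u => tk_le u e0) chi_intg.
have -> : conv (tk e) chi x = \int[mu]_t (tk e (x - t) * chi t - chi x * (tk e (x - t) * b (x - t))).
  rewrite Rintegral_intgB//; last exact: intgZ.
  by rewrite Rintegral_intgZ// k3 mulr0 subr0.
have -> : 6 = \int[mu]_t (r^-1 * b (x - t)).
  rewrite Rintegral_intgZ; last exact: intg_refl.
  by rewrite (Rintegral_refl x bi) Rint_ball ?mulr_ge0 ?(ltW r0)//; field; rewrite gt_eqF.
apply: le_norm_Rint.
- by apply: intgB => //; exact: intgZ.
- by apply: intgZ; exact: intg_refl.
move=> t; rewrite /b indic_ball0; case: ltP => h; last first.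
  rewrite /chi (@tent_eq0 _ r t)//; first by rewrite !mulr0 subrr normr0.
  exact: ball_far xr h (ler_normB x t).
rewrite !mulr1 [chi x * _]mulrC -mulrBr.
rewrite tkE; case: ifPn => _; last by rewrite mul0r normr0 invr_ge0 ltW.
exact: tent_quot_le.
Qed.

Let near_quot (x : R) : `|\int[mu]_t (tent_quot r x t * f t)| <=
  2 / r * v + 2 / r * conv (\1_(ball (0 : R) d)) (fun t => `|f t|) x.
Proof.
have mq : measurable_fun setT (tent_quot r x).
  apply: measurable_funM; last by apply: measurable_funB => //; exact: measurable_tent.
  apply: (measurableT_comp measurable_inv); exact: (@measurable_funB _ _ R setT (cst x) id).
have qi : intg (fun t => tent_quot r x t * f t).
  by apply: (@intg_bounded _ _ _ r^-1) => // t; exact: tent_quot_le.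
have bi : intg (fun t => \1_(ball (0 : R) d) (x - t) * `|f t|).
  apply: (@conv_integrand_bounded _ _ _ 1).
  - by apply: measurable_indic; exact: measurable_ball.
  - by move=> u; rewrite indic_ball0; case: ltP => _; rewrite ?normr0 ?normr1.
  - exact: intg_norm.
have -> : \int[mu]_t (tent_quot r x t * f t) = \int[mu]_t ((tent_quot r x t - tent_quot r x 0) * f t).
  under [RHS]eq_Rintegral do rewrite mulrBl.
  rewrite Rintegral_intgB//; last exact: intgZ.
  by rewrite Rintegral_intgZ// (H1_mean0 fi hi) mulr0 subr0.
rewrite /conv /v -!Rintegral_intgZ// -Rintegral_intgD; try exact: intgZ.
apply: le_norm_Rint.
- by under [X in intg X]eq_fun do rewrite mulrBl; apply: intgB => //; exact: intgZ.
- by apply: intgD; exact: intgZ.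
move=> t; rewrite -mulrDr -mulrDl normrM mulrA ler_wpM2r//.
exact: tent_quotB_le.
Qed.

Let near_cvg (x : R) : \int[mu]_t (tk n.+1%:R^-1 (x - t) * (chi t - chi x) * f t) @[n --> \oo] -->
  \int[mu]_t (tent_quot r x t * f t).
Proof.
have mb e : measurable_fun setT (fun t : R => tk e (x - t) * (chi t - chi x) * f t).
  apply: measurable_funM; last exact: intg_measurable.
  apply: measurable_funM; last by apply: measurable_funB => //; exact: measurable_tent.
  by apply: (measurableT_comp (measurable_tk e)); exact: (@measurable_funB _ _ R setT (cst x) id).
apply: (@dominated_cvgT _ _ _ (fun t => r^-1 * `|f t|)) => //.
- apply: measurable_funM; last exact: intg_measurable.
  apply: measurable_funM; last by apply: measurable_funB => //; exact: measurable_tent.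
  apply: (measurableT_comp measurable_inv); exact: (@measurable_funB _ _ R setT (cst x) id).
- move=> t; apply: cvgM; last exact: cvg_cst.
  by apply: cvgM; [exact: tk_cvg0|exact: cvg_cst].
- by apply: intgZ; exact: intg_norm.
- move=> n t; rewrite normrM ler_wpM2r// tkE; case: ifPn => _; last by rewrite mul0r normr0 invr_ge0 ltW.
  exact: tent_quot_le.
Qed.

(** The first two terms bound the commutator and the correction [m * chi] on the ball of radius
    [2 r]; the last one covers the rest of the line. *)
Let D (x : R) := (2 / r * v + 6 * `|m|) * \1_(ball (0 : R) (2 * r)) x
   + 2 / r * conv (\1_(ball (0 : R) d)) (fun t => `|f t|) x + 5 * v * pk r x.

Let hilbert_tk g : intg g -> {ae mu, forall x, conv (tk n.+1%:R^-1) g x @[n --> \oo] --> pi * hilbert g x}.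
Proof.
move=> gi; apply: ae_imp2 (hilbert_ae gi) (ae_lebesgue_pt gi) _ => x h1 h2.
have h : (conv (tk y) g x - conv (qk y) g x) + conv (qk y) g x @[y --> 0^'+] --> 0 + pi * hilbert g x.
  by apply: cvgD; [exact: lebesgue_pt_tk_qk|exact: h1].
rewrite add0r in h.
have {}h : conv (tk y) g x @[y --> 0^'+] --> pi * hilbert g x by apply: cvg0r_eq h => y _; rewrite subrK.
by apply: (cvg_at_right_seq h); [move=> n; rewrite invr_gt0|exact: cvg_harmonic].
Qed.

(* For [`|x| < 2 * r] the error is the commutator of [hilbert] with the tent,
   taken relative to its value for [t = 0] since [f] has mean zero. For larger
   [x] it is the Hilbert transform of a mean zero function supported away from
   [x]. *)
Let cutoff_err : {ae mu, forall x, `|pi * hilbert cutoff x - chi x * (pi * hilbert f x)| <= D x}.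
Proof.
apply: ae_imp2 (hilbert_tk cutoff_intg) (hilbert_tk fi) _ => x h1 h2.
have n0 n : 0 < n.+1%:R^-1 :> R by rewrite invr_gt0.
have p0 : 0 <= 5 * v * pk r x by rewrite mulr_ge0 ?pk_ge0// mulr_ge0.
have b0 : 0 <= 2 / r * conv (\1_(ball (0 : R) d)) (fun t => `|f t|) x.
  rewrite mulr_ge0 ?divr_ge0// ?(ltW r0)//; apply: Rintegral_ge0 => t _.
  by rewrite mulr_ge0// indic_ball0.
rewrite /D indic_ball0; case: ltP => xr.
  rewrite mulr1.
  pose K := \int[mu]_t (tent_quot r x t * f t).
  have cK : (conv (tk n.+1%:R^-1) cutoff x - chi x * conv (tk n.+1%:R^-1) f x
     - \int[mu]_t (tk n.+1%:R^-1 (x - t) * (chi t - chi x) * f t)) @[n --> \oo] -->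
     pi * hilbert cutoff x - chi x * (pi * hilbert f x) - K.
    apply: cvgB; last exact: near_cvg.
    by apply: cvgB; [exact: h1|apply: cvgM; [exact: cvg_cst|exact: h2]].
  have hK : `|pi * hilbert cutoff x - chi x * (pi * hilbert f x) - K| <= 6 * `|m|.
    rewrite -(cvg_lim (@Rhausdorff R) (cvg_norm cK)); apply: limr_le; first exact: cvgP (cvg_norm cK).
    apply: nearW => n.
    have mt := measurable_tk (n.+1%:R^-1 : R).
    have bt u := tk_le u (n0 n).
    have i1 := conv_integrand_bounded x mt bt cutoff_intg.
    have i2 := conv_integrand_bounded x mt bt fi.
    have i3 := conv_integrand_bounded x mt bt chi_intg.
    have i4 := conv_integrand_bounded x mt bt chif_intg.
    have -> : \int[mu]_t (tk n.+1%:R^-1 (x - t) * (chi t - chi x) * f t) =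
       conv (tk n.+1%:R^-1) (fun t => chi t * f t) x - chi x * conv (tk n.+1%:R^-1) f x.
      rewrite /conv -Rintegral_intgZ// -Rintegral_intgB//; last exact: intgZ.
      by apply: eq_Rintegral => t _; ring.
    have -> : conv (tk n.+1%:R^-1) cutoff x =
       conv (tk n.+1%:R^-1) (fun t => chi t * f t) x - m * conv (tk n.+1%:R^-1) chi x.
      rewrite /conv -Rintegral_intgZ// -Rintegral_intgB//; last exact: intgZ.
      by apply: eq_Rintegral => t _; rewrite /cutoff; ring.
    set A := conv _ (fun t => _) x; set B := conv _ f x; set E := conv _ chi x.
    have -> : A - m * E - chi x * B - (A - chi x * B) = - (m * E) by ring.
    by rewrite normrN normrM mulrC ler_wpM2r// tentconv.
  have := near_quot x; rewrite -/K => hq.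
  have := ler_normD (pi * hilbert cutoff x - chi x * (pi * hilbert f x) - K) K; rewrite subrK.
  by move: hK hq p0; lra.
rewrite mulr0 add0r.
have -> : chi x = 0 by rewrite /chi tent_eq0//; move: xr r0; lra.
rewrite mul0r subr0.
suff h : `|pi * hilbert cutoff x| <= 5 * v * pk r x by move: h b0; lra.
rewrite -(cvg_lim (@Rhausdorff R) (cvg_norm h1)); apply: limr_le; first exact: cvgP (cvg_norm h1).
have /cvgr0Pnorm_lt/(_ _ r0) := @cvg_harmonic R.
apply: filterS => n hn; apply: far => //; exact: le_lt_trans (ler_norm _) hn.
Qed.

Let bconv_intg : intg (conv (\1_(ball (0 : R) d)) (fun t => `|f t|)).
Proof. by apply: conv_intg; [exact: intg_ball|exact: intg_norm]. Qed.

Let D_intg : intg D.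
Proof.
apply: intgD; first apply: intgD.
- by apply: intgZ; exact: intg_ball.
- exact: intgZ.
- by apply: intgZ; exact: intg_pk.
Qed.

Let N := \int[mu]_t `|f t|.

Let D_int : \int[mu]_x D x <= 56 * v + 4 * d / r * N + 5 * pi * v.
Proof.
rewrite Rintegral_intgD; [|apply: intgD; apply: intgZ => //; exact: intg_ball|by apply: intgZ; exact: intg_pk].
rewrite Rintegral_intgD; [|by apply: intgZ; exact: intg_ball|exact: intgZ].
rewrite (Rintegral_intgZ _ (intg_ball 0 (2 * r))) (Rintegral_intgZ _ bconv_intg) (Rintegral_intgZ _ (intg_pk r0)).
rewrite Rint_ball ?mulr_ge0 ?(ltW r0)// Rintegral_pk// Rintegral_conv; [|exact: intg_ball|exact: intg_norm].
rewrite Rint_ball ?(ltW d0)// -/N.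
have -> : 5 * v * pi = 5 * pi * v by ring.
have -> : 2 / r * (2 * d * N) = 4 * d / r * N by ring.
rewrite lerD2r lerD2r.
(* The constant 56 is [8 + 24 * 2], as [|m| * r <= 2 * v]. *)
have -> : (2 / r * v + 6 * `|m|) * (2 * (2 * r)) = 8 * v + 24 * (`|m| * r).
  by field; rewrite gt_eqF.
have : `|m| * r <= 2 * v by rewrite -ler_pdivlMr.
lra.
Qed.

Let w := \int[mu]_t (trim d t * `|hilbert f t|).

Lemma cutoff_hilbert : intg (hilbert cutoff) /\
  \int[mu]_x `|hilbert cutoff x - hilbert f x| <=
    pi^-1 * (56 * v + 4 * d / r * N + 5 * pi * v) + w.
Proof.
have p0 := pi_gt0 R.
have mc := measurable_hilbert cutoff_intg.
pose G x := pi^-1 * D x + trim d x * `|hilbert f x|.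
have Gi : intg G by apply: intgD; [exact: intgZ|exact: trim_intg].
have [||ei eb] := @le_intg_ae R (fun x => hilbert cutoff x - hilbert f x) G _ Gi.
- by apply: measurable_funB; [exact: mc|exact: intg_measurable].
- apply: ae_imp cutoff_err _ => x hx.
  have -> : hilbert cutoff x - hilbert f x =
     pi^-1 * (pi * hilbert cutoff x - chi x * (pi * hilbert f x)) + (chi x - 1) * hilbert f x.
    rewrite mulrBr mulKf ?gt_eqF// [chi x * _]mulrCA mulKf ?gt_eqF//; ring.
  apply: (le_trans (ler_normD _ _)); apply: lerD.
    by rewrite normrM gtr0_norm ?invr_gt0// ler_wpM2l ?invr_ge0 ?(ltW p0).
  rewrite normrM ler_wpM2r//; apply: (le_trans (tent_trim _ r0)); exact: trim_le.
split.
  have -> : hilbert cutoff = fun x => (hilbert cutoff x - hilbert f x) + hilbert f x.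
    by apply/funext => x; rewrite subrK.
  exact: intgD.
apply: (le_trans eb); rewrite Rintegral_intgD; [|exact: intgZ|exact: trim_intg].
by rewrite Rintegral_intgZ// lerD2r ler_wpM2l ?invr_ge0 ?(ltW p0).
Qed.

End CutoffError.

(** * Box averages and density in [H1] *)

Section Density.
Context {R : realType}.
Local Notation mu := (@lebesgue_measure R).
Local Notation intg f := (mu.-integrable setT (EFin \o f)).
Implicit Types (f g h k : R -> R).

(** A cutoff may be unbounded. Averaging over intervals makes it bounded and, unlike Poisson
    smoothing, preserves compact support. *)
Definition box (s : R) f x := (2 * s)^-1 * conv (\1_(ball (0 : R) s)) f x.

Lemma box_intg s f : intg f -> intg (box s f).
Proof. by move=> fi; apply: intgZ; apply: conv_intg => //; exact: intg_ball. Qed.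

Lemma measurable_box_kernel (s : R) : measurable_fun setT (\1_(ball (0 : R) s) : R -> R).
Proof. by apply: measurable_indic; exact: measurable_ball. Qed.

Lemma box_kernel_le (s u : R) : `|\1_(ball (0 : R) s) u| <= 1 :> R.
Proof. by rewrite indic_ball0; case: ltP => _; rewrite ?normr0 ?normr1. Qed.

Lemma box_norm_le s f : 0 < s -> intg f -> \int[mu]_x `|box s f x| <= \int[mu]_x `|f x|.
Proof.
move=> s0 fi; have s20 : 0 < 2 * s by rewrite mulr_gt0.
have bi := @intg_ball R 0 s.
have -> : \int[mu]_x `|box s f x| = (2 * s)^-1 * \int[mu]_x `|conv (\1_(ball (0 : R) s)) f x|.
  rewrite -Rintegral_intgZ; last by apply: intg_norm; exact: conv_intg.
  by apply: eq_Rintegral => x _; rewrite /box normrM gtr0_norm// invr_gt0.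
rewrite ler_pdivrMl//; apply: (le_trans (conv_norm_le bi fi)).
rewrite (_ : \int[mu]_x `|\1_(ball (0 : R) s) x| = 2 * s)// -(Rint_ball 0 (ltW s0)).
by apply: eq_Rintegral => x _; rewrite ger0_norm// indic_ball0.
Qed.

Lemma box_int s f : 0 < s -> intg f -> \int[mu]_x box s f x = \int[mu]_x f x.
Proof.
move=> s0 fi; have bi := @intg_ball R 0 s.
rewrite Rintegral_intgZ; last exact: conv_intg.
by rewrite Rintegral_conv// Rint_ball ?(ltW s0)// mulKf// gt_eqF// mulr_gt0.
Qed.

Lemma box_cvg_L1 (s : nat -> R) f : (forall n, 0 < s n) -> s n @[n --> \oo] --> 0 ->
  intg f -> \int[mu]_x `|box (s n) f x - f x| @[n --> \oo] --> 0.
Proof.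
move=> s0 cs fi; apply: scheffe => //.
- by move=> n; exact: box_intg.
- apply: ae_imp (ae_lebesgue_pt fi) _ => x lx.
  pose K (y u : R) : R := y^-1 * \1_(ball (0 : R) y) u.
  have h : conv (K y) f x @[y --> 0^'+] --> 2 * f x.
    apply: (lebesgue_pt_kernel fi lx (M := 2)).
    + by move=> y y0; apply: measurable_funM => //; exact: measurable_box_kernel.
    + move=> y u y0; rewrite /K indic_ball0; case: ltP => h; last first.
        by rewrite mulr0 normr0 mulr_ge0 ?pk_ge0.
      rewrite mulr1 gtr0_norm ?invr_gt0// /pk mulrA ler_pdivlMr ?den_gt0// ler_pdivrMl//.
      have : `|u| ^+ 2 <= y ^+ 2 by rewrite ler_sqr ?nnegrE// ltW.
      by rewrite real_normK ?num_real// expr2 => hu; move: hu; rewrite !expr2; lra.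
    + by move=> y y0; rewrite Rintegral_intgZ ?Rint_ball ?(ltW y0)//; [field; rewrite gt_eqF|exact: intg_ball].
  have {}h := cvg_at_right_seq h s0 cs.
  rewrite (_ : f x = 2^-1 * (2 * f x)); last by rewrite mulKf.
  have E n : box (s n) f x = 2^-1 * conv (K (s n)) f x.
    rewrite /box invfM -mulrA; congr (_ * _); rewrite /conv -Rintegral_intgZ.
      by apply: eq_Rintegral => t _; rewrite mulrA.
    exact: conv_integrand_bounded (measurable_box_kernel _) (box_kernel_le _) fi.
  by under eq_fun do rewrite E; apply: cvgM; [exact: cvg_cst|exact: h].
- by move=> n; exact: box_norm_le.
Qed.

(** [Q] and [P] commute with the average, so [Q (box f) = box (Q f) = box (P (hilbert f)) = P (box
    (hilbert f))], and the boundary values of the two ends are compared. *)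
Lemma hilbert_box s f : 0 < s -> intg f -> intg (hilbert f) ->
  {ae mu, forall x, hilbert (box s f) x = box s (hilbert f) x}.
Proof.
move=> s0 fi hi; have bi := @intg_ball R 0 s.
have bhi := box_intg s hi.
apply: hilbert_ae_eq; first exact: box_intg.
apply: ae_imp (ae_lebesgue_pt bhi) _ => x lx.
apply: (cvg0r_eq _ (lebesgue_pt_pk_cvg bhi lx)) => y y0.
have ci := conv_intg bi fi; have chi := conv_intg bi hi.
rewrite (convZr_pk _ _ y0 chi) (convZr_qk _ _ y0 ci); apply: (congr1 ( *%R _)).
rewrite (conv_comm _ (measurable_pk y0) (fun u => pk_norm_le u y0) bi hi).
rewrite (conv_comm _ (measurable_qk y0) (fun u => qk_le u y0) bi fi).
rewrite (_ : conv (qk y) f = conv (pk y) (hilbert f))//.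
by apply/funext => t; exact: H1_poisson.
Qed.

Lemma box_test s r f : 0 < s -> intg f -> (forall t, r <= `|t| -> f t = 0) ->
  \int[mu]_t f t = 0 -> H1_test (box s f).
Proof.
move=> s0 fi fr f0; split.
- exact: intg_measurable (box_intg s fi).
- exists ((2 * s)^-1 * \int[mu]_t `|f t|); split; first exact: num_real.
  move=> M hM x _ /=; apply: le_trans (ltW hM).
  rewrite normrM gtr0_norm ?invr_gt0 ?mulr_gt0// ler_wpM2l ?invr_ge0 ?mulr_ge0 ?(ltW s0)//.
  by have := conv_bounded x (measurable_box_kernel s) (box_kernel_le s) fi; rewrite mul1r.
- have sub : [set x | box s f x != 0] `<=` `[- (r + s), r + s].
    move=> x /= /eqP hx; rewrite in_itv /= -ler_norml leNgt; apply/negP => xr; apply: hx.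
    rewrite /box /conv (_ : (fun _ => _) = cst 0) ?Rintegral_cst ?mul0r ?mulr0//.
    apply/funext => t /=; have [h|h] := leP r `|t|; first by rewrite fr// mulr0.
    rewrite indic_ball0 ltNge (_ : s <= _) ?mul0r//.
    by have := ler_normD (x - t) t; rewrite subrK; lra.
  apply: (subclosed_compact (@closed_closure _ _) (@segment_compact R (- (r + s)) (r + s))).
  have := closure_subset sub.
  by rewrite -[closure [set` _]]((closure_id _).1 (interval_closed _ _)).
- by rewrite box_int.
Qed.

Lemma H1_cutoff f e : intg f -> intg (hilbert f) -> 0 < e ->
  exists2 g, [/\ intg g, intg (hilbert g), \int[mu]_t g t = 0 &
     exists r, forall t, r <= `|t| -> g t = 0] &
  \int[mu]_x `|g x - f x| < e /\ \int[mu]_x `|hilbert g x - hilbert f x| < e.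
Proof.
move=> fi hi e0.
(* Two scales are needed: [d] tends to infinity to make [v] and [w] small, while [d / r] tends to
   0. *)
pose d n : R := n.+1%:R; pose r n : R := n.+1%:R ^+ 2.
have d0 n : 0 < d n by rewrite ltr0n.
have dr n : d n <= r n by rewrite /r expr2 ler_peMr ?ler1n// ltW.
pose v n := \int[mu]_t (trim (d n) t * `|f t|).
pose w n := \int[mu]_t (trim (d n) t * `|hilbert f t|).
have cv : v n @[n --> \oo] --> 0 by exact: trim_cvg0.
have cw : w n @[n --> \oo] --> 0 by exact: trim_cvg0.
pose N := \int[mu]_t `|f t|.
have c1 : 2 * v n @[n --> \oo] --> 0.
  by rewrite -(mulr0 2); apply: cvgM => //; exact: cvg_cst.
have c2 : pi^-1 * (56 * v n + 4 * d n / r n * N + 5 * pi * v n) + w n @[n --> \oo] --> 0.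
  rewrite -[X in _ --> X](_ : pi^-1 * (56 * 0 + (4 * N) * 0 + 5 * pi * 0) + 0 = 0); last by rewrite !mulr0 !addr0 mulr0.
  apply: cvgD; last exact: cw.
  apply: cvgM; first exact: cvg_cst.
  apply: cvgD; last by apply: cvgM; [exact: cvg_cst|exact: cv].
  apply: cvgD; first by apply: cvgM; [exact: cvg_cst|exact: cv].
  have E n : 4 * d n / r n * N = 4 * N * n.+1%:R^-1.
    by rewrite /r -/(d n); field; rewrite gt_eqF.
  under eq_fun do rewrite E.
  by apply: cvgM; [exact: cvg_cst|exact: cvg_harmonic].
move/cvgr0Pnorm_lt : c1 => /(_ _ e0) c1; move/cvgr0Pnorm_lt : c2 => /(_ _ e0) c2.
have [n _ /(_ n (leqnn n))[h1 h2]] := filterI c1 c2.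
exists (cutoff f (r n)).
  split.
  - exact: cutoff_intg (d0 n) (dr n).
  - exact: (cutoff_hilbert fi hi (d0 n) (dr n)).1.
  - exact: cutoff_mean0 (d0 n) (dr n).
  - by exists (r n) => t; apply: cutoff_supp; [exact: d0 n|exact: dr].
split.
- apply: le_lt_trans (cutoff_L1 fi hi (d0 n) (dr n)) _; exact: le_lt_trans (ler_norm _) h1.
- apply: le_lt_trans (cutoff_hilbert fi hi (d0 n) (dr n)).2 _; exact: le_lt_trans (ler_norm _) h2.
Qed.

Lemma L1_dist_trans f g h : intg f -> intg g -> intg h ->
  \int[mu]_x `|h x - f x| <= \int[mu]_x `|h x - g x| + \int[mu]_x `|g x - f x|.
Proof.
move=> fi gi hi; rewrite -Rintegral_intgD; try by apply: intg_norm; exact: intgB.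
apply: le_Rint; first by apply: intg_norm; exact: intgB.
  by apply: intgD; apply: intg_norm; exact: intgB.
by move=> x; rewrite -[X in `|X|](subrKA (g x)) ler_normD.
Qed.

Lemma H1_test_dense f e : intg f -> intg (hilbert f) -> 0 < e ->
  exists2 g, H1_test g /\ intg g /\ intg (hilbert g) &
  \int[mu]_x `|g x - f x| < e /\ \int[mu]_x `|hilbert g x - hilbert f x| < e.
Proof.
move=> fi hi e0; have e20 : 0 < e / 2 by rewrite divr_gt0.
have [g [gi hgi g0 [r gr]] [h1 h2]] := H1_cutoff fi hi e20.
have n0 n : 0 < n.+1%:R^-1 :> R by rewrite invr_gt0.
have /cvgr0Pnorm_lt/(_ _ e20) b1 := box_cvg_L1 n0 (@cvg_harmonic R) gi.
have /cvgr0Pnorm_lt/(_ _ e20) b2 := box_cvg_L1 n0 (@cvg_harmonic R) hgi.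
have [n _ /(_ n (leqnn n))[/= k1 k2]] := filterI b1 b2.
move/(le_lt_trans (ler_norm _)) : k1 => k1; move/(le_lt_trans (ler_norm _)) : k2 => k2.
have bi := box_intg n.+1%:R^-1 gi.
have bhi := box_intg n.+1%:R^-1 hgi.
have ha := hilbert_box (n0 n) gi hgi.
have [hbi _] := Rintegral_ae bhi (measurable_hilbert bi) (ae_imp ha (fun x => @esym _ _ _)).
exists (box n.+1%:R^-1 g).
  by split; [exact: (box_test (n0 n) gi gr g0)|split].
split.
  by apply: (le_lt_trans (L1_dist_trans fi gi bi)); rewrite [e]splitr; exact: (ltrD k1 h1).
apply: (le_lt_trans (L1_dist_trans hi hgi hbi)).
have i1 : intg (fun x => `|box n.+1%:R^-1 (hilbert g) x - hilbert g x|).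
  by apply: intg_norm; exact: intgB.
have m2 : measurable_fun setT (fun x : R => `|hilbert (box n.+1%:R^-1 g) x - hilbert g x|).
  by apply: intg_measurable; apply: intg_norm; exact: intgB.
have [_ E] := Rintegral_ae i1 m2 (ae_imp ha (fun x hx => congr1 (fun u => `|u - hilbert g x|) (esym hx))).
by rewrite -E [e]splitr; exact: (ltrD k2 h2).
Qed.

End Density.

(** * The logarithm *)

Section Logarithm.
Context {R : realType}.
Local Notation mu := (@lebesgue_measure R).
Local Notation intg f := (mu.-integrable setT (EFin \o f)).
Implicit Types (f g h k : R -> R) (y u D : R).

(** [ln sqrt (u^2 + y^2)], a primitive of [qk y] and a smooth substitute for [ln |u|]. *)
Definition lk y u : R := ln (u ^+ 2 + y ^+ 2) / 2.

Lemma continuous_lk y : 0 < y -> continuous (lk y).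
Proof.
move=> y0 u; have h := is_derive_ln_qk u y0.
by apply: differentiable_continuous; apply/derivable1_diffP; apply: ex_derive.
Qed.

Lemma measurable_lk y : 0 < y -> measurable_fun setT (lk y).
Proof. by move=> y0; apply: continuous_measurable_fun; exact: continuous_lk. Qed.

Lemma lkN y u : lk y (- u) = lk y u.
Proof. by rewrite /lk sqrrN. Qed.

Lemma le_lk y u D : 0 < y -> `|u| <= `|D| -> lk y u <= lk y D.
Proof.
move=> y0 uD; rewrite /lk ler_pM2r ?invr_gt0// ler_ln ?posrE ?den_gt0// lerD2r.
by rewrite -(real_normK (num_real u)) -(real_normK (num_real D)) ler_sqr ?nnegrE.
Qed.

Lemma ln_sqr u : u != 0 -> ln (u ^+ 2) / 2 = ln `|u|.
Proof.
move=> u0; rewrite -(real_normK (num_real u)) lnXn ?normr_gt0//.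
by rewrite mulr2n -mulr2n -mulr_natl; field.
Qed.

Lemma ln_le_lk y u : 0 < y -> u != 0 -> ln `|u| <= lk y u.
Proof.
move=> y0 u0; rewrite -ln_sqr// /lk ler_pM2r ?invr_gt0// ler_ln ?posrE ?den_gt0//.
  by rewrite lerDl sqr_ge0.
by rewrite exprn_even_gt0.
Qed.

Lemma ln_cvg (z : nat -> R) (a : R) : 0 < a -> z n @[n --> \oo] --> a -> ln (z n) @[n --> \oo] --> ln a.
Proof. by move=> a0 za; apply: continuous_cvg => //; exact: continuous_ln. Qed.

Lemma lk_cvg u : u != 0 -> lk n.+1%:R^-1 u @[n --> \oo] --> ln `|u|.
Proof.
move=> u0; rewrite -ln_sqr//; apply: cvgM; last exact: cvg_cst.
apply: ln_cvg; first by rewrite exprn_even_gt0.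
rewrite -[X in _ --> X]addr0 -[X in _ --> _ + X](mulr0 (0 : R)); apply: cvgD; first exact: cvg_cst.
by under eq_fun do rewrite expr2; apply: cvgM; exact: cvg_harmonic.
Qed.

Lemma is_derive_lk_prim y u : 0 < y ->
  is_derive u (1 : R) (fun v : R => v * lk y v - v + y * atan (v / y)) (lk y u).
Proof.
move=> y0.
have d1 := @is_deriveM R _ id (lk y) u 1 _ _ (is_derive_id _ _) (is_derive_ln_qk u y0).
have d2 := @is_deriveB R _ _ _ id u 1 _ _ d1 (is_derive_id _ _).
have d3 := @is_deriveM R _ (cst y) (fun v : R => atan (v / y)) u 1 _ _ (is_derive_cst _ _ _) (is_derive_atan_pk u y0).
have d4 := @is_deriveD R _ _ _ _ u 1 _ _ d2 d3.
apply: (is_derive_eq d4).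
rewrite /= /GRing.scale /= mulr0 addr0 mulr1 /qk /pk.
by have := den_neq0 u y0 => dn; field.
Qed.

Lemma lk_int y D : 0 < y -> 0 < D ->
  \int[mu]_(u in `[- D, D]) (lk y D - lk y u) = 2 * D - 2 * (y * atan (D / y)).
Proof.
move=> y0 D0.
have dF (u : R) : is_derive u (1 : R) (fun u => u * lk y D - (u * lk y u - u + y * atan (u / y))) (lk y D - lk y u).
  have h1 := is_derive_affine (lk y D) 0 u.
  have {}h1 : is_derive u (1 : R) (fun v : R => v * lk y D) (lk y D).
    by move: h1; under eq_fun do rewrite addr0.
  exact: is_deriveB h1 (is_derive_lk_prim u y0).
have cf : continuous (fun u => lk y D - lk y u).
  by move=> u; apply: cvgB; [exact: cvg_cst|exact: continuous_lk].
rewrite (FTC_Rint _ cf dF); last by rewrite gtrN.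
by rewrite lkN [- D / y]mulNr atanN; ring.
Qed.

Lemma mem_itvN D u : (u \in [set` `[- D, D]]) = (`|u| <= D).
Proof. by apply/idP/idP; rewrite inE /= in_itv /= ler_norml. Qed.

Definition logw D u : R := \1_(ball (0 : R) D) u * `|ln D - ln `|u| |.

Lemma measurable_logw D : measurable_fun setT (logw D).
Proof.
apply: measurable_funM; first exact: measurable_box_kernel.
apply: measurableT_comp => //; apply: measurable_funB; first exact: measurable_cst.
by apply: (measurableT_comp (@measurable_ln R)); exact: normr_measurable.
Qed.

Lemma ae_neq (a : R) : {ae mu, forall x, x != a}.
Proof.
exists [set a]; split; [exact: measurable_set1|exact: lebesgue_measure_set1|].
by move=> x /= /negP; rewrite negbK => /eqP.
Qed.

(** The singularity at 0 is approached through [lk]: the integral of [lk y D - lk y u] over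
    [[-D, D]] is explicit and at most [2 D] for every [y], and Fatou passes to the limit. *)
Lemma logw_intg D : 0 < D -> intg (logw D) /\ \int[mu]_u logw D u <= 2 * D.
Proof.
move=> D0; have n0 n : 0 < n.+1%:R^-1 :> R by rewrite invr_gt0.
pose f n u := \1_(ball (0 : R) D) u * (lk n.+1%:R^-1 D - lk n.+1%:R^-1 u).
pose g n : R -> R := (fun u => lk n.+1%:R^-1 D - lk n.+1%:R^-1 u) \_ `[- D, D].
have gi n : intg (g n).
  apply: (restrict_EFin_intg _ _).1 => //; apply: (@continuous_intg_itv _ (fun u => lk n.+1%:R^-1 D - lk n.+1%:R^-1 u)).
  by move=> u; apply: cvgB; [exact: cvg_cst|exact: continuous_lk].
have fg n u : 0 <= f n u /\ f n u <= g n u.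
  rewrite /f /g indic_ball0 patchE mem_itvN.
  have h v : `|v| <= D -> 0 <= lk n.+1%:R^-1 D - lk n.+1%:R^-1 v.
    by move=> vD; rewrite subr_ge0; apply: le_lk => //; rewrite (gtr0_norm D0).
  case: ltP => uD; first by rewrite (ltW uD) mul1r h// ltW.
  by rewrite mul0r; split => //; case: ifPn => // uD'; exact: h.
have fi n : intg (f n).
  apply: le_intg (gi n).
    apply: measurable_funM; first exact: measurable_box_kernel.
    by apply: measurable_funB; [exact: measurable_cst|exact: measurable_lk].
  by move=> u; rewrite ger0_norm; [exact: (fg n u).2|exact: (fg n u).1].
apply: (@fatou_intg _ f).
- exact: fi.
- exact: measurable_logw.
- by move=> n u; exact: (fg n u).1.
- by move=> u; rewrite mulr_ge0// indic_ball0.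
- apply: ae_imp (ae_neq 0) _ => u u0; rewrite /f /logw indic_ball0.
  case: ltP => uD; last by under eq_fun do rewrite mul0r; rewrite mul0r; exact: cvg_cst.
  apply: cvgM; first exact: cvg_cst.
  rewrite ger0_norm; last by rewrite subr_ge0 ler_ln ?posrE ?normr_gt0 ?ltW.
  apply: cvgB; last exact: lk_cvg.
  by have := lk_cvg (lt0r_neq0 D0); rewrite gtr0_norm.
- move=> n; apply: (@le_trans _ _ (\int[mu]_u g n u)).
    by apply: le_Rint => // u; exact: (fg n u).2.
  rewrite -Rintegral_mkcond lk_int// gerBl mulr_ge0// mulr_ge0 ?(ltW (n0 n))//.
  by rewrite -(atan0 R) le_atan// divr_ge0 ?(ltW D0) ?(ltW (n0 n)).
Qed.

Lemma log_intg (A : R) : 0 < A -> intg (fun u => \1_(ball (0 : R) A) u * `|ln `|u| |).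
Proof.
move=> A0; have h : intg (fun u => logw A u + `|ln A| * \1_(ball (0 : R) A) u).
  by apply: intgD; [exact: (logw_intg A0).1|apply: intgZ; exact: intg_ball].
apply: le_intg h.
  apply: measurable_funM; first exact: measurable_box_kernel.
  apply: measurableT_comp => //; apply: (measurableT_comp (@measurable_ln R)); exact: normr_measurable.
move=> u; rewrite /logw indic_ball0; case: ltP => _; last by rewrite !mul0r mulr0 addr0 normr0.
rewrite !mul1r mulr1 normr_id -[X in `|X| <= _](subKr (ln A)) addrC.
by rewrite -[in leRHS](normrN (ln A - _)) ler_normD.
Qed.

End Logarithm.

(** * The logarithm has bounded mean oscillation *)

Section BMO.
Context {R : realType}.
Local Notation mu := (@lebesgue_measure R).
Local Notation intg f := (mu.-integrable setT (EFin \o f)).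
Variable b : R.

Definition psi_log (x : R) : R := ln (1 / `|x - b|).

Lemma psi_logE x : psi_log x = - ln `|x - b|.
Proof.
(* At [x = b] both sides vanish, by the conventions [0^-1 = 0] and [ln 0 = 0]. *)
rewrite /psi_log div1r; have [->|h] := eqVneq `|x - b| 0; first by rewrite invr0 ln0// oppr0.
by rewrite lnV// posrE lt_def h normr_ge0.
Qed.

Lemma measurable_psi_log : measurable_fun setT psi_log.
Proof.
rewrite (_ : psi_log = fun x => - ln `|x - b|); last by apply/funext => x; exact: psi_logE.
apply: measurableT_comp => //; apply: (measurableT_comp (@measurable_ln R)).
apply: measurableT_comp => //; exact: (@measurable_funD _ _ R setT id (cst (- b))).
Qed.

Lemma psi_log_intg (A : R) (f : R -> R) (M : R) : 0 < A -> measurable_fun setT f -> (forall x, `|f x| <= M) ->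
  (forall x, A <= `|x - b| -> f x = 0) -> intg (fun x => f x * psi_log x).
Proof.
move=> A0 mf fM fA; have M0 : 0 <= M by apply: le_trans (fM 0).
apply: le_intg (intgZ M (intg_shift (- b) (log_intg A0))).
  by apply: measurable_funM => //; exact: measurable_psi_log.
move=> x; rewrite psi_logE normrM normrN indic_ball0; case: ltP => h.
  by rewrite mul1r ler_wpM2r.
by rewrite fA// normr0 !mul0r mulr0.
Qed.

Lemma psi_log_integrable (K : set R) : measurable K -> bounded_set K ->
  mu.-integrable K (EFin \o psi_log).
Proof.
move=> mK [N [_ hN]]; pose A := `|N| + 1 + `|b| + 1.
have Kb x : K x -> `|x| <= `|N| + 1.
  by apply: hN; rewrite (le_lt_trans (ler_norm N))// ltrDl.
apply/restrict_EFin_intg => //.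
rewrite (_ : psi_log \_ K = fun x => \1_K x * psi_log x); last first.
  apply/funext => x; rewrite patchE indicE; case: ifPn => _; by rewrite ?mul1r ?mul0r.
apply: (@psi_log_intg A _ 1).
- by rewrite /A ltr_wpDl// addr_ge0// addr_ge0.
- exact: measurable_indic.
- by move=> x; rewrite indicE; case: (x \in K); rewrite ?normr1 ?normr0.
- move=> x; rewrite indicE => h; rewrite memNset// => /Kb Kx.
  by have := ler_normB x b; move: h Kx; rewrite /A; lra.
Qed.

Lemma psi_log_locally_integrable : locally_integrable setT psi_log.
Proof.
split; [exact: measurable_psi_log|exact: openT|move=> K _ cK].
have /integrableP[_ //] := psi_log_integrable (compact_measurable cK) (compact_bounded cK).
Qed.

Lemma itv_integrable_cst (p q c : R) : mu.-integrable `[p, q] (EFin \o cst c).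
Proof. by apply: continuous_intg_itv => x; exact: cvg_cst. Qed.

Lemma itv_integrableB (p q : R) (f g : R -> R) : mu.-integrable `[p, q] (EFin \o f) ->
  mu.-integrable `[p, q] (EFin \o g) -> mu.-integrable `[p, q] (EFin \o (fun x => f x - g x)).
Proof. by move=> fi gi; have := integrableB _ fi gi; apply; exact: measurable_itv. Qed.

Lemma itv_integrableD (p q : R) (f g : R -> R) : mu.-integrable `[p, q] (EFin \o f) ->
  mu.-integrable `[p, q] (EFin \o g) -> mu.-integrable `[p, q] (EFin \o (fun x => f x + g x)).
Proof. by move=> fi gi; have := integrableD _ fi gi; apply; exact: measurable_itv. Qed.

Lemma itv_Rint_cst (p q c : R) : p < q -> \int[mu]_(x in `[p, q]) c = c * (q - p).
Proof.
move=> pq; rewrite Rintegral_cst//; have h : mu `[p, q] = (q - p)%:E.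
  by rewrite lebesgue_measure_itv /= lte_fin pq EFinB.
transitivity (c * fine (q - p)%:E) => //; congr (_ * fine _); exact: h.
Qed.

(** Passing from a constant to the mean at most doubles the oscillation, since the mean is within
    [B] of the constant. *)
Lemma osc_le (f : R -> R) (p q c B : R) : p < q -> mu.-integrable `[p, q] (EFin \o f) ->
  \int[mu]_(x in `[p, q]) `|f x - c| <= B * (q - p) ->
  (q - p)^-1 * \int[mu]_(x in `[p, q])
    `|f x - (q - p)^-1 * \int[mu]_(x in `[p, q]) f x| <= 2 * B.
Proof.
move=> pq fi h; have l0 : 0 < q - p by rewrite subr_gt0.
set a := _^-1 * \int[mu]_(x in _) f x.
have mI := measurable_itv `[p, q].
have ci e := itv_integrable_cst p q e.
have fci e : mu.-integrable `[p, q] (EFin \o (fun x => f x - e)).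
  exact: (itv_integrableB fi (ci e)).
have nfci e : mu.-integrable `[p, q] (EFin \o (fun x => `|f x - e|)).
  exact: (integrable_norm (fci e)).
have ac : `|c - a| <= B.
  have -> : c - a = - ((q - p)^-1 * \int[mu]_(x in `[p, q]) (f x - c)).
    have -> : \int[mu]_(x in `[p, q]) (f x - c) = \int[mu]_(x in `[p, q]) f x - c * (q - p).
      by rewrite -(itv_Rint_cst c pq); rewrite RintegralB; [|exact: mI|exact: fi|exact: ci].
    rewrite mulrBr opprB; congr (_ - _).
    by rewrite [c * _]mulrC mulKf// gt_eqF.
  rewrite normrN normrM gtr0_norm ?invr_gt0// ler_pdivrMl// [leRHS]mulrC.
  by apply: le_trans h; apply: le_normr_Rintegral.
rewrite ler_pdivrMl//.
apply: (@le_trans _ _ (\int[mu]_(x in `[p, q]) (`|f x - c| + `|c - a|))).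
  apply: le_Rintegral => //.
    exact: (itv_integrableD (nfci c) (ci `|c - a|)).
  by move=> x _; rewrite -[X in `|X|](subrKA c) ler_normD.
have -> : \int[mu]_(x in `[p, q]) (`|f x - c| + `|c - a|) =
    \int[mu]_(x in `[p, q]) `|f x - c| + `|c - a| * (q - p).
  by rewrite -(itv_Rint_cst _ pq) RintegralD; [|exact: mI|exact: nfci|exact: ci].
have : `|c - a| * (q - p) <= B * (q - p) by rewrite ler_wpM2r// ltW.
by move: h; set X := \int[mu]_(x in _) _; lra.
Qed.

(** Compare with the value at the endpoint farthest from [b], at distance [D]. If [D <= 2 (q - p)],
    enlarging the interval to the ball of radius [D] about [b] gives at most [2 D <= 4 (q - p)].
    Otherwise all points are at distance at least [D - (q - p) > D / 2] from [b], and
    [ln (D / |x - b|) <= D / |x - b| - 1 <= 1]. *)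
Lemma psi_log_dev (p q : R) : p < q -> exists c,
  \int[mu]_(x in `[p, q]) `|psi_log x - c| <= 4 * (q - p).
Proof.
move=> pq; have l0 : 0 < q - p by rewrite subr_gt0.
pose D := Num.max `|p - b| `|q - b|.
have D0 : 0 < D.
  rewrite lt_max !normr_gt0 !subr_eq0; have [E|//] := eqVneq p b.
  by rewrite -E; move: pq; rewrite lt_neqAle eq_sym => /andP[].
have pD : `|p - b| <= D by rewrite le_max lexx.
have qD : `|q - b| <= D by rewrite le_max lexx orbT.
have xD x : p <= x <= q -> `|x - b| <= D.
  move=> /andP[px xq]; rewrite ler_norml.
  by move: pD qD; rewrite !ler_norml => /andP[h1 h2] /andP[h3 h4]; apply/andP; split; lra.
have dx x : p <= x <= q -> D - (q - p) <= `|x - b|.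
  move=> /andP[px xq]; rewrite lerBlDr ge_max; apply/andP; split.
    have := ler_normD (x - b) (p - x); rewrite addrC subrKA [X in _ <= _ + X]distrC (ger0_norm (_ : 0 <= x - p)) ?subr_ge0//.
    by lra.
  have := ler_normD (x - b) (q - x); rewrite addrC subrKA (ger0_norm (_ : 0 <= q - x)) ?subr_ge0//.
  by lra.
exists (- ln D).
have E x : psi_log x - - ln D = ln D - ln `|x - b| by rewrite psi_logE opprK addrC.
have mI := measurable_itv `[p, q].
have bI : bounded_set `[p, q]%classic by exact: compact_bounded (@segment_compact R p q).
have pi_ : mu.-integrable `[p, q] (EFin \o (fun x => `|psi_log x - - ln D|)).
  apply: integrable_norm; exact: (itv_integrableB (psi_log_integrable mI bI) (itv_integrable_cst p q _)).
have [Dl|Dl] := leP D (2 * (q - p)).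
  rewrite Rintegral_mkcond; apply: (@le_trans _ _ (\int[mu]_x logw D (x + (- b)))).
    apply: le_Rint.
    - exact: (restrict_EFin_intg _ mI).1 pi_.
    - by apply: intg_shift; exact: (logw_intg D0).1.
    move=> x; rewrite patchE; case: ifPn => [|_]; last by rewrite mulr_ge0// indic_ball0.
    rewrite inE /= in_itv /= => xI; rewrite E /logw indic_ball0.
    (* [logw] lives on the open ball; on its boundary the deviation is 0. *)
    have := xD x xI; rewrite le_eqVlt => /predU1P[->|->]; last by rewrite mul1r.
    by rewrite subrr normr0 mulr_ge0.
  rewrite (Rintegral_shift _ (logw_intg D0).1); apply: (le_trans (logw_intg D0).2).
  by lra.
apply: (@le_trans _ _ (\int[mu]_(x in `[p, q]) 1)); last first.
  by rewrite itv_Rint_cst//; move: l0; lra.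
apply: le_Rintegral => //; first exact: itv_integrable_cst.
move=> x /=; rewrite in_itv /= => xI; rewrite E.
have h1 := xD x xI; have h2 := dx x xI.
have x0 : 0 < `|x - b| by move: h2 Dl l0; lra.
rewrite ger0_norm; last by rewrite subr_ge0 ler_ln ?posrE.
have -> : ln D - ln `|x - b| = ln (1 + (D / `|x - b| - 1)).
  by rewrite addrCA subrr addr0 ln_div ?posrE.
have r0 : 0 < D / `|x - b| by rewrite divr_gt0.
apply: (le_trans (le_ln1Dx _)); first by move: r0; lra.
rewrite lerBlDr ler_pdivrMr//; move: h2 Dl l0; lra.
Qed.

Lemma BMO_psi_log : BMO psi_log.
Proof.
split; first exact: psi_log_locally_integrable.
exists (2 * 4) => p q pq; have [c hc] := psi_log_dev pq.
apply: osc_le hc => //; apply: psi_log_integrable => //.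
exact: compact_bounded (@segment_compact R p q).
Qed.

End BMO.

(** * The logarithmic potential of a test function *)

Section LogPotential.
Context {R : realType}.
Local Notation mu := (@lebesgue_measure R).
Local Notation intg f := (mu.-integrable setT (EFin \o f)).
Implicit Types (f g h k : R -> R) (y u D : R).

Lemma H1_testP h : H1_test h -> intg h /\ exists M r : R, [/\ 0 < r,
  forall t, `|h t| <= M & forall t, r <= `|t| -> h t = 0].
Proof.
move=> [mh [N [_ hN]] cK _].
have hM t : `|h t| <= N + 1 by apply: (hN (N + 1)); rewrite ?ltrDl.
have [L [_ hL]] := compact_bounded cK.
pose r := `|L| + 2; have r0 : 0 < r by rewrite /r ltr_wpDl.
have hr t : r <= `|t| -> h t = 0.
  move=> rt; apply/eqP/negPn/negP => ht.
  have : `|t| <= `|L| + 1.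
    apply: (hL (`|L| + 1)); first by rewrite (le_lt_trans (ler_norm L))// ltrDl.
    exact: subset_closure.
  by move: rt; rewrite /r; lra.
split; last by exists (N + 1), r.
have N0 : 0 <= N + 1 by apply: le_trans (hM 0).
apply: le_intg (intgZ (N + 1) (intg_ball 0 r)) => // t.
rewrite indic_ball0; case: ltP => rt; first by rewrite mulr1.
by rewrite mulr0 hr// normr0.
Qed.

Lemma is_derive_lk_shift (y t x : R) : 0 < y ->
  is_derive x (1 : R) (fun v : R => lk y (v - t)) (qk y (x - t)).
Proof.
move=> y0; have d1 : is_derive x (1 : R) (fun v : R => v - t) 1.
  by have := is_derive_affine 1 (- t) x; under eq_fun do rewrite mulr1.
have := @is_derive1_comp _ (lk y) (fun v : R => v - t) x _ _ (is_derive_ln_qk (x - t) y0) d1.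
by rewrite mulr1.
Qed.

Lemma qk_shift_int (y t p q : R) : 0 < y -> p < q ->
  \int[mu]_(x in `[p, q]) qk y (x - t) = lk y (q - t) - lk y (p - t).
Proof.
move=> y0 pq; apply: (@FTC_Rint _ _ (fun v : R => lk y (v - t))) => //.
  move=> x; apply: (@continuous_comp _ _ _ (fun x => x - t) (qk y)); last exact: continuous_qk.
  by apply: cvgB; [exact: cvg_id|exact: cvg_cst].
by move=> x; exact: is_derive_lk_shift.
Qed.

Lemma qk_conv_int (y p q : R) h : 0 < y -> p < q -> intg h ->
  intg (fun t => (lk y (q - t) - lk y (p - t)) * h t) /\
  \int[mu]_(x in `[p, q]) conv (qk y) h x = \int[mu]_t ((lk y (q - t) - lk y (p - t)) * h t).
Proof.
move=> y0 pq hi.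
pose ind x : R := \1_(`[p, q]%classic) x.
have indi : intg ind.
  have := (restrict_EFin_intg (cst 1) (measurable_itv `[p, q])).1 (itv_integrable_cst p q 1).
  rewrite (_ : (cst 1 : R -> R) \_ _ = ind)//; apply/funext => x.
  by rewrite patchE /ind indicE; case: ifPn.
have mind := intg_measurable indi.
pose B (x t : R) := qk y (x - t); pose F (x t : R) := ind x * h t.
have mB : measurable_fun setT (fun z : R * R => B z.1 z.2).
  exact: measurable_convk (measurable_qk y0).
have mF : measurable_fun setT (fun z : R * R => F z.1 z.2).
  apply: measurable_funM.
    by apply: (measurableT_comp mind); exact: measurable_fst.
  by apply: (measurableT_comp (intg_measurable hi)); exact: measurable_snd.
have fin := fubini_bounded mB mF (fun x t => qk_le (x - t) y0) (fubini_tensor indi hi).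
have mBF : measurable_fun setT (fun z : R * R => B z.1 z.2 * F z.1 z.2) by exact: measurable_funM.
have [_ _ i2 E] := @fubini_intg R (fun x t => B x t * F x t) mBF fin.
have restr (k : R -> R) : \int[mu]_x (ind x * k x) = \int[mu]_(x in `[p, q]) k x.
  rewrite [RHS]Rintegral_mkcond; apply: eq_Rintegral => x _.
  by rewrite patchE /ind indicE; case: ifPn; rewrite ?mul1r ?mul0r.
have lhs x : \int[mu]_t (B x t * F x t) = ind x * conv (qk y) h x.
  rewrite /conv -Rintegral_intgZ; last exact: conv_qk_intg.
  by apply: eq_Rintegral => t _; rewrite /F /B mulrCA.
have rhs t : \int[mu]_x (B x t * F x t) = (lk y (q - t) - lk y (p - t)) * h t.
  rewrite -qk_shift_int// -restr mulrC -Rintegral_intgZ.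
    by apply: eq_Rintegral => x _; rewrite /B /F; ring.
  under [X in intg X]eq_fun do rewrite mulrC.
  apply: (@intg_bounded _ _ _ y^-1) => //; last by move=> x; exact: qk_le.
  apply: (measurableT_comp (measurable_qk y0)); exact: (@measurable_funD _ _ R setT id (cst (- t))).
split; first by move: i2; under [X in intg X -> _]eq_fun do rewrite rhs.
rewrite -restr; transitivity (\int[mu]_x \int[mu]_t (B x t * F x t)).
  by apply: eq_Rintegral => x _; rewrite lhs.
by rewrite E; apply: eq_Rintegral => t _; rewrite rhs.
Qed.

(** Subtracting [ln A] is harmless against a function of mean zero. What remains is half the
    logarithm of a number [z] that [|t / A| <= 1/2] keeps between [1/4] and [9 + 4 y^2 / r^2]; then
    [ln z <= z] and [- ln z <= 1 / z <= 4] suffice. *)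
Lemma lk_far (y r t A : R) : 0 < y -> 0 < r -> `|t| < r -> 2 * r <= A ->
  `|lk y (- A - t) - ln A| <= 4 + (9 + 4 * y ^+ 2 / r ^+ 2) /\
  lk y (- A - t) - ln A = ln ((1 + t * A^-1) ^+ 2 + (y * A^-1) ^+ 2) / 2.
Proof.
move=> y0 r0 tr rA; have A0 : 0 < A by apply: lt_le_trans rA; rewrite mulr_gt0.
set z := (1 + _) ^+ 2 + _.
have E : lk y (- A - t) - ln A = ln z / 2.
  have z0 : 0 < z by rewrite ltr_wpDl ?sqr_ge0// exprn_gt0// mulr_gt0 ?invr_gt0.
  rewrite /lk (_ : (- A - t) ^+ 2 + y ^+ 2 = A ^+ 2 * z); last first.
    by rewrite /z; field; rewrite gt_eqF.
  rewrite lnM ?posrE ?exprn_gt0// mulrDl ln_sqr ?gt_eqF// gtr0_norm//.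
  by rewrite addrAC subrr add0r.
split => //; rewrite E.
have tA : `|t * A^-1| <= 2^-1.
  rewrite normrM [X in _ * X]gtr0_norm ?invr_gt0// ler_pdivrMr//.
  by move: tr rA; lra.
have /andP[t1 t2] : - 2^-1 <= t * A^-1 <= 2^-1 by rewrite -ler_norml.
have z1 : 4^-1 <= z.
  rewrite /z; have : 0 <= (y * A^-1) ^+ 2 by exact: sqr_ge0.
  by move: (t * A^-1) t1 t2 ((y * A^-1) ^+ 2) => a a1 a2 w w0; nra.
have yA : (y * A^-1) ^+ 2 <= y ^+ 2 / r ^+ 2.
  rewrite exprMn ler_wpM2l ?sqr_ge0// exprVn lef_pV2 ?posrE ?exprn_gt0//.
  by rewrite ler_sqr ?nnegrE ?(ltW A0) ?(ltW r0)//; move: rA r0; lra.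
have z2 : z <= 9 + 4 * y ^+ 2 / r ^+ 2.
  rewrite /z; move: yA; have : 0 <= y ^+ 2 / r ^+ 2 by rewrite divr_ge0 ?sqr_ge0.
  rewrite -mulrA; move: (t * A^-1) t1 t2 ((y * A^-1) ^+ 2) (y ^+ 2 / r ^+ 2) => a a1 a2 w v v0 wv; nra.
have z0 : 0 < z by apply: lt_le_trans z1.
have u1 : ln z <= z by apply/ltW; exact: ln_sublinear.
have u2 : - ln z <= 4.
  rewrite -lnV ?posrE//; apply: (@le_trans _ _ z^-1); first by apply/ltW; apply: ln_sublinear; rewrite invr_gt0.
  by rewrite -[4]invrK lef_pV2 ?posrE ?invr_gt0.
have v0 : 0 <= 4 * y ^+ 2 / r ^+ 2 by rewrite -mulrA mulr_ge0// divr_ge0 ?sqr_ge0.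
rewrite ler_norml; apply/andP; split; lra.
Qed.

Lemma lk_far_cvg (y r t : R) : 0 < y -> 0 < r -> `|t| < r ->
  lk y (- (2 * r + n.+1%:R) - t) - ln (2 * r + n.+1%:R) @[n --> \oo] --> 0.
Proof.
move=> y0 r0 tr; have rA n : 2 * r <= 2 * r + n.+1%:R by rewrite lerDl.
under eq_fun do rewrite (lk_far y0 r0 tr (rA _)).2.
have c : (2 * r + n.+1%:R)^-1 @[n --> \oo] --> 0.
  apply: (@squeeze_cvgr _ _ _ _ (fun=> 0) (fun n : nat => n.+1%:R^-1)); [|exact: cvg_cst|exact: cvg_harmonic].
  apply: nearW => n; rewrite invr_ge0 addr_ge0 ?mulr_ge0 ?(ltW r0)//= lef_pV2 ?posrE ?ltr_wpDl ?mulr_ge0 ?(ltW r0)//.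
  by rewrite lerDr mulr_ge0 ?(ltW r0).
rewrite -(mul0r (2^-1 : R)) -(ln1 R); apply: cvgM; last exact: cvg_cst.
apply: ln_cvg => //.
rewrite -[X in _ --> X](_ : (1 + t * 0) ^+ 2 + (y * 0) ^+ 2 = 1); last by ring.
rewrite !expr2; under eq_fun do rewrite !expr2.
have a : 1 + t * (2 * r + n.+1%:R)^-1 @[n --> \oo] --> 1 + t * 0.
  by apply: cvgD; [exact: cvg_cst|apply: cvgM; [exact: cvg_cst|exact: c]].
have d : y * (2 * r + n.+1%:R)^-1 @[n --> \oo] --> y * 0.
  by apply: cvgM; [exact: cvg_cst|exact: c].
by apply: cvgD; apply: cvgM.
Qed.

Lemma Rint_ray_cvg (b : R) (A : nat -> R) f : intg f -> (forall n, n%:R <= A n) ->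
  \int[mu]_(x in `[- A n, b]) f x @[n --> \oo] --> \int[mu]_(x in `]-oo, b]) f x.
Proof.
move=> fi nA; rewrite Rintegral_mkcond; under eq_fun do rewrite Rintegral_mkcond.
apply: (@dominated_cvgT _ _ _ (fun x => `|f x|)).
- by move=> n; apply: measurable_restrictR => //; exact: intg_measurable.
- by apply: measurable_restrictR => //; exact: intg_measurable.
- move=> x; apply: cvg_near_cst; near=> n; rewrite !patchE.
  suff -> : (x \in `[- A n, b]%classic) = (x \in `]-oo, b]%classic) by [].
  have h : - A n <= x.
    have : `|x| <= n%:R by near: n; exact: nbhs_infty_ger.
    by rewrite ler_norml => /andP[h1 _]; rewrite lerNl (le_trans _ (nA n))// lerNl.
  by apply/idP/idP; rewrite !inE /= !in_itv /= h.
- exact: intg_norm.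
- by move=> n x; rewrite patchE; case: ifPn => // _; rewrite normr0.
Unshelve. all: by end_near. Qed.

Lemma ray_aux (r b B a : R) : 0 < r -> 2 * (r + B + 1) <= a -> 0 <= B -> - b <= B -> - a < b.
Proof. lra. Qed.

Lemma qk_conv_ray (y b : R) h : 0 < y -> H1_test h -> intg (conv (qk y) h) ->
  \int[mu]_(x in `]-oo, b]) conv (qk y) h x = \int[mu]_t (lk y (b - t) * h t).
Proof.
move=> y0 ht ci; have [hi [M [r [r0 hM hr]]]] := H1_testP ht; have [_ _ _ h0] := ht.
(* [s] exceeds both the radius of the support of [h] and [|b|], as needed for [lk_far] and for
   [- A n < b]. *)
pose s := r + `|b| + 1.
have s0 : 0 < s by rewrite /s -addrA ltr_pwDl// addr_ge0.
have hs t : s <= `|t| -> h t = 0.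
  by move=> st; apply: hr; apply: le_trans st; rewrite /s -addrA lerDl addr_ge0.
pose A n : R := 2 * s + n.+1%:R.
have sA n : 2 * s <= A n by rewrite lerDl.
have nA n : n%:R <= A n by apply: (@le_trans _ _ n.+1%:R); rewrite ?ler_nat// lerDr mulr_ge0// ltW.
have Ab n : - A n < b.
  have := ler_norm (- b); have := normr_ge0 b; have := sA n; rewrite normrN /s.
  exact: ray_aux r0.
pose C := 4 + (9 + 4 * y ^+ 2 / s ^+ 2).
pose G n t := (lk y (- A n - t) - ln (A n)) * h t.
have mlk (a : R) : measurable_fun setT (fun t : R => lk y (a - t)).
  by apply: (measurableT_comp (measurable_lk y0)); exact: (@measurable_funB _ _ R setT (cst a) id).
have mG n : measurable_fun setT (G n).
  apply: measurable_funM; last exact: intg_measurable.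
  by apply: measurable_funB; [exact: mlk|exact: measurable_cst].
have Gb n t : `|G n t| <= C * `|h t|.
  have [st|st] := leP s `|t|; first by rewrite /G hs// mulr0 normr0 mulr0.
  by rewrite normrM ler_wpM2r//; exact: (lk_far y0 s0 st (sA n)).1.
have Gi n : intg (G n) by apply: le_intg (mG n) (Gb n) (intgZ C (intg_norm hi)).
have cG : \int[mu]_t G n t @[n --> \oo] --> 0.
  rewrite (_ : 0 = \int[mu]_t (0 : R)); last by rewrite Rintegral_cst// mul0r.
  apply: (@dominated_cvgT _ _ _ (fun t => C * `|h t|)) => //.
  - move=> t; have [st|st] := leP s `|t|.
      by rewrite /G hs//; under eq_fun do rewrite mulr0; exact: cvg_cst.
    rewrite -(mul0r (h t)); apply: cvgM; last exact: cvg_cst.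
    exact: lk_far_cvg.
  - by apply: intgZ; exact: intg_norm.
have hlni n : intg (fun t => ln (A n) * h t) by exact: intgZ.
have E n : \int[mu]_(x in `[- A n, b]) conv (qk y) h x = \int[mu]_t (lk y (b - t) * h t) - \int[mu]_t G n t.
  have [i1 ->] := qk_conv_int y0 (Ab n) hi.
  have i2 : intg (fun t => lk y (b - t) * h t).
    have := intgD (intgD i1 (Gi n)) (hlni n).
    by congr (intg _); apply/funext => t; rewrite /G; ring.
  (* The term [ln (A n) * \int h], which is 0, is added to bring in [G]. *)
  rewrite -Rintegral_intgB// -[LHS]addr0 -[X in _ + X](mulr0 (ln (A n))) -[X in _ * X]h0.
  rewrite -Rintegral_intgZ// -Rintegral_intgD//.
  by apply: eq_Rintegral => t _; rewrite /G; ring.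
have c1 := @Rint_ray_cvg b _ _ ci nA.
have c2 : \int[mu]_(x in `[- A n, b]) conv (qk y) h x @[n --> \oo] --> \int[mu]_t (lk y (b - t) * h t).
  rewrite -[X in _ --> X]subr0; under eq_fun do rewrite E.
  by apply: cvgB; [exact: cvg_cst|exact: cG].
exact: (cvg_unique (@Rhausdorff R) c1 c2).
Qed.

(** The regularization raises the logarithm, so [ln |u|] is a lower bound uniform in [y];
    monotonicity in [y] and [|u|] gives the upper bound [lk 1 D]. *)
Lemma lk_log_bound (y u D : R) : 0 < y -> y <= 1 -> u != 0 -> `|u| <= D ->
  `|lk y u| <= `|ln `|u| | + `|lk 1 D|.
Proof.
move=> y0 y1 u0 uD.
have h1 := ln_le_lk y0 u0.
have h2 : lk y u <= lk 1 D.
  rewrite /lk ler_pM2r ?invr_gt0// ler_ln ?posrE ?den_gt0// lerD//.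
    rewrite -(real_normK (num_real u)) ler_sqr ?nnegrE// (le_trans _ uD)//.
  by rewrite ler_sqr ?nnegrE// ltW.
have h3 := ler_norm (lk 1 D); have h4 := ler_norm (- ln `|u|).
rewrite normrN in h4.
rewrite ler_norml; apply/andP; split.
  by have := normr_ge0 (lk 1 D); lra.
by have := normr_ge0 (ln `|u|); lra.
Qed.

Lemma lk_test_cvg (b : R) h : H1_test h ->
  \int[mu]_t (lk n.+1%:R^-1 (b - t) * h t) @[n --> \oo] --> - \int[mu]_t (h t * psi_log b t).
Proof.
move=> ht; have [hi [M [r [r0 hM hr]]]] := H1_testP ht.
have n0 n : 0 < n.+1%:R^-1 :> R by rewrite invr_gt0.
have n1 n : n.+1%:R^-1 <= 1 :> R by rewrite invf_le1 ?ler1n.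
pose A := r + `|b|; have A0 : 0 < A by rewrite ltr_pwDl.
have hA t : A <= `|t - b| -> h t = 0.
  by move=> At; apply: hr; have := ler_normB t b; move: At; rewrite /A; lra.
have pi_ : intg (fun t => h t * psi_log b t).
  exact: (psi_log_intg A0 (intg_measurable hi) hM hA).
rewrite -[X in _ --> X]mulN1r -Rintegral_intgZ//.
have mlk n : measurable_fun setT (fun t : R => lk n.+1%:R^-1 (b - t)).
  by apply: (measurableT_comp (measurable_lk (n0 n))); exact: (@measurable_funB _ _ R setT (cst b) id).
have [] // := @dominated_cvgR _ setT (fun n t => lk n.+1%:R^-1 (b - t) * h t)
  (fun t => -1 * (h t * psi_log b t)) (fun t => `|h t * psi_log b t| + `|lk 1 A| * `|h t|).
- by move=> n; apply: measurable_funM; [exact: mlk|exact: intg_measurable].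
- by apply: intg_measurable; exact: intgZ.
- apply: ae_imp (ae_neq b) _ => t tb _.
  have -> : -1 * (h t * psi_log b t) = ln `|b - t| * h t by rewrite psi_logE distrC; ring.
  by apply: cvgM; [apply: lk_cvg; rewrite subr_eq0 eq_sym|exact: cvg_cst].
- by apply: intgD; [exact: intg_norm|apply: intgZ; exact: intg_norm].
- apply: ae_imp (ae_neq b) _ => t tb n _.
  have [At|At] := leP A `|t - b|; first by rewrite hA// !mulr0 mul0r normr0 mulr0 addr0.
  rewrite [`|lk _ _ * _|]normrM [`|h t * _|]normrM psi_logE normrN [leRHS]addrC [`|h t| * _]mulrC -mulrDl ler_wpM2r//.
  rewrite [leRHS]addrC [`|t - b|]distrC; apply: lk_log_bound => //.
    by rewrite subr_eq0 eq_sym.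
  by rewrite distrC ltW.
Qed.

Lemma Rint_ray_L1_cvg (b : R) (f_ : nat -> R -> R) f : (forall n, intg (f_ n)) -> intg f ->
  \int[mu]_x `|f_ n x - f x| @[n --> \oo] --> 0 ->
  \int[mu]_(x in `]-oo, b]) f_ n x @[n --> \oo] --> \int[mu]_(x in `]-oo, b]) f x.
Proof.
move=> fi_ fi h; have mray : measurable [set` `]-oo, b] : interval R] by [].
apply/cvgrPdist_le => e e0; move/cvgr0Pnorm_le : h => /(_ _ e0).
apply: filterS => n; apply: le_trans; apply: (le_trans _ (ler_norm _)).
have ri k (ki : intg k) := intg_restrict mray ki.
have rm (k : R -> R) : \int[mu]_(x in `]-oo, b]) k x = \int[mu]_x (k \_ `]-oo, b]) x by exact: Rintegral_mkcond.
rewrite distrC !rm -Rintegral_intgB; [|exact: ri (fi_ n)|exact: ri fi].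
apply: le_norm_Rint.
- by apply: intgB; [exact: ri (fi_ n)|exact: ri fi].
- by apply: intg_norm; exact: intgB.
- by move=> x; rewrite !patchE; case: ifPn => // _; rewrite subrr normr0.
Qed.

(** The Poisson smoothings of [hilbert h] are [Q h / pi], so their integrals over the ray are
    logarithmic potentials; these converge because smoothing converges in [L^1]. *)
Lemma test_identity (b : R) h : H1_test h -> intg (hilbert h) ->
  - pi * \int[mu]_(x in `]-oo, b]) hilbert h x = \int[mu]_t (h t * psi_log b t).
Proof.
move=> ht ghi; have [hi _] := H1_testP ht; have p0 := pi_gt0 R.
have n0 n : 0 < n.+1%:R^-1 :> R by rewrite invr_gt0.
have c1 := @Rint_ray_L1_cvg b _ _ (fun n => psm_intg (n0 n) ghi) ghi (psm_cvg_L1 n0 (@cvg_harmonic R) ghi).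
have E n : \int[mu]_(x in `]-oo, b]) psm n.+1%:R^-1 (hilbert h) x =
    pi^-1 * \int[mu]_t (lk n.+1%:R^-1 (b - t) * h t).
  have qE : conv (qk n.+1%:R^-1) h = conv (pk n.+1%:R^-1) (hilbert h).
    by apply/funext => x; exact: H1_poisson.
  have qi : intg (conv (qk n.+1%:R^-1) h) by rewrite qE; apply: conv_intg => //; exact: intg_pk.
  have rm (k : R -> R) : \int[mu]_(x in `]-oo, b]) k x = \int[mu]_x (k \_ `]-oo, b]) x by exact: Rintegral_mkcond.
  rewrite -qk_conv_ray// !rm -Rintegral_intgZ; last exact: (intg_restrict _ qi).
  apply: eq_Rintegral => x _; rewrite !patchE /psm -qE; case: ifPn => // _; by rewrite mulr0.
have c2 : \int[mu]_(x in `]-oo, b]) psm n.+1%:R^-1 (hilbert h) x @[n --> \oo] -->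
   pi^-1 * - \int[mu]_t (h t * psi_log b t).
  under eq_fun do rewrite E.
  by apply: cvgM; [exact: cvg_cst|exact: lk_test_cvg].
by rewrite (cvg_unique (@Rhausdorff R) c1 c2) mulrN mulNr mulrN opprK mulVKf ?gt_eqF.
Qed.

End LogPotential.

(** * The pairing *)

Section Pairing.
Context {R : realType}.
Local Notation mu := (@lebesgue_measure R).
Local Notation intg f := (mu.-integrable setT (EFin \o f)).
Implicit Types (f g h : R -> R).

Lemma H1P f : H1 f <-> intg f /\ intg (hilbert f).
Proof. by split => -[h1 h2]; split; exact/Lfun1_integrable. Qed.

Lemma intg_normE f : intg f -> (\int[mu]_x `|(f x)%:E| = (\int[mu]_x `|f x|)%:E)%E.
Proof.
by move=> fi; rewrite /Rintegral fineK//; apply: integrable_fin_num => //; exact: intg_norm.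
Qed.

Lemma H1normE f : H1 f ->
  H1norm f = (\int[mu]_x `|f x| + \int[mu]_x `|hilbert f x|)%:E.
Proof.
by move=> /H1P[fi hi]; rewrite /H1norm !Lnorm1 EFinD -intg_normE// -intg_normE.
Qed.

Lemma H1_comb (a : R) f g : H1 f -> H1 g -> H1 (fun x => a * f x + g x) /\
  {ae mu, forall x, a * hilbert f x + hilbert g x = hilbert (fun x => a * f x + g x) x}.
Proof.
move=> /H1P[fi hfi] /H1P[gi hgi].
have ci : intg (fun x => a * f x + g x) by apply: intgD => //; exact: intgZ.
have hci : intg (fun x => a * hilbert f x + hilbert g x) by apply: intgD => //; exact: intgZ.
have E := ae_imp (hilbert_linear_ae a fi gi) (fun x => @esym _ _ _).
split; last exact: E.
apply/H1P; split; first exact: ci.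
by have [] := Rintegral_ae hci (measurable_hilbert ci) E.
Qed.

Lemma represents_unique (psi : R -> R) L1 L2 f : represents psi L1 -> represents psi L2 ->
  H1 f -> L1 f = L2 f.
Proof.
move=> [_ c1 t1] [_ c2 t2] Hf; apply/eqP/negPn/negP => L12.
have e0 : 0 < `|L1 f - L2 f| / 2 by rewrite divr_gt0// normr_gt0 subr_eq0.
have [d1 d10 h1] := c1 f Hf _ e0; have [d2 d20 h2] := c2 f Hf _ e0.
pose d := Num.min d1 d2; have d0 : 0 < d by rewrite lt_min d10.
have /H1P[fi hfi] := Hf.
have d20' : 0 < d / 2 by exact: divr_gt0.
have [g [tg [gi hgi]] [k1 k2]] := H1_test_dense fi hfi d20'.
have Hg : H1 g by exact/H1P.
have [Hc ae] := H1_comb (-1) Hf Hg.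
have E : (fun x => -1 * f x + g x) = (fun x => g x - f x).
  by apply/funext => x; rewrite mulN1r addrC.
rewrite E in Hc ae.
have nd : (H1norm (fun x => (g x - f x)%R) < d%:E)%E.
  have i1 : intg (fun x => `|hilbert g x - hilbert f x|) by apply: intg_norm; exact: intgB.
  have /H1P[_ hci] := Hc.
  have [|_ e1] := Rintegral_ae i1 (intg_measurable (intg_norm hci)).
    by apply: ae_imp ae _ => x <-; rewrite mulN1r addrC.
  by rewrite (H1normE Hc) lte_fin -e1 [d]splitr; exact: (ltrD k1 k2).
have g1 : `|L1 g - L1 f| < `|L1 f - L2 f| / 2.
  by apply: h1 => //; apply: (lt_le_trans nd); rewrite lee_fin ge_min lexx.
have g2 : `|L2 g - L2 f| < `|L1 f - L2 f| / 2.
  by apply: h2 => //; apply: (lt_le_trans nd); rewrite lee_fin ge_min lexx orbT.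
have : `|L1 f - L2 f| <= `|L2 g - L2 f| + `|L1 g - L1 f|.
  have -> : L1 f - L2 f = (L2 g - L2 f) - (L1 g - L1 f) by rewrite (t1 g tg) (t2 g tg); ring.
  exact: ler_normB.
by move: g1 g2; lra.
Qed.

Variable b : R.

Definition ray_fun f : R := \int[mu]_(x in `]-oo, b]) hilbert f x.

Lemma ray_mkcond (k : R -> R) : \int[mu]_(x in `]-oo, b]) k x = \int[mu]_x (k \_ `]-oo, b]) x.
Proof. exact: Rintegral_mkcond. Qed.

Lemma ray_comb (a : R) f g : H1 f -> H1 g ->
  ray_fun (fun x => a * f x + g x) = a * ray_fun f + ray_fun g.
Proof.
move=> Hf Hg; have [/H1P[_ hci] E] := H1_comb a Hf Hg.
move/H1P : Hf => [_ hf]; move/H1P : Hg => [_ hg].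
have ri k (ki : intg k) := intg_restrict (measurable_itv `]-oo, b]) ki.
rewrite /ray_fun !ray_mkcond -Rintegral_intgZ; last exact: ri hf.
rewrite -Rintegral_intgD; [|exact: intgZ (ri _ hf)|exact: ri hg].
have i1 : intg (fun x => a * ((hilbert f) \_ `]-oo, b]) x + ((hilbert g) \_ `]-oo, b]) x).
  by apply: intgD; [exact: intgZ (ri _ hf)|exact: ri hg].
have [|_ -> //] := Rintegral_ae i1 (intg_measurable (ri _ hci)).
by apply: ae_imp E _ => x Ex; rewrite !patchE; case: ifPn => // _; rewrite mulr0 addr0.
Qed.

Lemma ray_le f : H1 f -> `|ray_fun f| <= \int[mu]_x `|hilbert f x|.
Proof.
move=> /H1P[_ hf]; have rf := intg_restrict (measurable_itv `]-oo, b]) hf.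
rewrite /ray_fun ray_mkcond; apply: le_norm_Rint => //; first exact: intg_norm.
by move=> x; rewrite patchE; case: ifPn => // _; rewrite normr0.
Qed.

(** [represents] asks for the integral formula on all test functions, whether or not they are known
    to lie in [H1]; outside [H1] the value is chosen so that the formula holds trivially. *)
Definition log_functional f : R :=
  if pselect (H1 f) then - pi * ray_fun f else \int[mu]_x (f x * psi_log b x).

Lemma log_functionalE f : H1 f -> log_functional f = - pi * ray_fun f.
Proof. by rewrite /log_functional; case: pselect. Qed.

Lemma represents_log_functional : represents (psi_log b) log_functional.
Proof.
split.
- move=> a f g Hf Hg; have [Hc _] := H1_comb a Hf Hg.
  by rewrite !log_functionalE// ray_comb// mulrDr mulrCA.
- move=> f Hf e e0; have p0 := pi_gt0 R.
  exists (e / pi); first exact: divr_gt0.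
  move=> g Hg.
  have [Hc _] := H1_comb (-1) Hf Hg.
  have E : (fun x => g x - f x) = (fun x => -1 * f x + g x).
    by apply/funext => x; rewrite mulN1r addrC.
  rewrite E H1normE// lte_fin => h.
  rewrite !log_functionalE// -mulrBr normrM normrN (gtr0_norm p0).
  have -> : ray_fun g - ray_fun f = ray_fun (fun x => -1 * f x + g x).
    by rewrite ray_comb// mulN1r addrC.
  rewrite -ltr_pdivlMl// mulrC; apply: le_lt_trans h.
  by apply: (le_trans (ray_le Hc)); rewrite lerDr; apply: Rintegral_ge0 => x _.
- move=> g tg; rewrite /log_functional; case: pselect => [Hg|//].
  by rewrite /ray_fun test_identity//; move/H1P : Hg => [].
Qed.

End Pairing.

Theorem theorem1 (R : realType) (f : R -> R) (b : R) (hf : H1 f) :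
  pi^-1 * H1_BMO_pairing f (fun x : R => ln (1 / `|x - b|))
  = - (\int[@lebesgue_measure R]_(x in `]-oo, b]) hilbert f x).
Proof.
(* [get] needs an inhabitant; the functional behind the value it picks is then compared with
   [log_functional] by uniqueness. *)
have ex : exists v, BMO (psi_log b) /\ exists2 L, represents (psi_log b) L & v = L f.
  exists (log_functional b f); split; first exact: BMO_psi_log.
  by exists (log_functional b) => //; exact: represents_log_functional.
have [_ [L rL]] := @getPex R [set v | BMO (psi_log b) /\ exists2 L, represents (psi_log b) L & v = L f] ex.
rewrite -/(psi_log b) /H1_BMO_pairing => ->.
rewrite (represents_unique rL (represents_log_functional b) hf) log_functionalE//.
by rewrite /ray_fun mulNr mulrN mulKf// gt_eqF// pi_gt0.
Qed.
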